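(* Let $s\ge 1$, let $a_1,\dots,a_s\in\mathbb{D}$ be pairwise distinct, let $p_1,\dots,p_s$ be real numbers with $p_k>-2$ for all $k$, and let $$h(z)=\prod_{k=1}^s\left|\frac{z-a_k}{1-\overline{a_k}z}\right|^{p_k}.$$ Let $K(z,\zeta)$ be the reproducing kernel of the weighted Bergman space $A^2_h$. Then for all $z,\zeta\in\mathbb{D}$, $$K(z,\zeta)=\frac{1}{(1-z\overline{\zeta})^2}+\sum_{k=1}^s\frac{\frac{p_k}{2}(1-|a_k|^2)}{(1-z\overline{\zeta})(1-z\overline{a_k})(1-a_k\overline{\zeta})}+\frac{J(z,\zeta)}{\overline{q^*(\zeta)}\,q^*(z)},$$ where $$J(z,\zeta)=\sum_{k=0}^{s-2}\sum_{j=0}^{s-2}\frac{K^{(k,j)}(0,0)}{k!\,j!}T_k(z)\overline{T_j(\zeta)}-\sum_{k=0}^{s-2}(k+1)T_k(z)\overline{T_k(\zeta)}-\sum_{k=1}^{s}\frac{p_k}{2}(1-|a_k|^2)L_k(z,\zeta).$$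
   Context: $\mathbb{D}=\{z\in\mathbb{C}:|z|<1\}$ and $d\sigma=\pi^{-1}dA$ is the normalized area measure on $\mathbb{D}$, so $\sigma(\mathbb{D})=1$. For an integrable weight $h\ge 0$ on $\mathbb{D}$, $A^2_h$ is the space of functions $f$ analytic in $\mathbb{D}$ with $\int_{\mathbb{D}}|f|^2h\,d\sigma<\infty$. If point evaluations on $A^2_h$ are bounded (which is the case for instance if $\inf_{\rho<|z|<1}h>0$ for some $\rho<1$, hence for the weights considered here), the reproducing kernel of $A^2_h$ is the unique function $K(z,\zeta)$ on $\mathbb{D}\times\mathbb{D}$, analytic in $z$ and in $\overline{\zeta}$, such that $$f(z)=\int_{\mathbb{D}}f(\zeta)K(z,\zeta)h(\zeta)\,d\sigma(\zeta),\qquad f\in A^2_h,\ z\in\mathbb{D}.$$ It satisfies $K(z,\zeta)=\overline{K(\zeta,z)}$. For integers $k,j\ge 0$, $$K^{(k,j)}(z,\zeta):=\frac{\partial^{k+j}}{\partial z^k\,\partial\overline{\zeta}^{\,j}}K(z,\zeta).$$ Polynomials: $q(z)=\prod_{k=1}^s(z-a_k)=\sum_{\ell=0}^s c_\ell z^\ell$ (so $c_s=1$), $q^*(z)=z^s\overline{q(1/\overline{z})}=\prod_{k=1}^s(1-\overline{a_k}z)$, and, for $1\le k\le s$, $q_k(z)=\prod_{1\le j\le s,\,j\ne k}(z-a_j)=\sum_{\ell=0}^{s-1}c_{k,\ell}z^\ell$ (so $c_{k,s-1}=1$). Further, $$T_k(z):=z^k\sum_{\ell=0}^{s-2-k}\overline{c_{s-\ell}}\,z^\ell,\qquad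 0\le k\le s-2,$$ $$L_k(z,\zeta):=\sum_{r=0}^{s-2}\left(z^r\sum_{\ell=0}^{s-2-r}\overline{c_{k,s-1-\ell}}\,z^\ell\right)\left(\overline{\zeta}^{\,r}\sum_{\ell=0}^{s-2-r}c_{k,s-1-\ell}\,\overline{\zeta}^{\,\ell}\right),\qquad 1\le k\le s.$$ Empty sums (e.g. $\sum_{r=0}^{-1}$, occurring when $s=1$) are zero. *)

(* Defs.v *)
From HB Require Import structures.
From mathcomp Require Import all_boot all_order all_algebra.
From mathcomp Require Import all_classical all_reals all_analysis.
From mathcomp Require Import complex.

Set Implicit Arguments.
Unset Strict Implicit.
Unset Printing Implicit Defensive.

Import Order.TTheory GRing.Theory Num.Theory.
Import numFieldNormedType.Exports.

Local Open Scope classical_set_scope.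
Local Open Scope ring_scope.
Local Open Scope complex_scope.

Section WeightedBergman.
Variable R : realType.
Local Notation C := (R[i]).

Definition disc : set C := [set z | `|z| < 1].

(* R[i]^o is R[i] as a normed space over itself, so that derivable and
   derive1n below are complex differentiation. *)
Definition analytic_on_disc (f : C -> C) : Prop :=
  forall z : C, disc z -> derivable (f : C^o -> C^o) z 1.

Definition plane_pt (x : measurableTypeR R * measurableTypeR R) : C :=
  x.1 +i* x.2.

Lemma invpi_ge0 : 0 <= (pi : R)^-1.
Proof. by rewrite invr_ge0 pi_ge0. Qed.

Definition sigma : set (measurableTypeR R * measurableTypeR R) -> \bar R :=
  mscale (NngNum invpi_ge0)
         ((@lebesgue_measure R) \x (@lebesgue_measure R))%E.
HB.instance Definition _ := Measure.on sigma.

Definition disc_int (f : C -> C) : C :=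
  (\int[sigma]_(x in plane_pt @^-1` disc) complex.Re (f (plane_pt x))) +i*
  (\int[sigma]_(x in plane_pt @^-1` disc) complex.Im (f (plane_pt x))).

Definition bergman_space (h : C -> R) : set (C -> C) :=
  [set f | analytic_on_disc f /\
    (\int[sigma]_(x in plane_pt @^-1` disc)
        (Normc.normc (f (plane_pt x)) ^+ 2 * h (plane_pt x))%:E < +oo)%E].

(* Analyticity in the conjugate of zeta is analyticity of w |-> K z (w^* ).
   The third clause says that the Riesz representer of evaluation at z is an
   element of the space; with it the integral below converges absolutely. *)
Definition reproducing_kernel (h : C -> R) (K : C -> C -> C) : Prop :=
  [/\ forall zeta, disc zeta -> analytic_on_disc (fun z => K z zeta),
      forall z, disc z -> analytic_on_disc (fun w => K z (w^*)%R),
      forall z, disc z -> bergman_space h (fun zeta => (K z zeta)^*%R) &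
      forall f, bergman_space h f -> forall z, disc z ->
        f z = disc_int (fun zeta => f zeta * K z zeta * (h zeta)%:C)].

(* The derivative in the conjugate variable is taken in w, at
   w = zeta^*, of w |-> K u (w^* ). *)
Definition mixed_deriv (K : C -> C -> C) (k j : nat) (z zeta : C) : C :=
  derive1n k ((fun u => derive1n j ((fun w => K u (w^*)%R) : C^o -> C^o)
                                 (zeta^*)) : C^o -> C^o) z.

Section Polynomials.
Variables (s : nat) (a : 'I_s -> C).

Definition qpoly : {poly C} := \prod_(k < s) ('X - (a k)%:P).

Definition qpoly_omit (k : 'I_s) : {poly C} :=
  \prod_(j < s | j != k) ('X - (a j)%:P).

Definition qstar (z : C) : C := \prod_(k < s) (1 - (a k)^* * z).

(* The index ranges 0 <= k <= s - 2 and 0 <= l <= s - 2 - k are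
   k < s.-1 and l < s.-1 - k; they are empty when s = 1. *)
Definition Tterm (k : nat) (z : C) : C :=
  z ^+ k * \sum_(l < s.-1 - k) (qpoly`_(s - l))^* * z ^+ l.

Definition Lterm (k : 'I_s) (z zeta : C) : C :=
  \sum_(r < s.-1)
    (z ^+ r *
       \sum_(l < s.-1 - r) ((qpoly_omit k)`_(s.-1 - l))^* * z ^+ l) *
    (zeta^* ^+ r *
       \sum_(l < s.-1 - r) (qpoly_omit k)`_(s.-1 - l) * zeta^* ^+ l).

Variable p : 'I_s -> R.

Definition weight (z : C) : R :=
  \prod_(k < s) Normc.normc ((z - a k) / (1 - (a k)^* * z)) `^ p k.

Definition pcoef (k : 'I_s) : C :=
  (p k / 2 * (1 - Normc.normc (a k) ^+ 2))%:C.

Definition Jfun (K : C -> C -> C) (z zeta : C) : C :=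
  \sum_(k < s.-1) \sum_(j < s.-1)
     mixed_deriv K k j 0 0 / ((k`!)%:R * (j`!)%:R)
       * Tterm k z * (Tterm j zeta)^*
  - \sum_(k < s.-1) (k.+1)%:R * Tterm k z * (Tterm k zeta)^*
  - \sum_(k < s) pcoef k * Lterm k z zeta.

End Polynomials.
End WeightedBergman.

(* Main.v *)
Require Import Defs.
From HB Require Import structures.
From mathcomp Require Import all_boot all_order all_algebra.
From mathcomp Require Import all_classical all_reals all_analysis.
From mathcomp Require Import complex.
From mathcomp Require Import measurable_realfun zify ring lra.

Set Implicit Arguments.
Unset Strict Implicit.
Unset Printing Implicit Defensive.

Import Order.TTheory GRing.Theory Num.Theory.
Import numFieldNormedType.Exports.

Local Open Scope classical_set_scope.
Local Open Scope ring_scope.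
Local Open Scope complex_scope.

(** The two kernels [K] and [kernel0], the latter being the explicit part of the
    formula, have the same moments of high order, so that their difference becomes
    a polynomial after multiplication by [q^*]; its coefficients are then read off
    at the origin.

    Everything rests on one integration by parts. If [F] is continuously
    differentiable off a finite set and is [O(1 - |z|^2)] at the circle, the area
    integral of its derivative in the conjugate variable vanishes ([limit_stokes]).
    Taking [F = f g^* (h - 1)] is possible because [h - 1] is [O(1 - |z|^2)]; when
    [g = q z^m] the zeros of [q] cancel the poles of the logarithmic derivative of
    [h], and one obtains, for [f] in the weighted space,
      [int f (g' + g m_h)^* h = int f (g')^*]   ([weighted_stokes]),
    where [m_h] is the sum of [(p_k / 2) (1 - |a_k|^2) / ((z - a_k) (1 - a_k^* z))].
    The function [g' + g m_h] extends to a bounded holomorphic function, to which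
    the reproducing property applies: the unweighted moments of [K z _] against
    [(q z^m)'] are therefore explicit ([kernel_moment]). A moment against
    [(q z^m)'] is, up to conjugation, the Taylor coefficient of index [m + s - 1]
    of the product of [q^*] with the function ([taylor_recip]), and the same
    coefficients are computed for [kernel0] ([taylor_kernel0]). Hence
    [q^* (K - kernel0)] is in each variable a polynomial of degree at most [s - 2]
    ([kernel1_poly], and [kernel_sym] for the other variable).

    A polynomial of degree at most [s - 2] of the form [q^* f] is the sum of
    [c_k T_k], with [c_k] the Taylor coefficients of [f], since [T_k] is the
    truncation of [z^k q^*] ([taylor_truncation]). Applying this in both variables
    gives the double sum of the formula with the mixed derivatives of [K - kernel0]
    at the origin; those of [kernel0] produce the two subtracted sums
    ([kernel0_part]).

    What is needed of complex analysis is obtained from the same integration by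
    parts. It yields the Bergman formula
    [f w = int f z (1 - w z^* )^-2] for integrable holomorphic functions
    ([bergman_projection]), whence Taylor coefficients as area integrals,
    differentiation under the integral sign and uniqueness ([taylor_eq0]).
    Holomorphic functions are there required to have continuous partial
    derivatives; [goursat] removes that requirement, by bisection of rectangles and
    the Bergman formula for a primitive. *)

(** * Modulus and measurability in the complex plane *)

Notation normc := Normc.normc.
Notation Re := complex.Re.
Notation Im := complex.Im.

Section ComplexModulus.
Variable R : realType.
Local Notation C := R[i].
Local Notation "x ^*" := (conjc x) : ring_scope.
Implicit Types z w : C.

Lemma normc_ge0 z : 0 <= normc z.
Proof. by case: z => a b /=; rewrite sqrtr_ge0. Qed.

Lemma normc_eq0 z : (normc z == 0) = (z == 0).
Proof.
apply/eqP/eqP => [/Normc.eq0_normc //|->]; exact: Normc.normc0.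
Qed.

Lemma normc_gt0 z : (0 < normc z) = (z != 0).
Proof. by rewrite lt_def normc_ge0 andbT normc_eq0. Qed.

Lemma normcM z w : normc (z * w) = normc z * normc w.
Proof. exact: Normc.normcM. Qed.

Lemma normcD z w : normc (z + w) <= normc z + normc w.
Proof. exact: le_normcD. Qed.

Lemma normcN z : normc (- z) = normc z.
Proof. exact: normcN. Qed.

Lemma normcB z w : normc (z - w) <= normc z + normc w.
Proof. by rewrite -(normcN w) normcD. Qed.

Lemma normc_distC z w : normc (z - w) = normc (w - z).
Proof. by rewrite -normcN opprB. Qed.

Lemma normc_sub_ge z w : normc z - normc w <= normc (z - w).
Proof. by rewrite lerBlDr -{1}(subrK w z) normcD. Qed.

Lemma normcV z : normc z^-1 = (normc z)^-1.
Proof. exact: Normc.normcV. Qed.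

Lemma normc1 : normc (1 : C) = 1.
Proof. exact: Normc.normc1. Qed.

Lemma normc0 : normc (0 : C) = 0.
Proof. exact: Normc.normc0. Qed.

Lemma normcX z n : normc (z ^+ n) = normc z ^+ n.
Proof.
by elim: n => [|n IH]; rewrite ?expr0 ?normc1 // !exprS normcM IH.
Qed.

Lemma normc_conj z : normc z^* = normc z.
Proof. by case: z => a b /=; rewrite sqrrN. Qed.

Lemma normc_real (x : R) : normc x%:C = `|x|.
Proof. by rewrite /= expr0n /= addr0 sqrtr_sqr. Qed.

Lemma normc_i : normc ('i : C) = 1.
Proof. by rewrite /= expr0n /= add0r expr1n sqrtr1. Qed.

Lemma normc_nat n : normc (n%:R : C) = n%:R.
Proof.
have -> : (n%:R : C) = (n%:R : R)%:C by rewrite rmorph_nat.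
by rewrite normc_real ger0_norm.
Qed.

Lemma sqr_normcE z : normc z ^+ 2 = Re z ^+ 2 + Im z ^+ 2.
Proof. by case: z => a b /=; rewrite sqr_sqrtr // addr_ge0 ?sqr_ge0. Qed.

Lemma mul_conjc z : z * z^* = (normc z ^+ 2)%:C.
Proof.
rewrite sqr_normcE; case: z => a b; simpc; rewrite /=.
by congr (_ +i* _); ring.
Qed.

Lemma Re_le_normc z : `|Re z| <= normc z.
Proof.
case: z => a b /=; rewrite -sqrtr_sqr ler_wsqrtr // lerDl sqr_ge0 //.
Qed.

Lemma Im_le_normc z : `|Im z| <= normc z.
Proof.
case: z => a b /=; rewrite -sqrtr_sqr ler_wsqrtr // lerDr sqr_ge0 //.
Qed.

Lemma normc_le_ReIm z : normc z <= `|Re z| + `|Im z|.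
Proof.
rewrite -(@ler_pXn2r _ 2) ?nnegrE ?normc_ge0 ?addr_ge0 //.
rewrite sqr_normcE -(real_normK (num_real (Re z))) -(real_normK (num_real (Im z))).
rewrite sqrrD -addrA lerD2l lerDr mulrn_wge0 // mulr_ge0 //.
Qed.

Lemma discE z : disc z = (normc z < 1) :> Prop.
Proof.
rewrite /disc /mkset -ltcR; congr (is_true _).
Qed.

Lemma disc_sqr z : disc z -> normc z ^+ 2 < 1.
Proof. by rewrite discE => h; rewrite expr_lt1 ?normc_ge0. Qed.

Lemma disc_box (a b : R) : disc (a +i* b) -> (-1 <= a <= 1) /\ (-1 <= b <= 1).
Proof.
rewrite discE => h; have := Re_le_normc (a +i* b); have := Im_le_normc (a +i* b).
by move: h; move: (normc _) => r h; rewrite [Re _]/= [Im _]/= !ler_norml; lra.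
Qed.

Lemma disc_conj z : disc z -> disc z^*.
Proof. by rewrite !discE normc_conj. Qed.

Lemma ReM z w : Re (z * w) = Re z * Re w - Im z * Im w.
Proof. by case: z w => [a b] [c d]. Qed.
Lemma ImM z w : Im (z * w) = Re z * Im w + Im z * Re w.
Proof. by case: z w => [a b] [c d]. Qed.
Lemma ReD z w : Re (z + w) = Re z + Re w.
Proof. by case: z w => [a b] [c d]. Qed.
Lemma ImD z w : Im (z + w) = Im z + Im w.
Proof. by case: z w => [a b] [c d]. Qed.
Lemma ReN z : Re (- z) = - Re z.
Proof. by case: z => [a b]. Qed.
Lemma ImN z : Im (- z) = - Im z.
Proof. by case: z => [a b]. Qed.
Lemma ReB z w : Re (z - w) = Re z - Re w.
Proof. by case: z w => [a b] [c d]. Qed.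
Lemma ImB z w : Im (z - w) = Im z - Im w.
Proof. by case: z w => [a b] [c d]. Qed.
Lemma Re_conj z : Re z^* = Re z.
Proof. by case: z. Qed.
Lemma Im_conj z : Im z^* = - Im z.
Proof. by case: z. Qed.

Lemma complex_eta z : Re z +i* Im z = z.
Proof. by case: z. Qed.

Lemma complexP z w : Re z = Re w -> Im z = Im w -> z = w.
Proof. by case: z w => [a b] [c d] /= -> ->. Qed.

End ComplexModulus.

Arguments Normc.normc : simpl never.

Section Measurability.
Variable R : realType.
Local Notation C := R[i].
Local Notation "x ^*" := (conjc x) : ring_scope.

Definition ccont (f : C -> C) (z : C) :=
  forall e : R, 0 < e -> exists2 d : R, 0 < d &
    forall w, normc (w - z) < d -> normc (f w - f z) < e.

Definition copen (A : set C) :=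
  forall z, A z -> exists2 d : R, 0 < d & forall w, normc (w - z) < d -> A w.

Lemma copen_disc : copen (@disc R).
Proof.
move=> z; rewrite discE => hz; exists (1 - normc z); first by rewrite subr_gt0.
by move=> w hw; rewrite discE -(subrK z w); apply: (le_lt_trans (normcD _ _)); lra.
Qed.

Lemma notin_open (s : seq C) z : z \notin s ->
  exists2 d : R, 0 < d & forall w, normc (w - z) < d -> w \notin s.
Proof.
elim: s => [|a s IH]; first by move=> _; exists 1.
rewrite in_cons negb_or => /andP[za /IH[d d0 hd]].
have h0 : 0 < normc (a - z) by rewrite normc_gt0 subr_eq0 eq_sym.
exists (Num.min d (normc (a - z))); first by rewrite lt_min d0.
move=> w; rewrite lt_min => /andP[/hd ws w2].
rewrite in_cons negb_or ws andbT; apply/eqP => wa.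
by rewrite wa ltxx in w2.
Qed.

(** An open set is the union of the rational squares that it contains. *)
Lemma copen_measurable (A : set C) : copen A ->
  measurable (@plane_pt R @^-1` A).
Proof.
move=> oA.
pose B (q : rat * rat * rat) : set (measurableTypeR R * measurableTypeR R) :=
  [set` `]ratr q.1.1 - ratr q.2, ratr q.1.1 + ratr q.2[ ] `*`
  [set` `]ratr q.1.2 - ratr q.2, ratr q.1.2 + ratr q.2[ ].
pose F q := if pselect (B q `<=` @plane_pt R @^-1` A) then B q else set0.
have -> : @plane_pt R @^-1` A = \bigcup_q F q.
  apply/seteqP; split => [[x y] /= hA|]; last first.
    by move=> [x y] [q _]; rewrite /F; case: pselect => // h; apply: h.
  have [d d0 hd] := oA _ hA.
  have [r] := rat_in_itvoo (divr_gt0 d0 (ltr0n R 4)).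
  rewrite in_itv /= => /andP[r0 r4].
  have hx : x - ratr r / 2 < x + ratr r / 2 by lra.
  have hy : y - ratr r / 2 < y + ratr r / 2 by lra.
  have [qx] := rat_in_itvoo hx; rewrite in_itv /= => /andP[qx1 qx2].
  have [qy] := rat_in_itvoo hy; rewrite in_itv /= => /andP[qy1 qy2].
  exists (qx, qy, r) => //.
  suff h0 : B (qx, qy, r) `<=` @plane_pt R @^-1` A.
    by rewrite /F; case: (pselect (_ `<=` _)) => [_ /=|//]; rewrite /B /=; split; rewrite /= in_itv /=; lra.
  move=> -[u v] /= []; rewrite /= !in_itv /= => /andP[u1 u2] /andP[v1 v2].
  apply: hd; apply: (le_lt_trans (normc_le_ReIm _)).
  rewrite /plane_pt /=; have : `|u - x| < 2 * ratr r by rewrite ltr_norml; lra.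
  have : `|v - y| < 2 * ratr r by rewrite ltr_norml; lra.
  by lra.
apply: countable_bigcupT_measurable => // q; rewrite /F; case: (pselect (_ `<=` _)) => //= _.
exact: measurableX.
Qed.

Local Notation D := (@plane_pt R @^-1` @disc R).

Lemma measurable_disc : measurable D.
Proof. by apply: copen_measurable; exact: copen_disc. Qed.

Lemma measurable_pt1 (a b : measurableTypeR R) : measurable [set (a, b)].
Proof.
rewrite (_ : [set _] = [set a] `*` [set b]); first exact: measurableX.
by apply/seteqP; split => [[x y] [-> ->]|[x y] [/= -> ->]].
Qed.

Lemma measurable_pts (s : seq C) : measurable [set x | @plane_pt R x \in s].
Proof.
elim: s => [|a s IH].
  rewrite (_ : mkset _ = set0) //; apply/seteqP; split => // x /=.
rewrite (_ : mkset _ = [set (Re a, Im a)] `|` [set x | @plane_pt R x \in s]).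
  apply: measurableU => //.
  exact: measurable_pt1.
apply/seteqP; split => [[x y]|[x y]] /=; rewrite in_cons.
  by case/orP => [/eqP <-|]; [left|right].
by case=> [[-> ->]|->]; rewrite ?orbT // /plane_pt /= complex_eta eqxx.
Qed.

Lemma measurable_fun_pts (s : seq C) (g : measurableTypeR R * measurableTypeR R -> R) :
  measurable_fun [set x | @plane_pt R x \in s] g.
Proof.
elim: s => [|a s IH].
  rewrite (_ : mkset _ = set0); first exact: measurable_fun_set0.
  by apply/seteqP; split => // x /=.
rewrite (_ : mkset _ = [set (Re a, Im a)] `|` [set x | @plane_pt R x \in s]).
  apply/measurable_funU => //.
  - exact: measurable_pt1.
  - exact: measurable_pts.
  by split => //; exact: measurable_fun_set1.
apply/seteqP; split => [[x y]|[x y]] /=; rewrite in_cons.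
  by case/orP => [/eqP <-|]; [left|right].
by case=> [[-> ->]|->]; rewrite ?orbT // /plane_pt /= complex_eta eqxx.
Qed.

Definition rcont (g : C -> R) (z : C) :=
  forall e : R, 0 < e -> exists2 d : R, 0 < d &
    forall w, normc (w - z) < d -> `|g w - g z| < e.

(** On a finite set every function is measurable, and its complement is open. *)
Lemma rcont_measurable (s : seq C) (g : C -> R) :
  (forall z, disc z -> z \notin s -> rcont g z) ->
  measurable_fun D (g \o @plane_pt R).
Proof.
move=> cg.
pose S := [set x | @plane_pt R x \in s].
pose U := @plane_pt R @^-1` [set z | disc z /\ z \notin s].
have copenU (B : set C) : copen B -> copen [set z | B z /\ z \notin s].
  move=> oB z [Bz /notin_open[d1 d10 h1]]; have [d d0 hd] := oB _ Bz.
  exists (Num.min d d1); first by rewrite lt_min d0.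
  by move=> w; rewrite lt_min => /andP[/hd w1 /h1 w2].
have mS : measurable S by exact: measurable_pts.
have mU : measurable U by apply: copen_measurable; apply: copenU; exact: copen_disc.
suff : measurable_fun (U `|` S) (g \o @plane_pt R).
  apply: measurable_funS; first exact: measurableU.
  move=> x Dx; have [xs|xs] := boolP (plane_pt x \in s); [by right|by left].
apply/measurable_funU => //; split; last exact: measurable_fun_pts.
apply: (measurability _ (RGenOInfty.measurableE R)) => _ [_ [a ->] <-].
rewrite (_ : _ `&` _ = @plane_pt R @^-1` [set z | (disc z /\ a < g z) /\ z \notin s]); last first.
  apply/seteqP; split => x /=; rewrite in_itv /= andbT; first by move=> [[? ?] ?].
  by move=> [[? ?] ?].
apply: copen_measurable; move=> z [[dz az] zs].
have ga0 : 0 < g z - a by rewrite subr_gt0.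
have [d d0 hd] := cg _ dz zs _ ga0.
have [d1 d10 hd1] := copenU _ copen_disc _ (conj dz zs).
exists (Num.min d d1); first by rewrite lt_min d0.
move=> w; rewrite lt_min => /andP[w1 w2]; have [dw ws] := hd1 _ w2; split => //; split => //.
by have := hd _ w1; rewrite ltr_norml; lra.
Qed.

End Measurability.

(** * Integrals over the disc *)

Section DiscIntegral.
Variable R : realType.
Local Notation C := R[i].
Local Notation "x ^*" := (conjc x) : ring_scope.
Local Notation D := (@plane_pt R @^-1` @disc R).
Implicit Types (f g : C -> C) (u v : C -> R).

Definition rint u := \int[@sigma R]_(x in D) u (plane_pt x).

Definition rintegrable u :=
  (@sigma R).-integrable D (fun x => (u (plane_pt x))%:E).

Definition rmeas u := measurable_fun D (u \o @plane_pt R).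
Definition cmeas f := rmeas (fun z => Re (f z)) /\ rmeas (fun z => Im (f z)).

Definition cintegrable f :=
  rintegrable (fun z => Re (f z)) /\ rintegrable (fun z => Im (f z)).

Lemma eq_rintegrable u v : (forall z, disc z -> u z = v z) ->
  rintegrable u -> rintegrable v.
Proof.
move=> uv; apply: eq_integrable => [|x]; first exact: measurable_disc.
by rewrite inE => /= Dx; rewrite uv.
Qed.

Lemma eq_cintegrable f g : (forall z, disc z -> f z = g z) ->
  cintegrable f -> cintegrable g.
Proof.
by move=> fg [f1 f2]; split; [apply: eq_rintegrable f1|apply: eq_rintegrable f2];
  move=> z /fg ->.
Qed.

Lemma rintegrable_le u v : rmeas u -> rintegrable v ->
  (forall z, disc z -> `|u z| <= v z) -> rintegrable u.
Proof.
move=> mu iv uv; apply: le_integrable iv; first exact: measurable_disc.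
  exact/measurable_EFinP.
move=> x /= Dx; by rewrite lee_fin (le_trans (uv _ Dx)) // ler_norm.
Qed.

Lemma rintegrableD u v : rintegrable u -> rintegrable v ->
  rintegrable (fun z => u z + v z).
Proof. by move=> iu iv; have := integrableD (@measurable_disc R) iu iv. Qed.

Lemma rintegrableN u : rintegrable u -> rintegrable (fun z => - u z).
Proof. by move=> iu; have := integrableN iu. Qed.

Lemma rintegrableB u v : rintegrable u -> rintegrable v ->
  rintegrable (fun z => u z - v z).
Proof. by move=> iu iv; exact: rintegrableD (rintegrableN iv). Qed.

Lemma rintegrableZ k u : rintegrable u -> rintegrable (fun z => k * u z).
Proof. by move=> iu; have := integrableZl (@measurable_disc R) k iu. Qed.

Lemma rintegrable_norm u : rintegrable u -> rintegrable (fun z => `|u z|).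
Proof. by move=> iu; have := integrable_norm iu. Qed.

Lemma rintegrable_cst (k : R) : rintegrable (fun=> k).
Proof.
suff h : (@sigma R).-integrable D (cst 1%:E).
  by apply: (eq_rintegrable (u := fun z => k * 1)); [move=> z _; rewrite mulr1
    |exact: rintegrableZ].
apply/integrableP; split => //.
under eq_integral do rewrite /= normr1.
rewrite integral_cst //=; last exact: measurable_disc.
rewrite mul1e /sigma /mscale /=.
have h : ((@lebesgue_measure R \x @lebesgue_measure R)%E D < +oo)%E.
  pose Q : set (measurableTypeR R) := `[-1, 1]%classic.
  apply: (@le_lt_trans _ _ ((@lebesgue_measure R \x @lebesgue_measure R)%E (Q `*` Q))).
    apply: le_measure; rewrite ?inE.
    - exact: measurable_disc.
    - by apply: measurableX; exact: measurable_itv.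
    by move=> [x y] /= /disc_box[hx hy]; rewrite /Q /= !in_itv.
  rewrite product_measure1E; try exact: measurable_itv.
  have hQ : @lebesgue_measure R Q = 2%:E.
    rewrite /Q lebesgue_measure_itv /= lte_fin (_ : -1 < 1 = true) ?oppr_lt0 //.
      by rewrite -EFinD; congr EFin; lra.
    by apply/idP; lra.
  rewrite -[X in (X < _)%E]/(@lebesgue_measure R Q * @lebesgue_measure R Q)%E hQ.
  by rewrite -EFinM ltry.
have : (0 <= (@lebesgue_measure R \x @lebesgue_measure R)%E D)%E by [].
move: h; case: (_ D) => // r _ _; by rewrite -EFinM ltry.
Qed.

Lemma rint_ge0 u : (forall z, disc z -> 0 <= u z) -> 0 <= rint u.
Proof. by move=> u0; apply: Rintegral_ge0 => x /= Dx; exact: u0. Qed.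

Lemma le_rint u v : rintegrable u -> rintegrable v ->
  (forall z, disc z -> u z <= v z) -> rint u <= rint v.
Proof.
move=> iu iv uv; apply: le_Rintegral => //; first exact: measurable_disc.
by move=> x /= Dx; exact: uv.
Qed.

Lemma eq_rint u v : (forall z, disc z -> u z = v z) -> rint u = rint v.
Proof. by move=> uv; apply: eq_Rintegral => x /[!inE] /= Dx; exact: uv. Qed.

Lemma rintD u v : rintegrable u -> rintegrable v ->
  rint (fun z => u z + v z) = rint u + rint v.
Proof. by move=> iu iv; rewrite /rint RintegralD //; exact: measurable_disc. Qed.

Lemma rintZ k u : rintegrable u -> rint (fun z => k * u z) = k * rint u.
Proof. by move=> iu; rewrite /rint RintegralZl //; exact: measurable_disc. Qed.

Lemma rintN u : rintegrable u -> rint (fun z => - u z) = - rint u.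
Proof.
move=> iu; rewrite -mulN1r -rintZ //; apply: eq_rint => z _; by rewrite mulN1r.
Qed.

Lemma normr_rint u : rintegrable u -> `|rint u| <= rint (fun z => `|u z|).
Proof. by move=> iu; apply: le_normr_Rintegral => //; exact: measurable_disc. Qed.

Lemma disc_intE f :
  disc_int f = rint (fun z => Re (f z)) +i* rint (fun z => Im (f z)).
Proof. by []. Qed.

Lemma eq_disc_int f g : (forall z, disc z -> f z = g z) ->
  disc_int f = disc_int g.
Proof.
move=> fg; rewrite !disc_intE.
by congr (_ +i* _); apply: eq_rint => z /fg ->.
Qed.

Lemma cintegrable_le f v : cmeas f -> rintegrable v ->
  (forall z, disc z -> normc (f z) <= v z) -> cintegrable f.
Proof.
move=> [m1 m2] iv fv; split; apply: (rintegrable_le _ iv) => // z /fv;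
  apply: le_trans; [exact: Re_le_normc|exact: Im_le_normc].
Qed.

Lemma cintegrableD f g : cintegrable f -> cintegrable g ->
  cintegrable (fun z => f z + g z).
Proof.
move=> [f1 f2] [g1 g2]; split.
  apply: eq_rintegrable (rintegrableD f1 g1) => z _; by rewrite ReD.
apply: eq_rintegrable (rintegrableD f2 g2) => z _; by rewrite ImD.
Qed.

Lemma cintegrableZ k f : cintegrable f -> cintegrable (fun z => k * f z).
Proof.
move=> [f1 f2]; split.
  apply: eq_rintegrable
    (rintegrableB (rintegrableZ (Re k) f1) (rintegrableZ (Im k) f2)) => z _.
  by rewrite ReM.
apply: eq_rintegrable
  (rintegrableD (rintegrableZ (Re k) f2) (rintegrableZ (Im k) f1)) => z _.
by rewrite ImM.
Qed.

Lemma cintegrableN f : cintegrable f -> cintegrable (fun z => - f z).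
Proof.
move=> /(cintegrableZ (-1)); apply: eq_cintegrable => z _; by rewrite mulN1r.
Qed.

Lemma cintegrableB f g : cintegrable f -> cintegrable g ->
  cintegrable (fun z => f z - g z).
Proof. by move=> i1 i2; exact: cintegrableD i1 (cintegrableN i2). Qed.

Lemma cintegrable_cst k : cintegrable (fun=> k).
Proof. by split; exact: rintegrable_cst. Qed.

Lemma disc_intD f g : cintegrable f -> cintegrable g ->
  disc_int (fun z => f z + g z) = disc_int f + disc_int g.
Proof.
move=> [f1 f2] [g1 g2]; rewrite !disc_intE; apply: complexP => /=.
  by rewrite -rintD //; apply: eq_rint => z _; rewrite ReD.
by rewrite -rintD //; apply: eq_rint => z _; rewrite ImD.
Qed.

Lemma disc_intZ k f : cintegrable f ->
  disc_int (fun z => k * f z) = k * disc_int f.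
Proof.
move=> [f1 f2]; rewrite !disc_intE; apply: complexP; rewrite ?ReM ?ImM /=.
  rewrite -!rintZ // -rintN; last exact: rintegrableZ.
  rewrite -rintD; [|exact: rintegrableZ|apply: rintegrableN; exact: rintegrableZ].
  by apply: eq_rint => z _; rewrite ReM.
rewrite -!rintZ // -rintD; [|exact: rintegrableZ..].
by apply: eq_rint => z _; rewrite ImM.
Qed.

Lemma disc_intN f : cintegrable f -> disc_int (fun z => - f z) = - disc_int f.
Proof.
move=> i1; rewrite -mulN1r -disc_intZ //; apply: eq_disc_int => z _.
by rewrite mulN1r.
Qed.

Lemma disc_intB f g : cintegrable f -> cintegrable g ->
  disc_int (fun z => f z - g z) = disc_int f - disc_int g.
Proof.
by move=> i1 i2; rewrite disc_intD ?disc_intN //; exact: cintegrableN.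
Qed.

Lemma disc_int_conj f : cintegrable f ->
  disc_int (fun z => (f z)^*) = (disc_int f)^*.
Proof.
move=> [f1 f2]; rewrite !disc_intE; apply: complexP; rewrite ?Re_conj ?Im_conj /=.
  by apply: eq_rint => z _; rewrite Re_conj.
by rewrite -rintN //; apply: eq_rint => z _; rewrite Im_conj.
Qed.

Lemma cintegrable_sum (I : Type) (r : seq I) (F : I -> C -> C) :
  (forall i, cintegrable (F i)) ->
  cintegrable (fun z => \sum_(i <- r) F i z).
Proof.
move=> iF; elim: r => [|i r IH].
  apply: eq_cintegrable (cintegrable_cst 0) => z _; by rewrite big_nil.
apply: eq_cintegrable (cintegrableD (iF i) IH) => z _; by rewrite big_cons.
Qed.

Lemma disc_int0 : disc_int (fun=> 0 : C) = 0.
Proof.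
rewrite (_ : (fun=> 0) = (fun=> 0 * 0 : C)).
  by rewrite (disc_intZ 0 (cintegrable_cst 0)) mul0r.
by apply/funext => z; rewrite mul0r.
Qed.

Lemma disc_int_sum (I : Type) (r : seq I) (F : I -> C -> C) :
  (forall i, cintegrable (F i)) ->
  disc_int (fun z => \sum_(i <- r) F i z) = \sum_(i <- r) disc_int (F i).
Proof.
move=> iF; elim: r => [|i r IH].
  rewrite big_nil -[RHS]disc_int0; apply: eq_disc_int => z _; exact: big_nil.
rewrite big_cons -IH -disc_intD //; last exact: cintegrable_sum.
by apply: eq_disc_int => z _; rewrite big_cons.
Qed.

(** The factor 2 comes from bounding the real and imaginary parts separately. *)
Lemma normc_disc_int f v : cintegrable f -> rintegrable v ->
  (forall z, disc z -> normc (f z) <= v z) ->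
  normc (disc_int f) <= 2 * rint v.
Proof.
move=> [f1 f2] iv fv; rewrite disc_intE (le_trans (normc_le_ReIm _)) //=.
rewrite mulr_natl mulr2n lerD // (le_trans (normr_rint _)) //;
  apply: le_rint => //; try (exact: rintegrable_norm) => //.
- by move=> z /fv; apply: le_trans; exact: Re_le_normc.
- by move=> z /fv; apply: le_trans; exact: Im_le_normc.
Qed.

(** Limits under the integral sign, for a sequence of null integrals. *)
Lemma rint_dominated0 (u_ : nat -> C -> R) u v :
  (forall n, rmeas (u_ n)) -> rmeas u -> rintegrable v ->
  (forall n z, disc z -> `|u_ n z| <= v z) ->
  (forall z, disc z -> u_ n z @[n --> \oo] --> u z) ->
  (forall n, rint (u_ n) = 0) -> rint u = 0.
Proof.
move=> mu_ mu iv uv cu u0.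
have [|||||iu _] := @dominated_convergence _ _ R (@sigma R) D (@measurable_disc R)
  (fun n x => (u_ n (plane_pt x))%:E) (fun x => (u (plane_pt x))%:E)
  (fun x => (v (plane_pt x))%:E) .
- by move=> n; apply/measurable_EFinP; exact: mu_.
- exact/measurable_EFinP.
- by apply: aeW => x Dx; apply/fine_cvgP; split; [exact: nearW|exact: cu].
- exact: iv.
- by apply: aeW => x n Dx; rewrite lee_fin; exact: uv.
move=> h.
have int_ n : rintegrable (u_ n) by exact: rintegrable_le iv (uv n).
have e0 n : (\int[@sigma R]_(x in D) (u_ n (plane_pt x))%:E = 0)%E.
  have := integrable_fin_num (@measurable_disc R) (int_ n).
  by move=> /fineK <-; rewrite -[fine _]/(rint (u_ n)) u0.
rewrite /rint /Rintegral.
suff -> : (\int[@sigma R]_(x in D) (u (plane_pt x))%:E = 0)%E by [].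
apply: (@cvg_unique _ (@ereal_hausdorff R) _ _ _ _ h).
change ((fun n => (\int[@sigma R]_(x in D) (u_ n (plane_pt x))%:E)%E) @ \oo
  --> (0%E : \bar R)).
rewrite (funext e0); exact: cvg_cst.
Qed.

Lemma disc_int_dominated0 (f_ : nat -> C -> C) f v :
  (forall n, cmeas (f_ n)) -> cmeas f -> rintegrable v ->
  (forall n z, disc z -> normc (f_ n z) <= v z) ->
  (forall z, disc z -> Re (f_ n z) @[n --> \oo] --> Re (f z)) ->
  (forall z, disc z -> Im (f_ n z) @[n --> \oo] --> Im (f z)) ->
  (forall n, disc_int (f_ n) = 0) -> disc_int f = 0.
Proof.
move=> mf_ [mf1 mf2] iv fv c1 c2 f0; rewrite disc_intE; apply: complexP => /=.
  apply: (rint_dominated0 (fun n => (mf_ n).1) mf1 iv) => //.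
    by move=> n z /(fv n); apply: le_trans; exact: Re_le_normc.
  by move=> n; have := f0 n; rewrite disc_intE => -[].
apply: (rint_dominated0 (fun n => (mf_ n).2) mf2 iv) => //.
  by move=> n z /(fv n); apply: le_trans; exact: Im_le_normc.
by move=> n; have := f0 n; rewrite disc_intE => -[].
Qed.

End DiscIntegral.

(** * Integrating derivatives along chords *)

Section LineCalculus.
Variable R : realType.
Local Notation C := R[i].
Local Notation "x ^*" := (conjc x) : ring_scope.

Definition cder (g : R -> C) (t : R) (A : C) : Prop :=
  is_derive t 1 (fun x => Re (g x)) (Re A) /\
  is_derive t 1 (fun x => Im (g x)) (Im A).

Definition cline (g : R -> C) (t : R) : Prop :=
  {for t, continuous (fun x => Re (g x))} /\
  {for t, continuous (fun x => Im (g x))}.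

Lemma nbhs_dist (t : R) (P : R -> Prop) :
  (exists2 d : R, 0 < d & forall x, `|x - t| < d -> P x) -> \forall x \near t, P x.
Proof.
move=> [d d0 hd]; exists d => //= x /=; rewrite distrC; exact: hd.
Qed.

Lemma ccont_lineP (f : C -> C) (l : R -> C) (t : R) :
  ccont f (l t) -> (forall x y, normc (l x - l y) = `|x - y|) -> cline (fun x => f (l x)) t.
Proof.
move=> cf hl; split; apply/cvgrPdist_lt => e e0; have [d d0 hd] := cf e e0;
  apply: nbhs_dist; exists d => // x hx; rewrite distrC.
- by rewrite -ReB (le_lt_trans (Re_le_normc _)) //; apply: hd; rewrite hl.
- by rewrite -ImB (le_lt_trans (Im_le_normc _)) //; apply: hd; rewrite hl.
Qed.

Lemma normc_hline (y x x' : R) : normc ((x +i* y) - (x' +i* y)) = `|x - x'|.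
Proof. by rewrite /Normc.normc /= subrr expr0n addr0 sqrtr_sqr. Qed.

Lemma normc_vline (x y y' : R) : normc ((x +i* y) - (x +i* y')) = `|y - y'|.
Proof. by rewrite /Normc.normc /= subrr expr0n add0r sqrtr_sqr. Qed.

Lemma cder_near (g1 g2 : R -> C) (t : R) (A : C) (d : R) : 0 < d ->
  (forall x, `|x - t| < d -> g1 x = g2 x) -> cder g1 t A -> cder g2 t A.
Proof.
move=> d0 E [a b]; split; [apply: near_eq_is_derive a|apply: near_eq_is_derive b];
  by apply: nbhs_dist; exists d => // x /E ->.
Qed.

Lemma ftc_segment (u du : R -> R) (a b : R) : a <= b ->
  (forall x, a <= x <= b -> is_derive x 1 u (du x)) ->
  (forall x, a <= x <= b -> {for x, continuous du}) ->
  (\int[lebesgue_measure]_(x in `[a, b]) (du x)%:E = (u b - u a)%:E)%E.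
Proof.
rewrite le_eqVlt => /orP[/eqP <- _ _|ab hu cu].
  by rewrite set_itv1 integral_set1 subrr.
have cont x : a <= x <= b -> {for x, continuous u}.
  move=> hx; apply: differentiable_continuous; apply/derivable1_diffP.
  by have := hu x hx => -[].
rewrite (@continuous_FTC2 _ du u) ?EFinB //.
- apply: continuous_in_subspaceT => x; rewrite inE /= in_itv /= => hx; exact: cu.
- split.
  + move=> x; rewrite in_itv /= => /andP[/ltW h1 /ltW h2].
    by have [] := hu x _; rewrite ?h1.
  + by apply: cvg_at_right_filter; apply: cont; rewrite lexx ltW.
  + by apply: cvg_at_left_filter; apply: cont; rewrite lexx ltW.
- move=> x; rewrite in_itv /= => /andP[/ltW h1 /ltW h2].
  have h : is_derive x 1 u (du x) by apply: hu; rewrite h1.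
  by rewrite derive1E derive_val.
Qed.

(** The integrand is cut off outside the segment [x ^+ 2 < r], at whose ends the
    primitive [u] vanishes. *)
Lemma ftc_chord (u du : R -> R) (r : R) : 0 < r ->
  (forall x, x ^+ 2 <= r -> is_derive x 1 u (du x)) ->
  (forall x, x ^+ 2 <= r -> {for x, continuous du}) ->
  (forall x, x ^+ 2 = r -> u x = 0) ->
  (\int[lebesgue_measure]_x ((if x ^+ 2 < r then du x else 0)%:E) = 0)%E.
Proof.
move=> r0 hu cu u0; set X := Num.sqrt r.
have XX : X ^+ 2 = r by rewrite sqr_sqrtr // ltW.
have X0 : 0 <= X by rewrite sqrtr_ge0.
have sqle x : - X <= x <= X -> x ^+ 2 <= r.
  by rewrite -ler_norml -XX -(real_normK (num_real x)) => h; rewrite lerXn2r ?nnegrE.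
have sqlt x : (x ^+ 2 < r) = (x \in `]-X, X[).
  rewrite in_itv /= -ltr_norml -XX -(real_normK (num_real x)).
  by rewrite ltr_pXn2r ?nnegrE.
have NXX : - X <= X by rewrite ge0_cp.
have := ftc_segment NXX (fun x hx => hu x (sqle x hx)) (fun x hx => cu x (sqle x hx)).
rewrite !u0 ?sqrrN // subrr => h.
have mdu : measurable_fun `[-X, X]%classic (EFin \o du).
  apply/measurable_EFinP; apply: subspace_continuous_measurable_fun => //.
  apply: continuous_in_subspaceT => x; rewrite inE /= in_itv /= => hx.
  by apply: cu; exact: sqle.
rewrite -integral_itv_bndo_bndc in h; last first.
  by apply: measurable_funS mdu => //; apply: subset_itv_co_cc.
rewrite -integral_itv_obnd_cbnd in h; last first.
  by apply: measurable_funS mdu => //; apply: subset_itv_oo_cc.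
rewrite -[RHS]h [RHS]integral_mkcond; apply: eq_integral => x _.
by rewrite patchE sqlt mem_setE; case: ifP.
Qed.

End LineCalculus.

Section ScaledMeasure.
Context d (T : measurableType d) (R : realType).
Variables (m : {measure set T -> \bar R}) (k : {nonneg R}) (D : set T).
Hypotheses (mD : measurable D) (k0 : 0 < k%:num).
Variable f : T -> \bar R.

Lemma integrable_mscale : (mscale k m).-integrable D f <-> m.-integrable D f.
Proof.
have mg (mf : measurable_fun D f) : measurable_fun D (fun x => `|f x|%E).
  exact: measurableT_comp.
split => /integrableP[mf h]; apply/integrableP; split => //; move: h;
  rewrite ge0_integral_mscale //; try (exact: mg);
  set I := (\int[_]_(x in _) _)%E => h.
- have : (0 <= I)%E by apply: integral_ge0.
  move: h; case: I => //= [r _ _|]; first by rewrite ltry.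
  by rewrite mulry gtr0_sg ?mul1e ?ltxx.
- have : (0 <= I)%E by apply: integral_ge0.
  by move: h; case: I => //= r _ _; rewrite -EFinM ltry.
Qed.

Lemma integral_mscale : m.-integrable D f ->
  (\int[mscale k m]_(x in D) f x = (k%:num)%:E * \int[m]_(x in D) f x)%E.
Proof.
move=> im; have mf := measurable_int _ im.
rewrite [LHS]integralE [in RHS](integralE m).
rewrite ge0_integral_mscale //; last exact: measurable_funepos.
rewrite ge0_integral_mscale //; last exact: measurable_funeneg.
rewrite [RHS]muleBr //.
by apply: fin_num_adde_defl; rewrite fin_numN; apply: integrable_neg_fin_num.
Qed.

End ScaledMeasure.

Section PlaneFubini.
Variable R : realType.
Local Notation C := R[i].
Local Notation "x ^*" := (conjc x) : ring_scope.
Local Notation D := (@plane_pt R @^-1` @disc R).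
Local Notation mu := (@lebesgue_measure R).
Local Notation mu2 := (mu \x mu)%E.

Lemma invpi_gt0 : 0 < (pi : R)^-1.
Proof. by rewrite invr_gt0 pi_gt0. Qed.

Lemma sigma_integrable (u : C -> R) : rintegrable u <->
  mu2.-integrable D (fun x => (u (plane_pt x))%:E).
Proof.
exact: (@integrable_mscale _ _ R _ (NngNum (invpi_ge0 R)) D
  (@measurable_disc R) invpi_gt0).
Qed.

Lemma sigma_integral (u : C -> R) : rintegrable u ->
  (\int[@sigma R]_(x in D) (u (plane_pt x))%:E =
   (pi^-1)%:E * \int[mu2]_(x in D) (u (plane_pt x))%:E)%E.
Proof.
move=> iu; apply: (@integral_mscale _ _ R _ (NngNum (invpi_ge0 R)) D
  (@measurable_disc R)).
exact: (sigma_integrable u).1.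
Qed.

(** Fubini: finitely many lines are negligible, so the others decide. *)
Lemma rint_eq0_fubini (u : C -> R) (s : seq R) : rintegrable u ->
  (forall z, ~ disc z -> u z = 0) ->
  (forall y, y \notin s -> (\int[mu]_x (u (x +i* y))%:E = 0)%E) \/
  (forall x, x \notin s -> (\int[mu]_y (u (x +i* y))%:E = 0)%E) ->
  rint u = 0.
Proof.
move=> iu u0 hl; have mD := @measurable_disc R.
have iu2 := (sigma_integrable u).1 iu.
rewrite /rint /Rintegral sigma_integral //.
suff -> : (\int[mu2]_(x in D) (u (plane_pt x))%:E = 0)%E by rewrite mule0.
have E : (fun x => (u (plane_pt x))%:E) \_ D = (fun x => (u (plane_pt x))%:E).
  apply/funext => x; rewrite patchE; case: ifPn => // /negP h.
  by rewrite u0 // => h'; apply: h; rewrite inE.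
rewrite integral_mkcond E.
have iT : mu2.-integrable setT (fun x => (u (plane_pt x))%:E).
  by have := (integrable_mkcond _ mD).1 iu2; rewrite E.
have ae0 (F : R -> \bar R) : measurable_fun setT F ->
    (forall y, y \notin s -> F y = 0%E) -> (\int[mu]_y F y = 0)%E.
  move=> mF F0; rewrite -(integral0 mu setT); apply: ae_eq_integral => //.
  exists [set` s]; split.
  - apply: countable_measurable => [t|]; first exact: measurable_set1.
    exact/finite_set_countable/finite_seq.
  - exact/countable_lebesgue_measure0/finite_set_countable/finite_seq.
  move=> y /= hy; apply/negPn/negP => ys; apply: hy => _; exact: F0.
case: hl => hl.
  rewrite -(integral21_prod_meas1 iT); apply: ae0; last exact: hl.
  exact: (measurable_fubini_G iT).
rewrite -(integral12_prod_meas1 iT); apply: ae0; last exact: hl.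
exact: (measurable_fubini_F iT).
Qed.

End PlaneFubini.

Section Stokes.
Variable R : realType.
Local Notation C := R[i].
Local Notation "x ^*" := (conjc x) : ring_scope.
Implicit Types (f fx fy : C -> C) (s : seq C).

Definition xder f (z A : C) := cder (fun x => f (x +i* Im z)) (Re z) A.
Definition yder f (z A : C) := cder (fun y => f (Re z +i* y)) (Im z) A.

Definition C1at f fx fy z :=
  [/\ xder f z (fx z), yder f z (fy z), ccont f z, ccont fx z & ccont fy z].

(** Fubini reduces both integrals to chords, along which the derivative
    integrates to a difference of boundary values of [f]. The chords
    through [s], finitely many in each direction, are negligible. *)
Lemma stokes_chords s f fx fy (rho : R) : 0 < rho < 1 ->
  (forall z, disc z -> z \notin s -> C1at f fx fy z) ->
  (forall z, normc z ^+ 2 = rho -> f z = 0) ->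
  cintegrable (fun z => if normc z ^+ 2 < rho then fx z else 0) ->
  cintegrable (fun z => if normc z ^+ 2 < rho then fy z else 0) ->
  disc_int (fun z => if normc z ^+ 2 < rho then fx z else 0) = 0 /\
  disc_int (fun z => if normc z ^+ 2 < rho then fy z else 0) = 0.
Proof.
move=> /andP[rho0 rho1] hf f0 [ix1 ix2] [iy1 iy2].
have out z : ~ disc z -> (normc z ^+ 2 < rho) = false.
  move=> hz; apply/negbTE; rewrite -leNgt; apply: ltW; apply: (lt_le_trans rho1).
  rewrite expr_ge1 ?normc_ge0 // leNgt; apply/negP => h; apply: hz; by rewrite discE.
have inD z : normc z ^+ 2 <= rho -> disc z.
  move=> h; rewrite discE -(@expr_lt1 _ 2) ?normc_ge0 //; exact: le_lt_trans rho1.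
have nE (x y : R) : normc (x +i* y) ^+ 2 = x ^+ 2 + y ^+ 2 by rewrite sqr_normcE.
pose sy := [seq Im z | z <- s]; pose sx := [seq Re z | z <- s].
(* each chord is [t |-> l t] with [|l t|^2 = t^2 + k]; [P] is [Re] or [Im] *)
have chord (P : C -> R) (g : C -> C) (l : R -> C) (k : R) : P 0 = 0 -> 0 <= k ->
    (forall t, normc (l t) ^+ 2 = t ^+ 2 + k) ->
    (forall t, disc (l t) -> is_derive t 1 (fun t => P (f (l t))) (P (g (l t))) /\
       {for t, continuous (fun t => P (g (l t)))}) ->
    (\int[@lebesgue_measure R]_t (P (if (normc (l t) ^+ 2 < rho)%R then g (l t) else 0))%:E = 0)%E.
  move=> P0 k0 lE hd; have [hr|hr] := leP (rho - k) 0.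
    under eq_integral => t _.
      rewrite lE ifF; last by apply/negbTE; rewrite -leNgt; have := sqr_ge0 t; lra.
      rewrite P0; over.
    by rewrite integral0.
  transitivity (\int[@lebesgue_measure R]_t
      (if (t ^+ 2 < rho - k)%R then P (g (l t)) else 0)%:E)%E.
    by apply: eq_integral => t _; rewrite lE ltrBrDr; case: ifP; rewrite ?P0.
  have hin t : t ^+ 2 <= rho - k -> disc (l t) by move=> ht; apply: inD; rewrite lE; lra.
  apply: (@ftc_chord R (fun t => P (f (l t))) (fun t => P (g (l t))) (rho - k) hr).
  - by move=> t /hin /hd[].
  - by move=> t /hin /hd[].
  - by move=> t ht; rewrite f0 // lE; lra.
have nsy x y : y \notin sy -> x +i* y \notin s.
  by apply: contra => /(map_f (@complex.Im R)).
have nsx x y : x \notin sx -> x +i* y \notin s.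
  by apply: contra => /(map_f (@complex.Re R)).
have hline := @normc_hline R; have vline := @normc_vline R.
split; rewrite disc_intE; apply: complexP => /=.
- apply: (@rint_eq0_fubini R _ sy) => // [z /out -> //|]; left=> y ys.
  apply: (chord (@complex.Re R) fx (fun x => x +i* y) (y ^+ 2)) => // [|t dt]; first exact: sqr_ge0.
  have [[h _] _ _ c _] := hf _ dt (nsy t y ys); split; first exact: h.
  exact: (ccont_lineP (l := fun x => x +i* y) c (hline y)).1.
- apply: (@rint_eq0_fubini R _ sy) => // [z /out -> //|]; left=> y ys.
  apply: (chord (@complex.Im R) fx (fun x => x +i* y) (y ^+ 2)) => // [|t dt]; first exact: sqr_ge0.
  have [[_ h] _ _ c _] := hf _ dt (nsy t y ys); split; first exact: h.
  exact: (ccont_lineP (l := fun x => x +i* y) c (hline y)).2.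
- apply: (@rint_eq0_fubini R _ sx) => // [z /out -> //|]; right=> x xs.
  apply: (chord (@complex.Re R) fy (fun y => x +i* y) (x ^+ 2)) => // [|t|t dt].
  + exact: sqr_ge0.
  + by rewrite nE addrC.
  have [_ [h _] _ _ c] := hf _ dt (nsx x t xs); split; first exact: h.
  exact: (ccont_lineP (l := fun y => x +i* y) c (vline x)).1.
- apply: (@rint_eq0_fubini R _ sx) => // [z /out -> //|]; right=> x xs.
  apply: (chord (@complex.Im R) fy (fun y => x +i* y) (x ^+ 2)) => // [|t|t dt].
  + exact: sqr_ge0.
  + by rewrite nE addrC.
  have [_ [_ h] _ _ c] := hf _ dt (nsx x t xs); split; first exact: h.
  exact: (ccont_lineP (l := fun y => x +i* y) c (vline x)).2.
Qed.

End Stokes.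

(** * Calculus of continuously differentiable functions *)

Section Calculus.
Variable R : realType.
Local Notation C := R[i].
Local Notation "x ^*" := (conjc x) : ring_scope.
Implicit Types (f g : C -> C).

Lemma ccontM f g z : ccont f z -> ccont g z -> ccont (fun w => f w * g w) z.
Proof.
move=> cf cg e e0.
set F := normc (f z); set G := normc (g z).
have F0 : 0 <= F by exact: normc_ge0.
have G0 : 0 <= G by exact: normc_ge0.
have [d1 d10 h1] : exists2 d : R, 0 < d &
    forall w, normc (w - z) < d -> normc (f w - f z) < e / (2 * (G + 1)).
  by apply: cf; rewrite divr_gt0 // mulr_gt0 //; lra.
have [d2 d20 h2] := cf 1 ltr01.
have [d3 d30 h3] : exists2 d : R, 0 < d &
    forall w, normc (w - z) < d -> normc (g w - g z) < e / (2 * (F + 1)).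
  by apply: cg; rewrite divr_gt0 // mulr_gt0 //; lra.
exists (Num.min d1 (Num.min d2 d3)); first by rewrite !lt_min d10 d20.
move=> w; rewrite !lt_min => /and3P[/h1 w1 /h2 w2 /h3 w3].
have -> : f w * g w - f z * g z = f w * (g w - g z) + (f w - f z) * g z by ring.
have hF : normc (f w) <= F + 1.
  by rewrite -(subrK (f z) (f w)) (le_trans (normcD _ _)) // addrC lerD // ltW.
have -> : e = (F + 1) * (e / (2 * (F + 1))) + e / (2 * (G + 1)) * (G + 1).
  by field; apply/andP; split; lra.
apply: (le_lt_trans (normcD _ _)); rewrite !normcM -/G.
apply: ler_ltD.
  by apply: ler_pM; rewrite ?normc_ge0 // ltW.
apply: (@le_lt_trans _ _ (e / (2 * (G + 1)) * G)).
  by rewrite ler_wpM2r // ltW.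
rewrite ltr_pM2l; first lra.
by rewrite divr_gt0 // mulr_gt0 //; lra.
Qed.

Lemma ccontD f g z : ccont f z -> ccont g z -> ccont (fun w => f w + g w) z.
Proof.
move=> cf cg e e0; have e2 : 0 < e / 2 by lra.
have [d1 d10 h1] := cf _ e2; have [d2 d20 h2] := cg _ e2.
exists (Num.min d1 d2); first by rewrite lt_min d10.
move=> w; rewrite lt_min => /andP[/h1 w1 /h2 w2].
have -> : f w + g w - (f z + g z) = (f w - f z) + (g w - g z) by ring.
by apply: (le_lt_trans (normcD _ _)); lra.
Qed.

Lemma ccont_cst (k : C) z : ccont (fun=> k) z.
Proof. by move=> e e0; exists 1 => // w _; rewrite subrr normc0. Qed.

Lemma ccont_id z : ccont (fun w : C => w) z.
Proof. by move=> e e0; exists e. Qed.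

Lemma ccont_conj f z : ccont f z -> ccont (fun w => (f w)^*) z.
Proof.
move=> cf e /cf[d d0 h]; exists d => // w /h.
by rewrite -rmorphB /= normc_conj.
Qed.

Lemma ccont_rfun (phi : R -> R) (v : C -> R) z :
  {for v z, continuous phi} -> ccont (fun w => (v w)%:C) z ->
  ccont (fun w => (phi (v w))%:C) z.
Proof.
move=> cphi cv e e0.
have /cvgrPdist_lt/(_ e e0) := cphi; rewrite near_simpl => -[d d0 h]; have [d1 d10 h1] := cv _ d0; exists d1 => // w /h1.
rewrite -rmorphB normc_real => hw; rewrite -rmorphB normc_real.
by rewrite distrC; apply: h => /=; rewrite distrC.
Qed.

Lemma ccont_norm f z : ccont f z -> ccont (fun w => (normc (f w))%:C) z.
Proof.
move=> cf e /cf[d d0 h]; exists d => // w /h; apply: le_lt_trans.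
rewrite -rmorphB normc_real ler_norml normc_sub_ge andbT.
by rewrite lerNl opprB normc_distC normc_sub_ge.
Qed.

Lemma ccont_rcont f z : ccont f z ->
  rcont (fun w => Re (f w)) z /\ rcont (fun w => Im (f w)) z.
Proof.
move=> cf; split=> e /cf[d d0 h]; exists d => // w /h; apply: le_lt_trans.
  by rewrite -ReB Re_le_normc.
by rewrite -ImB Im_le_normc.
Qed.

Lemma ccont_near f g z (d : R) : 0 < d ->
  (forall w, normc (w - z) < d -> f w = g w) -> ccont f z -> ccont g z.
Proof.
move=> d0 fg cf e /cf[d1 d10 h]; exists (Num.min d d1); first by rewrite lt_min d0.
move=> w; rewrite lt_min => /andP[w1 w2]; rewrite -!fg //; first exact: h.
by rewrite subrr normc0.
Qed.

Lemma ccont_cmeas (s : seq C) f :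
  (forall z, disc z -> z \notin s -> ccont f z) -> cmeas f.
Proof.
by move=> cf; split; apply: (rcont_measurable (s := s)) => z dz zs;
  have [] := ccont_rcont (cf z dz zs).
Qed.

Lemma cder_cst (k : C) t : cder (fun=> k) t 0.
Proof. by split; exact: is_derive_cst. Qed.

Lemma cderD (g1 g2 : R -> C) t A1 A2 :
  cder g1 t A1 -> cder g2 t A2 -> cder (fun x => g1 x + g2 x) t (A1 + A2).
Proof.
move=> [a1 b1] [a2 b2]; split.
  rewrite ReD (_ : (fun x => _) = (fun x => Re (g1 x)) \+ (fun x => Re (g2 x))).
    exact: is_deriveD.
  by apply/funext => x; rewrite ReD.
rewrite ImD (_ : (fun x => _) = (fun x => Im (g1 x)) \+ (fun x => Im (g2 x))).
  exact: is_deriveD.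
by apply/funext => x; rewrite ImD.
Qed.

Lemma cderM (g1 g2 : R -> C) t A1 A2 :
  cder g1 t A1 -> cder g2 t A2 ->
  cder (fun x => g1 x * g2 x) t (A1 * g2 t + g1 t * A2).
Proof.
move=> [a1 b1] [a2 b2]; split.
  rewrite (_ : (fun x => _) = ((fun x => Re (g1 x)) * (fun x => Re (g2 x)))
     - ((fun x => Im (g1 x)) * (fun x => Im (g2 x))))%R.
    apply: (@is_derive_eq _ _ _ _ _ _ _ _ (is_deriveB (is_deriveM a1 a2) (is_deriveM b1 b2))).
    by rewrite /GRing.scale /= ReD !ReM; ring.
  by apply/funext => x; rewrite ReM.
rewrite (_ : (fun x => _) = ((fun x => Re (g1 x)) * (fun x => Im (g2 x)))
     + ((fun x => Im (g1 x)) * (fun x => Re (g2 x))))%R.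
  apply: (@is_derive_eq _ _ _ _ _ _ _ _ (is_deriveD (is_deriveM a1 b2) (is_deriveM b1 a2))).
  by rewrite /GRing.scale /= ImD !ImM; ring.
by apply/funext => x; rewrite ImM.
Qed.

Lemma cder_conj (g : R -> C) t A : cder g t A -> cder (fun x => (g x)^*) t A^*.
Proof.
move=> [a b]; split.
  rewrite Re_conj (_ : (fun x => _) = (fun x => Re (g x))) //.
  by apply/funext => x; rewrite Re_conj.
rewrite Im_conj (_ : (fun x => _) = - (fun x => Im (g x)))%R.
  exact: is_deriveN.
by apply/funext => x; rewrite Im_conj.
Qed.

Lemma cder_rfun (phi : R -> R) (v : R -> R) t (A : C) (c : R) :
  is_derive (v t) 1 phi c -> cder (fun x => (v x)%:C) t A ->
  cder (fun x => (phi (v x))%:C) t (c%:C * A).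
Proof.
move=> dphi [a b]; have A0 : Im A = 0.
  have <- := @derive_val _ _ _ _ _ _ _ b; exact: derive_cst.
split; last first.
  by rewrite ImM /= A0 mulr0 mul0r add0r; exact: is_derive_cst.
by rewrite ReM /= mul0r subr0; exact: is_derive1_comp.
Qed.

Lemma cder_ext (g1 g2 : R -> C) t A : (forall x, g1 x = g2 x) ->
  cder g1 t A -> cder g2 t A.
Proof. by move=> /funext ->. Qed.

Lemma C1at_cst (k : C) z : C1at (fun=> k) (fun=> 0) (fun=> 0) z.
Proof. by split; try exact: ccont_cst; exact: cder_cst. Qed.

Lemma C1at_id (z : C) : C1at (fun w => w) (fun=> 1) (fun=> 'i) z.
Proof.
split; try exact: ccont_cst; last exact: ccont_id.
  by split; rewrite /=; [exact: is_derive_id|exact: is_derive_cst].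
by split; rewrite /=; [exact: is_derive_cst|exact: is_derive_id].
Qed.

Lemma C1atD f fx fy g gx gy z : C1at f fx fy z -> C1at g gx gy z ->
  C1at (fun w => f w + g w) (fun w => fx w + gx w) (fun w => fy w + gy w) z.
Proof.
by move=> [? ? ? ? ?] [? ? ? ? ?]; split; try exact: ccontD; exact: cderD.
Qed.

Lemma C1atM f fx fy g gx gy z : C1at f fx fy z -> C1at g gx gy z ->
  C1at (fun w => f w * g w) (fun w => fx w * g w + f w * gx w)
       (fun w => fy w * g w + f w * gy w) z.
Proof.
move=> [f1 f2 f3 f4 f5] [g1 g2 g3 g4 g5]; split.
- by have := cderM f1 g1; rewrite complex_eta.
- by have := cderM f2 g2; rewrite complex_eta.
- exact: ccontM.
- by apply: ccontD; exact: ccontM.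
- by apply: ccontD; exact: ccontM.
Qed.

Lemma C1at_conj f fx fy z : C1at f fx fy z ->
  C1at (fun w => (f w)^*) (fun w => (fx w)^*) (fun w => (fy w)^*) z.
Proof.
move=> [f1 f2 f3 f4 f5]; split; try exact: ccont_conj; exact: cder_conj.
Qed.

(** The chain rule for a function of a real-valued one; only its derivative at
    the point is used, so that [phi] may be singular elsewhere. *)
Lemma C1at_rfun (phi dphi : R -> R) (v : C -> R) vx vy z :
  is_derive (v z) 1 phi (dphi (v z)) -> {for v z, continuous dphi} ->
  C1at (fun w => (v w)%:C) vx vy z ->
  C1at (fun w => (phi (v w))%:C) (fun w => (dphi (v w))%:C * vx w)
    (fun w => (dphi (v w))%:C * vy w) z.
Proof.
move=> dp cp [v1 v2 v3 v4 v5]; split.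
- by apply: (@cder_rfun phi (fun x => v (x +i* Im z)) (Re z) (vx z) _ _ v1);
    rewrite complex_eta.
- by apply: (@cder_rfun phi (fun y => v (Re z +i* y)) (Im z) (vy z) _ _ v2);
    rewrite complex_eta.
- apply: ccont_rfun v3; apply: differentiable_continuous.
  by apply/derivable1_diffP; have [] := dp.
- by apply: ccontM v4; exact: ccont_rfun v3.
- by apply: ccontM v5; exact: ccont_rfun v3.
Qed.

Lemma C1at_near f fx fy f' fx' fy' z (d : R) : 0 < d ->
  (forall w, normc (w - z) < d -> [/\ f w = f' w, fx w = fx' w & fy w = fy' w]) ->
  C1at f fx fy z -> C1at f' fx' fy' z.
Proof.
move=> d0 hE [f1 f2 f3 f4 f5].
have zz : normc (z - z) < d by rewrite subrr normc0.
have [_ ex ey] := hE _ zz.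
split.
- rewrite /xder -ex; apply: cder_near d0 _ f1 => x hx.
  by have [|->] := hE (x +i* Im z); rewrite // -[z in _ - z]complex_eta normc_hline.
- rewrite /yder -ey; apply: cder_near d0 _ f2 => x hx.
  by have [|->] := hE (Re z +i* x); rewrite // -[z in _ - z]complex_eta normc_vline.
- by apply: (ccont_near d0 _ f3) => w /hE[].
- by apply: (ccont_near d0 _ f4) => w /hE[].
- by apply: (ccont_near d0 _ f5) => w /hE[].
Qed.

Lemma C1at_eq f fx fy f' fx' fy' z :
  (forall w, [/\ f w = f' w, fx w = fx' w & fy w = fy' w]) ->
  C1at f fx fy z -> C1at f' fx' fy' z.
Proof. by move=> h; apply: (C1at_near ltr01) => w _. Qed.

End Calculus.

(** * A Stokes formula without boundary term *)

Section LimitStokes.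
Variable R : realType.
Local Notation C := R[i].
Local Notation "x ^*" := (conjc x) : ring_scope.
Local Notation D := (@plane_pt R @^-1` @disc R).
Implicit Types (f g : C -> C) (s : seq C).

(** A function that may be singular on [s] is replaced there by a harmless value. *)
Definition off s f : C -> C := fun z => if z \in s then 0 else f z.

Lemma C1at_off s f fx fy z : z \notin s -> C1at f fx fy z ->
  C1at f (off s fx) (off s fy) z.
Proof.
move=> /notin_open[d d0 hd]; apply: (C1at_near d0) => w /hd /negbTE ws.
by rewrite /off ws.
Qed.

Lemma ccont_off s f z : z \notin s -> ccont f z -> ccont (off s f) z.
Proof.
move=> /notin_open[d d0 hd]; apply: (ccont_near d0) => w /hd /negbTE ws.
by rewrite /off ws.
Qed.

Lemma off_cmeas s f :
  (forall z, disc z -> z \notin s -> ccont f z) -> cmeas (off s f).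
Proof.
by move=> cf; apply: (ccont_cmeas (s := s)) => z dz zs; apply: ccont_off => //; exact: cf.
Qed.

Lemma rmeas_if (u v : C -> R) (rho : R) : rmeas u ->
  rmeas (fun z => if normc z ^+ 2 < rho then u z else 0).
Proof.
move=> mu.
have mn : rmeas (fun z : C => normc z ^+ 2).
  apply: (rcont_measurable (s := [::])) => z _ _.
  have := ccontM (ccont_norm (ccont_id z)) (ccont_norm (ccont_id z)).
  by move=> /ccont_rcont[+ _]; congr (rcont _ _); apply/funext => w; rewrite ReM /= mul0r subr0 -expr2.
apply: measurable_fun_if => //.
- exact: measurable_disc.
- by apply: measurable_fun_ltr.
- by apply: measurable_funS mu; [exact: measurable_disc|exact: subIsetl].
Qed.

Lemma cmeas_if f (rho : R) : cmeas f ->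
  cmeas (fun z => if normc z ^+ 2 < rho then f z else 0).
Proof.
move=> [m1 m2]; split.
  rewrite (_ : (fun z => _) = (fun z => if normc z ^+ 2 < rho then Re (f z) else 0)).
    exact: rmeas_if.
  by apply/funext => z; case: ifP.
rewrite (_ : (fun z => _) = (fun z => if normc z ^+ 2 < rho then Im (f z) else 0)).
  exact: rmeas_if.
by apply/funext => z; case: ifP.
Qed.

(** The cut-off [1 - e / (1 - |z|^2)] vanishes on [|z|^2 = 1 - e] and tends to
    [1] with [e]; where it is nonnegative, its gradient is at most
    [2 / (1 - |z|^2)]. *)
Definition cutoff (e : R) (z : C) : C := (1 - e / (1 - normc z ^+ 2))%:C.
Definition dcutoff (e : R) (z : C) : C := (- e / (1 - normc z ^+ 2) ^+ 2)%:C.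

Lemma C1at_sqnorm (z : C) : C1at (fun w => (normc w ^+ 2)%:C)
  (fun w => w^* + w) (fun w => 'i * w^* - 'i * w) z.
Proof.
apply: C1at_eq (C1atM (C1at_id z) (C1at_conj (C1at_id z))) => w.
rewrite mul_conjc mul1r conjc1 mulr1; split => //; congr (_ + _).
by rewrite mulrC -mulNr; congr (_ * _); apply: complexP; rewrite ?Re_conj ?Im_conj ?ReN ?ImN /= ?oppr0.
Qed.

Lemma C1at_cutoff e z : disc z -> C1at (cutoff e)
  (fun w => dcutoff e w * (w^* + w)) (fun w => dcutoff e w * ('i * w^* - 'i * w)) z.
Proof.
move=> dz; have h1 := disc_sqr dz.
apply: (C1at_rfun (phi := fun t => 1 - e / (1 - t))
  (dphi := fun t => - e / (1 - t) ^+ 2) (v := fun w : C => normc w ^+ 2)).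
- have n0 : 1 - normc z ^+ 2 != 0 by apply/eqP; lra.
  have h : is_derive (normc z ^+ 2) 1 (fun t : R => 1 - t) (-1).
    rewrite (_ : (fun t => _) = (cst 1 - id)%R) //.
    by apply: is_derive_eq; rewrite sub0r.
  have hV := @is_deriveV _ (fun t : R => 1 - t) _ _ _ n0 h.
  rewrite (_ : (fun t => _) = (cst 1 - (e *: (fun t : R => (1 - t)^-1)))%R) //.
  apply: is_derive_eq; rewrite sub0r /GRing.scale /=.
  by field.
- apply/differentiable_continuous; apply/derivable1_diffP.
  have n0 : (1 - normc z ^+ 2) ^+ 2 != 0 by rewrite expf_neq0 //; apply/eqP; lra.
  apply: derivableM => //; apply: derivableV => //.
- exact: C1at_sqnorm.
Qed.

Lemma Re_real_mul (r : R) (z : C) : Re (r%:C * z) = r * Re z.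
Proof. by rewrite ReM /= mul0r subr0. Qed.

Lemma Im_real_mul (r : R) (z : C) : Im (r%:C * z) = r * Im z.
Proof. by rewrite ImM /= mul0r addr0. Qed.

(** Multiply [f] by the cut-off, which vanishes on a circle, and let the circle
    tend to the unit circle. The gradient of the cut-off is large there, but [f] is
    [O(1 - |z|^2)], so that dominated convergence applies. Singularities in [s] are
    allowed as long as the partial derivatives stay integrable. *)
Lemma limit_stokes s f fx fy (v : C -> R) :
  (forall z, disc z -> z \notin s -> C1at f fx fy z) ->
  rintegrable v ->
  (forall z, disc z -> z \notin s -> normc (fx z + 'i * fy z) <= v z) ->
  (forall z, disc z -> z \notin s -> normc (f z) <= v z * (1 - normc z ^+ 2)) ->
  (forall rho, 0 < rho < 1 -> exists2 u, rintegrable u &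
    forall z, normc z ^+ 2 < rho -> z \notin s ->
      normc (fx z) <= u z /\ normc (fy z) <= u z) ->
  disc_int (off s (fun z => fx z + 'i * fy z)) = 0.
Proof.
move=> hf iv hB hf0 hu.
have [|vr hr] := @choice R (C -> R) (fun rho u => 0 < rho < 1 -> rintegrable u /\
    forall z, normc z ^+ 2 < rho -> z \notin s -> normc (fx z) <= u z /\ normc (fy z) <= u z).
  move=> rho; have [/hu[u iu hu']|] := boolP (0 < rho < 1); last by exists (fun=> 0).
  by exists u.
pose en (n : nat) : R := n.+2%:R^-1.
have en0 n : 0 < en n by rewrite invr_gt0.
have en1 n : en n < 1 by rewrite invf_lt1 // ltr1n.
pose cut n := cutoff (en n); pose dcut n := dcutoff (en n).
(* the partial derivatives of the function cut off at [|z|^2 = 1 - en n] *)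
pose Fx n z := fx z * cut n z + f z * (dcut n z * (z^* + z)).
pose Fy n z := fy z * cut n z + f z * (dcut n z * ('i * z^* - 'i * z)).
pose trunc n (g : C -> C) z := if normc z ^+ 2 < 1 - en n then off s g z else 0.
have inD n z : normc z ^+ 2 < 1 - en n -> disc z.
  move=> h; rewrite discE -(@expr_lt1 _ 2) ?normc_ge0 //.
  by have := en0 n; move: h; lra.
have cF n z : disc z -> z \notin s ->
    C1at (fun w => f w * cut n w) (Fx n) (Fy n) z.
  by move=> dz zs; exact: C1atM (hf z dz zs) (C1at_cutoff (en n) dz).
have bcut n z : normc z ^+ 2 < 1 - en n -> normc (cut n z) <= 1.
  move=> h; rewrite /cut /cutoff normc_real ler_norml.
  have t0 : 0 < 1 - normc z ^+ 2 by have := en0 n; move: h; lra.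
  have : 0 < en n / (1 - normc z ^+ 2) by rewrite divr_gt0.
  have : en n / (1 - normc z ^+ 2) <= 1 by rewrite ler_pdivrMr //; move: h; lra.
  by lra.
have bdcut n z (c : C) : normc z ^+ 2 < 1 - en n -> z \notin s -> normc c <= 2 ->
    normc (f z * (dcut n z * c)) <= 2 * `|v z|.
  move=> h zs hc; have dz := inD n z h.
  have t0 : 0 < 1 - normc z ^+ 2 by have := en0 n; move: h; lra.
  have h1 : en n / (1 - normc z ^+ 2) <= 1 by rewrite ler_pdivrMr //; move: h; lra.
  rewrite !normcM /dcut /dcutoff normc_real normrM normrN (gtr0_norm (en0 n)).
  rewrite normfV (gtr0_norm (exprn_gt0 2 t0)).
  apply: (@le_trans _ _ ((`|v z| * (1 - normc z ^+ 2)) *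
    (en n / (1 - normc z ^+ 2) ^+ 2 * 2))).
    have q0 : 0 <= en n / (1 - normc z ^+ 2) ^+ 2.
      by rewrite divr_ge0 ?exprn_ge0 // ltW.
    apply: ler_pM; [exact: normc_ge0|by rewrite mulr_ge0 ?normc_ge0| |exact: ler_wpM2l].
    apply: (le_trans (hf0 z dz zs)); rewrite ler_pM2r //; exact: ler_norm.
  rewrite (_ : _ * _ = 2 * `|v z| * (en n / (1 - normc z ^+ 2))); last first.
    by field; apply/eqP; lra.
  by rewrite ler_piMr // mulr_ge0.
have n2 (z : C) : disc z -> normc (z^* + z) <= 2.
  rewrite discE => dz; apply: (le_trans (normcD _ _)); rewrite normc_conj; lra.
have n2' (z : C) : disc z -> normc ('i * z^* - 'i * z) <= 2.
  rewrite discE => dz; apply: (le_trans (normcB _ _)).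
  rewrite !normcM normc_conj normc_i; lra.
have mtrunc n g : (forall z, disc z -> z \notin s -> ccont g z) -> cmeas (trunc n g).
  by move=> cg; apply: cmeas_if; exact: off_cmeas.
have itr n (g g1 : C -> C) (gd c : C -> C) :
    (forall z, g z = g1 z * cut n z + f z * (dcut n z * c z)) ->
    (forall z, disc z -> normc (c z) <= 2) ->
    (forall z, normc z ^+ 2 < 1 - en n -> z \notin s -> normc (g1 z) <= vr (1 - en n) z) ->
    (forall z, disc z -> z \notin s -> ccont g z) -> cintegrable (trunc n g).
  move=> gE cE bg1 cg; have hrho : 0 < 1 - en n < 1.
    by have := en0 n; have := en1 n; lra.
  have [ivr _] := hr _ hrho.
  apply: (cintegrable_le (v := fun z => `|vr (1 - en n) z| + 2 * `|v z|)).
  - exact: mtrunc.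
  - apply: rintegrableD; first exact: rintegrable_norm.
    by apply: rintegrableZ; exact: rintegrable_norm.
  move=> z dz; rewrite /trunc /off; case: ifPn => [h|_]; last first.
    by rewrite normc0 addr_ge0 // mulr_ge0.
  case: ifPn => [_|zs]; first by rewrite normc0 addr_ge0 // mulr_ge0.
  rewrite gE (le_trans (normcD _ _)) // lerD //; last exact: bdcut (cE _ dz).
  rewrite normcM (@le_trans _ _ (normc (g1 z) * 1)) //.
    by rewrite ler_wpM2l ?normc_ge0 // bcut.
  by rewrite mulr1 (le_trans (bg1 _ h zs)) // ler_norm.
have ix n : cintegrable (trunc n (Fx n)).
  have hrho : 0 < 1 - en n < 1 by have := en0 n; have := en1 n; lra.
  apply: (itr n (Fx n) fx fx (fun z => z^* + z)) => //.
    by move=> z h zs; have [_ /(_ z h zs)[]] := hr _ hrho.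
  by move=> z dz zs; have [] := cF n z dz zs.
have iy n : cintegrable (trunc n (Fy n)).
  have hrho : 0 < 1 - en n < 1 by have := en0 n; have := en1 n; lra.
  apply: (itr n (Fy n) fy fy (fun z => 'i * z^* - 'i * z)) => //.
    by move=> z h zs; have [_ /(_ z h zs)[]] := hr _ hrho.
  by move=> z dz zs; have [] := cF n z dz zs.
pose B z := fx z + 'i * fy z.
pose Bn n z := B z * cut n z + f z * (dcut n z * (2 * z)).
have BnE n z : Fx n z + 'i * Fy n z = Bn n z.
  have ii : 'i * 'i = -1 :> C by rewrite -expr2 sqr_i.
  rewrite /Fx /Fy /Bn /B.
  transitivity (fx z * cut n z + 'i * fy z * cut n z +
    f z * (dcut n z * (z^* + z + ('i * 'i) * z^* - ('i * 'i) * z))); first by ring.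
  by rewrite ii; ring.
have int0 n : disc_int (trunc n (Bn n)) = 0.
  have hrho : 0 < 1 - en n < 1 by have := en0 n; have := en1 n; lra.
  have [||||sx sy] := @stokes_chords R s (fun w => f w * cut n w) (off s (Fx n)) (off s (Fy n)) _ hrho.
  - by move=> z dz zs; apply: C1at_off => //; exact: cF.
  - move=> z hz; rewrite /cut /cutoff hz subKr divff ?subrr ?mulr0 //.
    by rewrite gt_eqF.
  - exact: ix.
  - exact: iy.
  rewrite -[RHS](_ : disc_int (trunc n (Fx n)) + 'i * disc_int (trunc n (Fy n)) = _); last first.
    by rewrite /trunc sx sy mulr0 addr0.
  rewrite -disc_intZ // -disc_intD //; last exact: cintegrableZ.
  apply: eq_disc_int => z dz; rewrite /trunc /off -BnE.
  by case: ifP => _; rewrite ?mulr0 ?addr0 //; case: ifP => _; rewrite ?mulr0 ?addr0.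
have cB z : disc z -> z \notin s -> ccont B z.
  move=> dz zs; have [_ _ _ c1 c2] := hf z dz zs.
  by apply: ccontD => //; apply: ccontM => //; exact: ccont_cst.
have lim z : disc z -> exists2 N : nat, exists c : C, forall n, (N <= n)%N ->
    trunc n (Bn n) z = off s B z - (en n)%:C * c & True.
  move=> dz; have t0 : 0 < 1 - normc z ^+ 2 by have := disc_sqr dz; lra.
  have [N _ hN] := near_infty_natSinv_lt (PosNum t0).
  exists N => //.
  exists (if z \in s then 0 else (1 - normc z ^+ 2)^-1%:C * B z + ((1 - normc z ^+ 2) ^- 2)%:C * f z * (2 * z)).
  move=> n Nn; rewrite /trunc ifT; last first.
    have h3 : en n <= n.+1%:R^-1 by rewrite lef_pV2 ?posrE // ler_nat.
    rewrite ltrBrDl -ltrBrDr; apply: le_lt_trans h3 _; exact: (hN n Nn).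
  rewrite /off; case: ifP => _; first by rewrite mulr0 subr0.
  rewrite /Bn /cut /cutoff /dcut /dcutoff rmorphB rmorph1 !rmorphM rmorphN.
  by ring.
have limP (P : C -> R) z : (forall x y, P (x - y) = P x - P y) ->
    (forall (r : R) x, P (r%:C * x) = r * P x) -> disc z ->
    P (trunc n (Bn n) z) @[n --> \oo] --> P (off s B z).
  move=> PB PZ dz; have [N [c hN] _] := lim z dz.
  apply/cvgrPdist_lt => e e0.
  have he : 0 < e / (`|P c| + 1) by rewrite divr_gt0 // ltr_wpDl.
  near=> n; rewrite hN; last by near: n; exists N.
  rewrite PB PZ opprB addrCA subrr addr0 normrM (gtr0_norm (en0 n)).
  have : en n < e / (`|P c| + 1).
    apply: (@le_lt_trans _ _ n.+1%:R^-1); last first.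
      by near: n; exact: (near_infty_natSinv_lt (PosNum he)).
    by rewrite lef_pV2 ?posrE // ler_nat.
  rewrite ltr_pdivlMr; last by rewrite ltr_wpDl.
  by have := en0 n; rewrite mulrDr mulr1; lra.
apply: (disc_int_dominated0 (f_ := fun n => trunc n (Bn n))
  (v := fun z => 3 * `|v z|)) => //.
- move=> n; apply: mtrunc => z dz zs.
  have [_ _ _ c1 c2] := cF n z dz zs.
  rewrite (_ : Bn n = (fun z => Fx n z + 'i * Fy n z)).
    by apply: ccontD => //; apply: ccontM => //; exact: ccont_cst.
  by apply/funext => w; rewrite BnE.
- exact: off_cmeas.
- by apply: rintegrableZ; exact: rintegrable_norm.
- move=> n z dz; rewrite /trunc /off; case: ifPn => [h|_]; last first.
    by rewrite normc0 mulr_ge0.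
  case: ifPn => [_|zs]; first by rewrite normc0 mulr_ge0.
  rewrite /Bn (le_trans (normcD _ _)) //.
  have h1 : normc (B z * cut n z) <= `|v z|.
    rewrite normcM (@le_trans _ _ (normc (B z) * 1)) //.
      by rewrite ler_wpM2l ?normc_ge0 // bcut.
    by rewrite mulr1 (le_trans (hB _ dz zs)) // ler_norm.
  have h2 : normc (f z * (dcut n z * (2 * z))) <= 2 * `|v z|.
    apply: bdcut => //; rewrite normcM normc_nat.
    by move: dz; rewrite discE; lra.
  by move: h1 h2; move: (normc _) (normc _) => A1 A2; lra.
- by move=> z dz; apply: limP => //; [exact: ReB|exact: Re_real_mul].
- by move=> z dz; apply: limP => //; [exact: ImB|exact: Im_real_mul].
Unshelve. all: by end_near.
Qed.

End LimitStokes.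

(** * Integrability of powers, and the area of the disc *)

Section PowerIntegrability.
Variable R : realType.
Local Notation C := R[i].
Local Notation "x ^*" := (conjc x) : ring_scope.
Local Notation D := (@plane_pt R @^-1` @disc R).
Local Notation mu := (@lebesgue_measure R).
Local Notation mu2 := (mu \x mu)%E.

Let box (a : C) (r : R) : set (measurableTypeR R * measurableTypeR R) :=
  `[Re a - r, Re a + r]%classic `*` `[Im a - r, Im a + r]%classic.

Let measurable_box a r : measurable (box a r).
Proof. by apply: measurableX; exact: measurable_itv. Qed.

Let measure_box a r : 0 < r -> mu2 (box a r) = ((2 * r) ^+ 2)%:E.
Proof.
move=> r0; have hQ (t : R) : mu `[t - r, t + r]%classic = (2 * r)%:E.
  rewrite lebesgue_measure_itv /= lte_fin (_ : t - r < t + r = true); last first.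
    by apply/idP; lra.
  by rewrite -EFinD; congr EFin; ring.
rewrite product_measure1E; try exact: measurable_itv.
by rewrite -[LHS]/(mu _ * mu _)%E !hQ -EFinM expr2.
Qed.

Lemma dyadic_scale (r : R) : 0 < r -> r < 2 ->
  exists k : nat, 2^-1 ^+ k <= r /\ r <= 2 * 2^-1 ^+ k.
Proof.
move=> r0 r2.
have [k hk] : exists k : nat, 2^-1 ^+ k <= r.
  have [N _ hN] := near_infty_natSinv_expn_lt (PosNum r0).
  exists N; rewrite exprVn ltW //.
  by have := hN N (leqnn N); rewrite /= div1r.
have ex : exists k : nat, 2^-1 ^+ k <= r by exists k.
exists (ex_minn ex); case: ex_minnP => m hm hmin; split => //.
case: m hm hmin => [|m] hm hmin; first by rewrite expr0 mulr1 ltW.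
rewrite exprS mulrA mulfV // mul1r leNgt; apply/negP => h.
by have := hmin m (ltW h); rewrite ltnn.
Qed.

(** On the ring where [|z - a|] is comparable to [2 ^- k] the function is at most
    [b ^ k] with [b = 2 ^ (- q) < 4], while the ring lies in a square of area
    [16 * 4 ^- k]. *)
Lemma rintegrable_power (a : C) (q : R) : -2 < q <= 0 -> disc a ->
  rintegrable (fun z => normc (z - a) `^ q).
Proof.
move=> /andP[q2 q0] da; apply/sigma_integrable.
have mD := @measurable_disc R.
have mf : rmeas (fun z : C => normc (z - a) `^ q).
  apply: (rcont_measurable (s := [:: a])) => z dz; rewrite inE => za.
  have n0 : 0 < normc (z - a) by rewrite normc_gt0 subr_eq0.
  apply: (ccont_rcont (f := fun z : C => (normc (z - a) `^ q)%:C) _).1.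
  apply: (@ccont_rfun R (fun t => t `^ q) (fun w : C => normc (w - a)) z).
    apply: differentiable_continuous; apply/derivable1_diffP.
    by have [] := is_derive1_powR q n0.
  by apply: ccont_norm; apply: ccontD; [exact: ccont_id|exact: ccont_cst].
have mfE : measurable_fun D (fun x => (normc (plane_pt x - a) `^ q)%:E).
  exact/measurable_EFinP.
apply/integrableP; split => //.
pose b : R := 2 `^ (- q).
have b0 : 0 < b by rewrite powR_gt0.
have b4 : b < 4.
  have two (x : R) : 2 `^ x = expR (x * ln 2) by rewrite /powR pnatr_eq0.
  have -> : 4 = 2 `^ 2 :> R by rewrite powR_mulrn //; lra.
  rewrite /b !two ltr_expR ltr_pM2r ?ln_gt0 ?ltr1n //; lra.
pose G k x : \bar R := (b ^+ k * \1_(box a (2 * 2^-1 ^+ k)) x)%:E.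
have G0 k x : (0 <= G k x)%E.
  by rewrite lee_fin mulr_ge0 // exprn_ge0 // ltW.
have mG k : measurable_fun D (G k).
  apply/measurable_EFinP; apply: measurable_funM; first exact: measurable_cst.
  exact: measurable_indic.
have pw x : D x -> (`|(normc (plane_pt x - a) `^ q)%:E| <= \sum_(0 <= k <oo) G k x)%E.
  move=> Dx; rewrite gee0_abs ?lee_fin ?powR_ge0 //.
  have [E|E] := eqVneq (normc (plane_pt x - a)) 0.
    have [q00|qn0] := eqVneq q 0; last first.
      by rewrite E powR0 // nneseries_ge0.
    apply: le_trans (nneseries_lim_ge 1 _) => //; rewrite big_nat1 /G lee_fin expr0 mul1r q00 powRr0.
    rewrite indicE mem_set //.
    have /eqP := E; rewrite normc_eq0 subr_eq0 => /eqP Ea.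
    rewrite /box /= !in_itv /= -Ea expr0 mulr1 /plane_pt /=.
    by case: x {Dx Ea E} => x1 x2 /=; split; lra.
  have w0 : 0 < normc (plane_pt x - a) by rewrite lt_def E normc_ge0.
  have w2 : normc (plane_pt x - a) < 2.
    apply: (le_lt_trans (normcB _ _)); move: Dx da; rewrite /= !discE; lra.
  have [k [hk1 hk2]] := dyadic_scale w0 w2.
  apply: le_trans (nneseries_lim_ge k.+1 _) => //.
  rewrite big_nat_recr //=.
  apply: (@le_trans _ _ (G k x)); last by rewrite leeDr // sume_ge0.
  rewrite /G lee_fin indicE mem_set ?mulr1; last first.
    have := le_trans (Re_le_normc _) hk2; have := le_trans (Im_le_normc _) hk2.
    rewrite ReB ImB /plane_pt /= !ler_norml /box /= !in_itv /= => h1 h2.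
    by case: x {Dx E w0 w2 hk1 hk2} h1 h2 => x1 x2 /=; split; lra.
  have p0 : (0 : R) < 2^-1 ^+ k by rewrite exprn_gt0 // invr_gt0.
  apply: (@le_trans _ _ ((2^-1 ^+ k) `^ q)).
    rewrite -[q]opprK 2!(powRN _ (- q)) lef_pV2 ?posrE ?powR_gt0 //.
    by apply: ge0_ler_powR; rewrite ?nnegrE ?oppr_ge0 ?normc_ge0 // ltW.
  have -> : 2^-1 ^+ k = (2^-1 : R) `^ k%:R by rewrite powR_mulrn // invr_ge0.
  have -> : b ^+ k = b `^ k%:R by rewrite powR_mulrn // ltW.
  rewrite -(powR_inv1 (ler0n R 2)) /b -!powRrM.
  by rewrite (_ : -1 * (k%:R * q) = - q * k%:R) //; ring.
apply: (@le_lt_trans _ _ (\int[mu2]_(x in D) \sum_(0 <= k <oo) G k x)%E).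
  apply: ge0_le_integral => //; first exact: measurableT_comp.
  - exact: ge0_emeasurable_sum.
rewrite integral_nneseries //.
apply: (@le_lt_trans _ _ (16 / (1 - b / 4))%:E); last exact: ltry.
apply: lime_le.
  by apply: is_cvg_nneseries => n _ _; apply: integral_ge0 => x _; exact: G0.
apply: nearW => n.
apply: (@le_trans _ _ (series (geometric 16 (b / 4)) n)%:E); last first.
  rewrite lee_fin geometric_le_lim //; first by rewrite divr_gt0.
  by rewrite ger0_norm ?divr_ge0 ?ltW // ltr_pdivrMr // mul1r.
rewrite /series /= -sumEFin; apply: lee_sum => k _.
rewrite /G; under eq_integral do rewrite EFinM.
rewrite ge0_integralZl //; last first.
- by rewrite lee_fin exprn_ge0 // ltW.
- by apply/measurable_EFinP; exact: measurable_indic.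
rewrite integral_indic //.
apply: (@le_trans _ _ ((b ^+ k)%:E * mu2 (box a (2 * 2^-1 ^+ k)))%E).
  rewrite lee_pmul2l ?lte_fin ?exprn_gt0 //; apply: le_measure; rewrite ?inE //.
  exact: measurableI.
rewrite measure_box ?mulr_gt0 ?exprn_gt0 ?invr_gt0 // -EFinM lee_fin.
rewrite expr_div_n !exprMn -exprM mulnC exprM exprVn.
by rewrite (_ : 2 ^+ 2 = 4) ?exprVn; [rewrite (_ : 4 ^+ k = 4 ^+ k) //; lra | lra].
Qed.

(** The section of the disc at [x] has length [2 sqrt (1 - x^2)]; substitute
    [x = sin t]. *)
Lemma disc_area : rint (fun _ : C => 1) = 1.
Proof.
have mD := @measurable_disc R.
rewrite /rint /Rintegral (sigma_integral (u := fun=> 1) (rintegrable_cst 1)).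
rewrite integral_cst // mul1e.
transitivity (fine ((pi^-1)%:E * mu2 D)); first by [].
suff -> : mu2 D = pi%:E by rewrite -EFinM mulVf // gt_eqF // pi_gt0.
rewrite -[LHS]/(\int[mu]_x (mu (xsection D x)))%E.
have secE (x : R) : mu (xsection D x) = (2 * Num.sqrt (1 - x ^+ 2))%:E.
  have -> : xsection D x =
      `]- Num.sqrt (1 - x ^+ 2), Num.sqrt (1 - x ^+ 2)[%classic.
    apply/seteqP; split => y; rewrite /xsection /= inE /= discE in_itv /=.
      rewrite -(@expr_lt1 _ 2) ?normc_ge0 // sqr_normcE /= => h.
      rewrite -ltr_norml -sqrtr_sqr ltr_sqrt //; have := sqr_ge0 y; lra.
    rewrite -ltr_norml -sqrtr_sqr => h.
    have h0 : 0 < 1 - x ^+ 2 by rewrite -sqrtr_gt0 (le_lt_trans _ h) // sqrtr_ge0.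
    move: h; rewrite ltr_sqrt // => h.
    by rewrite -(@expr_lt1 _ 2) ?normc_ge0 // sqr_normcE /=; lra.
  rewrite lebesgue_measure_itv /= lte_fin.
  case: ifPn => h; first by rewrite -EFinD; congr EFin; ring.
  have -> : Num.sqrt (1 - x ^+ 2) = 0.
    apply/eqP; rewrite eq_le sqrtr_ge0 andbT; move: h; rewrite -leNgt.
    by have := sqrtr_ge0 (1 - x ^+ 2); lra.
  by rewrite mulr0.
under eq_integral do rewrite secE.
have -> : (\int[mu]_x (2 * Num.sqrt (1 - x ^+ 2))%:E =
   \int[mu]_(x in `[sin (- (pi / 2)), sin (pi / 2)]) (2 * Num.sqrt (1 - x ^+ 2))%:E)%E.
  rewrite sinN sin_pihalf [RHS]integral_mkcond; apply: eq_integral => x _.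
  rewrite patchE mem_setE in_itv /=; case: ifPn => // h.
  rewrite ler0_sqrtr ?mulr0 //; move: h; rewrite -ler_norml -ltNge => h.
  have : 1 <= `|x| ^+ 2 by rewrite expr_ge1 // ltW.
  rewrite real_normK ?num_real //; lra.
have pi0 := pi_gt0 R.
have dsin : (@sin R)^`()%classic = @cos R.
  by apply/funext => x; rewrite derive1E; have := is_derive_sin x => h; rewrite derive_val.
rewrite integration_by_substitution_increasing.
- transitivity (\int[mu]_(x in `[(- (pi / 2))%R, (pi / 2)%R]) (2 * cos x ^+ 2)%:E)%E.
    apply: eq_integral => x; rewrite inE /= in_itv /= => hx; congr EFin.
    change (2 * Num.sqrt (1 - sin (x : R) ^+ 2) * (@sin R)^`()%classic x = 2 * cos (x : R) ^+ 2).
    rewrite dsin -(cos2Dsin2 (x : R)) addrK sqrtr_sqr ger0_norm; first ring.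
    exact: cos_ge0_pihalf.
  apply: etrans (@ftc_segment R (fun x => x + sin x * cos x)
    (fun x => 2 * cos x ^+ 2) (- (pi / 2)) (pi / 2) _ _ _) _.
  + lra.
  + move=> x _; apply: (@is_derive_eq _ _ _ _ _ _ _ _ (is_deriveD
      (is_derive_id x 1) (is_deriveM (is_derive_sin x) (is_derive_cos x)))).
    rewrite /GRing.scale /= -[1 in LHS](cos2Dsin2 x); ring.
  + move=> x _; apply: differentiable_continuous; apply/derivable1_diffP.
    by [].
  by rewrite cosN cos_pihalf !mulr0 !addr0; congr EFin; lra.
- lra.
- by move=> x y hx hy xy; rewrite ltr_sin.
- by rewrite dsin => x _; exact: continuous_cos.
- by rewrite dsin; apply/cvg_ex; exists (cos (- (pi / 2))); apply: cvg_at_right_filter; exact: continuous_cos.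
- by rewrite dsin; apply/cvg_ex; exists (cos (pi / 2)); apply: cvg_at_left_filter; exact: continuous_cos.
- split; first by [].
  + by apply: cvg_at_right_filter; exact: continuous_sin.
  + by apply: cvg_at_left_filter; exact: continuous_sin.
- apply: continuous_subspaceT => x; apply: cvgM; first exact: cvg_cst.
  apply: (@continuous_comp _ _ _ (fun x : R => 1 - x ^+ 2) (@Num.sqrt R)); last exact: sqrt_continuous.
  by apply: differentiable_continuous; apply/derivable1_diffP.
Qed.

End PowerIntegrability.

(** * Cousin's lemma and holomorphic functions *)

Section Cousin.
Variable R : realType.

(** Bisection: a property that fails for a rectangle fails for one of its
    quarters, hence for arbitrarily small rectangles around some point. All
    rectangles have sides [t * w] and [t * v], so that [t] measures them. *)
Lemma cousin_rect (P : R -> R -> R -> Prop) (w v x0 y0 : R) :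
  0 <= w -> 0 <= v ->
  (forall x y t, 0 < t -> P x y (t / 2) -> P (x + t / 2 * w) y (t / 2) ->
     P x (y + t / 2 * v) (t / 2) -> P (x + t / 2 * w) (y + t / 2 * v) (t / 2) ->
     P x y t) ->
  (forall a b, x0 <= a <= x0 + w -> y0 <= b <= y0 + v ->
     exists2 d : R, 0 < d & forall x y t, 0 < t -> t < d ->
       x <= a <= x + t * w -> y <= b <= y + t * v ->
       x0 <= x -> x + t * w <= x0 + w -> y0 <= y -> y + t * v <= y0 + v ->
       P x y t) ->
  P x0 y0 1.
Proof.
move=> w0 v0 Pquarter Plocal; apply: contrapT => nP.
pose inside (p : R * R) t (p' : R * R) :=
  [/\ p.1 <= p'.1, p'.1 + t / 2 * w <= p.1 + t * w, p.2 <= p'.2 &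
      p'.2 + t / 2 * v <= p.2 + t * v].
pose nxt (p : R * R) t := xget p [set p' | ~ P p'.1 p'.2 (t / 2) /\ inside p t p'].
have nxtP p t : 0 < t -> ~ P p.1 p.2 t ->
    ~ P (nxt p t).1 (nxt p t).2 (t / 2) /\ inside p t (nxt p t).
  move=> t0 np; rewrite /nxt; case: xgetP => [y _ []//|h].
  exfalso; apply: np; apply: Pquarter => //; apply: contrapT => hp.
  - apply: (h p); split => //; split => //=; nra.
  - apply: (h (p.1 + t / 2 * w, p.2)); split => //; split => //=; nra.
  - apply: (h (p.1, p.2 + t / 2 * v)); split => //; split => //=; nra.
  - apply: (h (p.1 + t / 2 * w, p.2 + t / 2 * v)); split => //; split => //=; nra.
pose tn (n : nat) : R := 2^-1 ^+ n.
have tn0 n : 0 < tn n by rewrite exprn_gt0 // invr_gt0.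
have tnS n : tn n.+1 = tn n / 2 by rewrite /tn exprSr.
pose pn := fix pn n := if n is m.+1 then nxt (pn m) (tn m) else (x0, y0).
have npn n : ~ P (pn n).1 (pn n).2 (tn n).
  by elim: n => [|n IH]; rewrite ?expr0 // tnS; have [] := nxtP _ _ (tn0 n) IH.
have ins n : inside (pn n) (tn n) (pn n.+1) by have [] := nxtP _ _ (tn0 n) (npn n).
have mono1 n m : (n <= m)%N ->
    [/\ (pn n).1 <= (pn m).1, (pn m).1 + tn m * w <= (pn n).1 + tn n * w,
        (pn n).2 <= (pn m).2 & (pn m).2 + tn m * v <= (pn n).2 + tn n * v].
  move=> /subnKC <-; elim: (m - n)%N => [|k [h1 h2 h3 h4]]; first by rewrite addn0.
  have [g1 g2 g3 g4] := ins (n + k)%N; rewrite addnS tnS; split.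
  - exact: le_trans g1.
  - exact: le_trans h2.
  - exact: le_trans g3.
  - exact: le_trans h4.
have limit (c : nat -> R) (l : R) : 0 <= l ->
    (forall n m, (n <= m)%N -> c n <= c m /\ c m + tn m * l <= c n + tn n * l) ->
    exists a, forall n, c n <= a <= c n + tn n * l.
  move=> l0 hc; have bnd m n : c m <= c n + tn n * l.
    have [nm|mn] := leqP n m.
      have [_ h] := hc _ _ nm; apply: le_trans h; rewrite lerDl mulr_ge0 //; exact: ltW.
    have [h _] := hc _ _ (ltnW mn); apply: (le_trans h).
    by rewrite lerDl mulr_ge0 //; exact: ltW.
  exists (sup (range c)) => n; apply/andP; split.
    apply: ub_le_sup; last by exists n.
    by exists (c 0%N + tn 0%N * l) => _ [m _ <-].
  apply: ge_sup; first by exists (c 0%N), 0%N.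
  by move=> _ [m _ <-].
have [|a ha] := limit (fun n => (pn n).1) w w0.
  by move=> n m /mono1[].
have [|b hb] := limit (fun n => (pn n).2) v v0.
  by move=> n m /mono1[].
have ha0 := ha 0%N; have hb0 := hb 0%N; rewrite /tn expr0 !mul1r /= in ha0 hb0.
have [d d0 hd] := Plocal a b ha0 hb0.
have [n _ hn] := near_infty_natSinv_expn_lt (PosNum d0).
have tnd : tn n < d by have := hn n (leqnn n); rewrite /= /tn exprVn div1r.
have [h1 h2 h3 h4] := mono1 0%N n (leq0n n); rewrite /tn expr0 !mul1r /= in h1 h2 h3 h4.
by apply: (npn n); apply: hd => //.
Qed.

End Cousin.

Section Holomorphic.
Variable R : realType.
Local Notation C := R[i].
Local Notation "x ^*" := (conjc x) : ring_scope.
Implicit Types (f g : C -> C).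

(** The last argument of [C1at] encodes the Cauchy-Riemann equations; the
    continuity of the derivative belongs to this notion. *)
Definition hol f f' (z : C) := C1at f f' (fun w => 'i * f' w) z.

Definition hol_disc f f' := forall z, disc z -> hol f f' z.

Lemma mul_ii : 'i * 'i = -1 :> C.
Proof. by rewrite -expr2 sqr_i. Qed.

Lemma hol_cst (k : C) z : hol (fun=> k) (fun=> 0) z.
Proof. by apply: C1at_eq (C1at_cst k z) => w; split => //; rewrite mulr0. Qed.

Lemma hol_id (z : C) : hol (fun w => w) (fun=> 1) z.
Proof. by apply: C1at_eq (C1at_id z) => w; split => //; rewrite mulr1. Qed.

Lemma holD f f' g g' z : hol f f' z -> hol g g' z ->
  hol (fun w => f w + g w) (fun w => f' w + g' w) z.
Proof.
by move=> hf hg; apply: C1at_eq (C1atD hf hg) => w; split => //; rewrite mulrDr.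
Qed.

Lemma holM f f' g g' z : hol f f' z -> hol g g' z ->
  hol (fun w => f w * g w) (fun w => f' w * g w + f w * g' w) z.
Proof.
move=> hf hg; apply: C1at_eq (C1atM hf hg) => w; split => //; ring.
Qed.

Lemma hol_eq f f' g g' z : (forall w, f w = g w) -> (forall w, f' w = g' w) ->
  hol f f' z -> hol g g' z.
Proof. by move=> h h'; apply: C1at_eq => w; rewrite h h'. Qed.

Lemma holZ (k : C) f f' z : hol f f' z -> hol (fun w => k * f w) (fun w => k * f' w) z.
Proof.
move=> hf; apply: hol_eq (holM (hol_cst k z) hf) => // w; by rewrite mul0r add0r.
Qed.

Lemma holN f f' z : hol f f' z -> hol (fun w => - f w) (fun w => - f' w) z.
Proof.
by move=> hf; apply: hol_eq (holZ (-1) hf) => w; rewrite mulN1r.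
Qed.

Lemma holB f f' g g' z : hol f f' z -> hol g g' z ->
  hol (fun w => f w - g w) (fun w => f' w - g' w) z.
Proof. by move=> hf hg; exact: holD hf (holN hg). Qed.

Lemma C1at_conj_hol f f' z : hol f f' z ->
  C1at (fun w => (f w)^*) (fun w => (f' w)^*) (fun w => - 'i * (f' w)^*) z.
Proof.
move=> hf; apply: C1at_eq (C1at_conj hf) => w; split => //.
rewrite rmorphM /=; congr (_ * _); by apply: complexP; rewrite /= ?oppr0.
Qed.

(** Real calculus for [1 / f = f^* / |f|^2], the reciprocal of a real function. *)
Lemma holV f f' z : f z != 0 -> hol f f' z ->
  hol (fun w => (f w)^-1) (fun w => - f' w / f w ^+ 2) z.
Proof.
move=> fz hf.
have hn := C1atM hf (C1at_conj_hol hf).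
have n0 : normc (f z) ^+ 2 != 0 by rewrite expf_neq0 // normc_eq0.
have hn2 : C1at (fun w => (normc (f w) ^+ 2)%:C)
    (fun w => f' w * (f w)^* + f w * (f' w)^*)
    (fun w => 'i * f' w * (f w)^* + f w * (- 'i * (f' w)^*)) z.
  by apply: C1at_eq hn => w; rewrite mul_conjc.
have hV := C1at_rfun (phi := fun t : R => t^-1) (dphi := fun t => - t ^- 2)
  (v := fun w => normc (f w) ^+ 2).
have {hV} hV : C1at (fun w => ((normc (f w) ^+ 2)^-1)%:C)
    (fun w => (- (normc (f w) ^+ 2) ^- 2)%:C * (f' w * (f w)^* + f w * (f' w)^*))
    (fun w => (- (normc (f w) ^+ 2) ^- 2)%:C *
      ('i * f' w * (f w)^* + f w * (- 'i * (f' w)^*))) z.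
  apply: hV hn2.
    apply: (@is_derive_eq _ _ _ _ _ _ _ _ (@is_deriveV _ id _ _ _ n0 (is_derive_id _ _))).
    by rewrite /GRing.scale /= mulr1.
  apply: differentiable_continuous; apply/derivable1_diffP.
  by apply: derivableN; apply: derivableV; [rewrite expf_neq0|].
have h := C1atM hV (C1at_conj_hol hf).
apply: C1at_eq h => w.
have [E|E] := eqVneq (f w) 0.
  have z1 : (normc (f w) ^- 2)%:C = 0 by rewrite E normc0 expr0n invr0.
  have z2 : (- (normc (f w) ^+ 2) ^- 2)%:C = 0.
    by rewrite E normc0 expr0n expr0n invr0 oppr0.
  by rewrite z1 z2 E expr0n !invr0 !mul0r !mulr0 !addr0.
have cE : (f w)^* != 0 by rewrite conjc_eq0.
have V1 : ((normc (f w) ^+ 2)^-1)%:C = (f w * (f w)^*)^-1.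
  by rewrite mul_conjc fmorphV.
have V2 : (- (normc (f w) ^+ 2) ^- 2)%:C = - (f w * (f w)^*) ^- 2.
  by rewrite mul_conjc rmorphN fmorphV rmorphXn.
rewrite V1 V2; split; field; by rewrite E cE.
Qed.

Lemma hol_exp f f' z n : hol f f' z ->
  hol (fun w => f w ^+ n) (fun w => n%:R * f w ^+ n.-1 * f' w) z.
Proof.
move=> hf; elim: n => [|n IH].
  by apply: hol_eq (hol_cst 1 z) => w; rewrite ?expr0 ?mul0r.
apply: hol_eq (holM hf IH) => w; rewrite ?exprS //=.
case: n {IH} => [|n] /=; first by rewrite expr0; ring.
by rewrite -[in RHS]natr1 exprS; ring.
Qed.

Lemma hol_horner (P : {poly C}) z : hol (fun w => P.[w]) (fun w => P^`().[w]) z.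
Proof.
elim/poly_ind: P => [|P c IH].
  by apply: hol_eq (hol_cst 0 z) => w; rewrite ?deriv0 horner0.
apply: hol_eq (holD (holM IH (hol_id z)) (hol_cst c z)) => w.
  by rewrite hornerMXaddC.
by rewrite derivD derivM derivX derivC !hornerD !hornerM hornerX hornerC horner0.
Qed.

Lemma hol_ccont f f' z : hol f f' z -> ccont f z.
Proof. by case. Qed.

(** Cousin's lemma replaces compactness; at points outside the closed sub-disc
    the local bound holds vacuously. *)
Lemma bounded_subdisc f (rho : R) : 0 < rho < 1 ->
  (forall z, disc z -> ccont f z) ->
  exists2 M : R, 0 < M & forall z, normc z ^+ 2 <= rho -> normc (f z) <= M.
Proof.
move=> /andP[rho0 rho1] cf.
pose P (x y t : R) := exists M : R, forall z : C, x <= Re z <= x + t * 2 ->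
  y <= Im z <= y + t * 2 -> normc z ^+ 2 <= rho -> normc (f z) <= M.
have : P (-1) (-1) 1.
  apply: (@cousin_rect R P 2 2) => //.
    move=> x y t t0 [M1 h1] [M2 h2] [M3 h3] [M4 h4].
    exists (Num.max (Num.max M1 M2) (Num.max M3 M4)) => z hx hy hz.
    rewrite !le_max; have [x1|x1] := leP (Re z) (x + t); have [y1|y1] := leP (Im z) (y + t).
    - by rewrite (h1 z _ _ hz) //; lra.
    - by rewrite (h3 z _ _ hz) ?orbT //; lra.
    - by rewrite (h2 z _ _ hz) ?orbT //; lra.
    - by rewrite (h4 z _ _ hz) ?orbT //; lra.
  move=> a b ha hb.
  have near0 (d : R) : 0 < d -> exists2 d' : R, 0 < d' &
      forall x y t, 0 < t -> t < d' -> x <= a <= x + t * 2 -> y <= b <= y + t * 2 ->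
      forall z : C, x <= Re z <= x + t * 2 -> y <= Im z <= y + t * 2 ->
      normc (z - (a +i* b)) < d.
    move=> d0; exists (d / 8); first by rewrite divr_gt0.
    move=> x y t t0 td xa yb z hx hy; apply: (le_lt_trans (normc_le_ReIm _)).
    rewrite ReB ImB /=; have : `|Re z - a| <= t * 2 by rewrite ler_norml; lra.
    have : `|Im z - b| <= t * 2 by rewrite ler_norml; lra.
    lra.
  have [hin|hout] := leP (normc (a +i* b) ^+ 2) rho.
    have dab : disc (a +i* b).
      rewrite discE -(@expr_lt1 _ 2) ?normc_ge0 //; exact: le_lt_trans rho1.
    have [d d0 hd] := cf _ dab 1 ltr01; have [d' d'0 hd'] := near0 d d0.
    exists d' => // x y t t0 td xa yb _ _ _ _; exists (normc (f (a +i* b)) + 1) => z hx hy _.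
    have := hd z (hd' x y t t0 td xa yb z hx hy).
    by have := normc_sub_ge (f z) (f (a +i* b)); lra.
  have n0 : 0 < normc (a +i* b) ^+ 2 - rho by rewrite subr_gt0.
  have := ccontM (ccont_norm (ccont_id (a +i* b))) (ccont_norm (ccont_id (a +i* b))).
  move=> /(_ _ n0)[d d0 hd]; have [d' d'0 hd'] := near0 d d0.
  exists d' => // x y t t0 td xa yb _ _ _ _; exists 0 => z hx hy hz.
  have := hd z (hd' x y t t0 td xa yb z hx hy).
  rewrite -!rmorphM -rmorphB normc_real -!expr2 ltr_norml; lra.
move=> [M hM]; exists (`|M| + 1); first by rewrite ltr_wpDl.
move=> z hz; have n1 : normc z <= 1.
  rewrite -(@expr_le1 _ 2) ?normc_ge0 //; lra.
have := Re_le_normc z; have := Im_le_normc z; rewrite !ler_norml => h1 h2.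
apply: (@le_trans _ _ M); first by apply: hM => //; lra.
by apply: (le_trans (ler_norm M)); rewrite lerDl.
Qed.

End Holomorphic.

(** * Stokes for holomorphic functions *)

Section BergmanKernel.
Variable R : realType.
Local Notation C := R[i].
Local Notation "x ^*" := (conjc x) : ring_scope.
Implicit Types (f g : C -> C) (v : C -> R).

Lemma mvt_bound (u du : R -> R) (a b M : R) :
  (forall x, Num.min a b <= x <= Num.max a b ->
     is_derive x 1 u (du x) /\ `|du x| <= M) ->
  `|u b - u a| <= M * `|b - a|.
Proof.
wlog ab : a b / a <= b => [hw|].
  have [ab h|ba h] := leP a b.
    by apply: hw => // x; rewrite (min_idPl ab) (max_idPr ab); exact: h.
  rewrite distrC (distrC b) hw //; first exact: ltW.
  by move=> x; rewrite (min_idPl (ltW ba)) (max_idPr (ltW ba)); exact: h.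
rewrite (min_idPl ab) (max_idPr ab) => h.
have [E|nab] := eqVneq a b; first by rewrite E !subrr normr0 mulr0.
have lab : a < b by rewrite lt_neqAle nab.
have [||c hc ->] := @MVT R u du a b lab.
- by move=> x; rewrite in_itv /= => /andP[/ltW h1 /ltW h2]; have [|//] := h x; rewrite h1.
- apply: continuous_in_subspaceT => x; rewrite inE /= in_itv /= => hx.
  apply: differentiable_continuous; apply/derivable1_diffP.
  by have [[]] := h x hx.
rewrite normrM ler_wpM2r //; have [] // := h c.
by move: hc; rewrite in_itv /= => /andP[/ltW -> /ltW ->].
Qed.

Lemma cder_mvt_bound (G l : R -> C) (a b M : R) :
  (forall x, Num.min a b <= x <= Num.max a b -> cder G x (l x) /\ normc (l x) <= M) ->
  normc (G b - G a) <= 2 * M * `|b - a|.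
Proof.
move=> h.
have key (P : C -> R) : (forall z, `|P z| <= normc z) ->
    (forall x A, cder G x A -> is_derive x 1 (fun t => P (G t)) (P A)) ->
    `|P (G b) - P (G a)| <= M * `|b - a|.
  move=> bP dP; apply: (@mvt_bound (fun t => P (G t)) (fun t => P (l t))).
  move=> x /h[h1 h2]; split; first exact: dP.
  exact: le_trans h2.
apply: (le_trans (normc_le_ReIm _)); rewrite ReB ImB.
have := key _ (@Re_le_normc R) (fun x A => @proj1 _ _).
have := key _ (@Im_le_normc R) (fun x A => @proj2 _ _).
lra.
Qed.

Lemma normc_mulD (a b c d : C) (A B A' B' : R) :
  normc a <= A -> normc b <= B -> normc c <= A' -> normc d <= B' ->
  normc (a * b + c * d) <= A * B + A' * B'.
Proof.
move=> h1 h2 h3 h4; apply: (le_trans (normcD _ _)).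
by rewrite !normcM lerD // ler_pM ?normc_ge0.
Qed.

Lemma normc_mono (z w : C) : `|Re z| <= `|Re w| -> `|Im z| <= `|Im w| ->
  normc z <= normc w.
Proof.
move=> h1 h2; rewrite -(@ler_pXn2r _ 2) ?nnegrE ?normc_ge0 // !sqr_normcE.
by rewrite -(real_normK (num_real (Re z))) -(real_normK (num_real (Im z)))
  -(real_normK (num_real (Re w))) -(real_normK (num_real (Im w)))
  lerD // lerXn2r ?nnegrE.
Qed.

Lemma hol_partials f f' z : hol f f' z ->
  [/\ xder f z (f' z), yder f z ('i * f' z) & ccont f' z].
Proof. by case. Qed.

(** Go from [w] to [z] along a horizontal and then a vertical segment. *)
Lemma hol_lipschitz f f' (w : C) (r : R) : 0 < r ->
  (forall z, normc (z - w) < r ->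
    [/\ xder f z (f' z), yder f z ('i * f' z) & ccont f' z]) ->
  exists d M : R, [/\ 0 < d, d <= r, 0 <= M &
    forall z, normc (z - w) < d -> normc (f z - f w) <= M * normc (z - w)].
Proof.
move=> r0 hf; have ww : normc (w - w) < r by rewrite subrr normc0.
have [_ _ cf'] := hf w ww; have [d d0 hd] := cf' 1 ltr01.
pose M0 := normc (f' w) + 1; have M00 : 0 <= M0 by rewrite addr_ge0 ?normc_ge0.
pose d1 := Num.min d r; exists d1, (4 * M0); split.
- by rewrite lt_min d0.
- by rewrite ge_min lexx orbT.
- by rewrite mulr_ge0.
move=> z hz; have bf' u : normc (u - w) <= normc (z - w) ->
    [/\ xder f u (f' u), yder f u ('i * f' u) & ccont f' u] /\ normc (f' u) <= M0.
  move=> /le_lt_trans/(_ hz); rewrite lt_min => /andP[/hd h1 /hf h2]; split => //.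
  by have := normc_sub_ge (f' u) (f' w); rewrite /M0; lra.
pose c := Re z +i* Im w.
have hline x : Num.min (Re w) (Re z) <= x <= Num.max (Re w) (Re z) ->
    xder f (x +i* Im w) (f' (x +i* Im w)) /\ normc (f' (x +i* Im w)) <= M0.
  move=> hx; suff /bf'[[]] : normc (x +i* Im w - w) <= normc (z - w) by [].
  apply: normc_mono; rewrite ?ReB ?ImB /= ?subrr ?normr0 //.
  move: hx; case: (leP (Re w) (Re z)) => h h2.
    by rewrite !ger0_norm; lra.
  by rewrite !ler0_norm; lra.
have vline y : Num.min (Im w) (Im z) <= y <= Num.max (Im w) (Im z) ->
    yder f (Re z +i* y) ('i * f' (Re z +i* y)) /\ normc (f' (Re z +i* y)) <= M0.
  move=> hy; suff /bf'[[]] : normc (Re z +i* y - w) <= normc (z - w) by [].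
  apply: normc_mono; rewrite ?ReB ?ImB /= //.
  move: hy; case: (leP (Im w) (Im z)) => h h2.
    by rewrite !ger0_norm; lra.
  by rewrite !ler0_norm; lra.
have ni u : normc ('i * f' u) = normc (f' u) by rewrite normcM normc_i mul1r.
have F1 : normc (f z - f c) <= 2 * M0 * `|Im z - Im w|.
  rewrite -[f z](congr1 f (complex_eta z)).
  apply: (@cder_mvt_bound (fun y => f (Re z +i* y)) (fun y => 'i * f' (Re z +i* y))) => y /vline.
  by rewrite ni.
have F2 : normc (f c - f w) <= 2 * M0 * `|Re z - Re w|.
  rewrite -[f w](congr1 f (complex_eta w)).
  exact: (@cder_mvt_bound (fun x => f (x +i* Im w)) (fun x => f' (x +i* Im w))).
rewrite (_ : f z - f w = (f z - f c) + (f c - f w)); last by ring.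
apply: (le_trans (normcD _ _)); apply: (le_trans (lerD F1 F2)).
rewrite -mulrDr (_ : 4 * M0 * normc (z - w) = 2 * M0 * (2 * normc (z - w))); last ring.
rewrite ler_wpM2l ?mulr_ge0 // mulr_natl mulr2n lerD // -?ReB -?ImB.
  exact: Im_le_normc.
exact: Re_le_normc.
Qed.

Lemma cintegrable_cont f v : (forall z, disc z -> ccont f z) -> rintegrable v ->
  (forall z, disc z -> normc (f z) <= v z) -> cintegrable f.
Proof.
move=> cf; apply: cintegrable_le; apply: (ccont_cmeas (s := [::])) => z dz _.
exact: cf.
Qed.

Lemma C1at_onem_sqnorm (z : C) : C1at (fun w => (1 - normc w ^+ 2)%:C)
  (fun w => - (w^* + w)) (fun w => - ('i * w^* - 'i * w)) z.
Proof.
apply: C1at_eq (C1atD (C1at_cst 1 z) (C1atM (C1at_cst (-1) z) (C1at_sqnorm z))) => w.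
by rewrite rmorphB rmorph1 !mul0r !add0r !mulN1r.
Qed.

Lemma disc_denom_ge (w z : C) : disc w -> disc z ->
  1 - normc w <= normc (1 - w * z^*).
Proof.
rewrite !discE => dw dz; apply: le_trans (normc_sub_ge _ _).
rewrite normc1 normcM normc_conj lerD2l lerN2 ler_piMr ?normc_ge0 //; exact: ltW.
Qed.

Lemma disc_denom_neq0 (w z : C) : disc w -> disc z -> 1 - w * z^* != 0.
Proof.
move=> dw dz; rewrite -normc_gt0; apply: lt_le_trans (disc_denom_ge dw dz).
by move: dw; rewrite discE; lra.
Qed.

Lemma hol_cauchy (w z : C) : disc w -> disc z ->
  hol (fun u => (1 - w^* * u)^-1) (fun u => w^* / (1 - w^* * u) ^+ 2) z.
Proof.
move=> dw dz.
have n0 : 1 - w^* * z != 0.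
  have := disc_denom_neq0 (disc_conj dw) (disc_conj dz); by rewrite conjcK.
have h := @holV R (fun u => 1 - w^* * u) (fun u => 0 - w^* * 1) z n0
  (holB (hol_cst 1 z) (holZ w^* (hol_id z))).
apply: hol_eq h => // u.
by rewrite sub0r opprK mulr1.
Qed.

(** Integrability by a majorant, which spares the measurability of the modulus. *)
Definition A1 f := exists2 v, rintegrable v & forall z, disc z -> normc (f z) <= v z.

(** Stokes for [F (1 - |z|^2) G^*] with [F] and [G] holomorphic: the first factor
    vanishes at the boundary, and only [G^*] and [1 - |z|^2] depend on the
    conjugate variable. *)
Lemma stokes_hol (s : seq C) F F' G G' v (B : R) : 0 <= B ->
  (forall z, disc z -> z \notin s -> hol F F' z) -> hol_disc G G' ->
  (forall z, disc z -> normc (G z) <= B /\ normc (G' z) <= B) ->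
  rintegrable v -> (forall z, disc z -> 0 <= v z) ->
  (forall z, disc z -> z \notin s -> normc (F z) <= v z) ->
  (forall rho, 0 < rho < 1 -> exists2 u, rintegrable u &
    forall z, normc z ^+ 2 < rho -> z \notin s -> normc (F' z) <= u z) ->
  disc_int (off s (fun z =>
    F z * ((1 - normc z ^+ 2)%:C * (G' z)^* - z * (G z)^*))) = 0.
Proof.
move=> B0 hF hG hB iv v0 hv hu.
pose t z : C := (1 - normc z ^+ 2)%:C.
pose g z := (2^-1 * G z)^*; pose g' z := (2^-1 * G' z)^*.
pose U z := t z * g z.
pose Ux z := - (z^* + z) * g z + t z * g' z.
pose Uy z := - ('i * z^* - 'i * z) * g z + t z * (- 'i * g' z).
have hU z : disc z -> C1at U Ux Uy z.
  by move=> dz; exact: C1atM (C1at_onem_sqnorm z) (C1at_conj_hol (holZ 2^-1 (hG z dz))).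
have E z : (F' z * U z + F z * Ux z) + 'i * ('i * F' z * U z + F z * Uy z) =
    F z * (t z * (G' z)^* - z * (G z)^*).
  have h2 (x : C) : x^* = 2 * (2^-1 * x)^*.
    by rewrite [(2^-1 * x)^*]rmorphM fmorphV rmorph_nat /= mulVKf.
  rewrite (h2 (G z)) (h2 (G' z)) -/(g z) -/(g' z).
  transitivity ((1 + 'i * 'i) * (F' z * U z - F z * z^* * g z) +
    (1 - 'i * 'i) * (F z * (t z * g' z - z * g z))); first by rewrite /Ux /Uy; ring.
  by rewrite mul_ii; ring.
have n2 (z : C) : disc z -> normc (z^* + z) <= 2 /\ normc ('i * z^* - 'i * z) <= 2.
  rewrite discE => dz; split; first by apply: (le_trans (normcD _ _)); rewrite normc_conj; lra.
  by apply: (le_trans (normcB _ _)); rewrite !(normcM 'i) normc_conj normc_i; lra.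
have bg z : disc z -> normc (g z) <= B /\ normc (g' z) <= B.
  move=> /hB[h1 h2]; rewrite !normc_conj !(normcM 2^-1) normcV normc_nat.
  by have := normc_ge0 (G z); have := normc_ge0 (G' z); split; lra.
have t0 (z : C) : disc z -> 0 <= 1 - normc z ^+ 2 by move=> /disc_sqr; lra.
have nt z : disc z -> normc (t z) <= 1.
  by move=> dz; rewrite normc_real ger0_norm ?t0 // gerBl sqr_ge0.
have b3 (c1 c2 z : C) : disc z -> normc c1 <= 2 -> normc c2 <= 1 ->
    normc (c1 * g z + t z * (c2 * g' z)) <= 3 * B.
  move=> dz h1 h2; have [b1 b2] := bg z dz; rewrite (_ : 3 * B = 2 * B + 1 * (1 * B)); last by ring.
  apply: normc_mulD => //; first exact: nt.
  by rewrite normcM ler_pM ?normc_ge0.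
transitivity (disc_int (off s (fun z => (F' z * U z + F z * Ux z) +
    'i * ('i * F' z * U z + F z * Uy z)))).
  by apply: eq_disc_int => z _; rewrite /off E.
apply: (limit_stokes (f := fun z => F z * U z) (v := fun z => 2 * B * v z)).
- by move=> z dz zs; exact: C1atM (hF z dz zs) (hU z dz).
- exact: rintegrableZ.
- move=> z dz zs; rewrite E normcM mulrC ler_pM ?normc_ge0 ?hv //.
  have [h1 h2] := hB z dz; rewrite (_ : 2 * B = 1 * B + 1 * B) -1?mulNr; last by ring.
  apply: normc_mulD; rewrite ?normc_conj ?nt ?normcN //.
  by apply: ltW; rewrite -discE.
- move=> z dz zs; rewrite normcM (normcM (t z)) normc_real (ger0_norm (t0 z dz)).
  have [h1 _] := bg z dz; have v1 := hv z dz zs.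
  rewrite mulrCA mulrC ler_wpM2r ?t0 // mulrC -mulrA.
  apply: (@le_trans _ _ (B * v z)); first by rewrite ler_pM ?normc_ge0.
  by have := mulr_ge0 B0 (v0 z dz); lra.
move=> rho hrho; have [u iu hu'] := hu rho hrho.
exists (fun z => B * u z + 3 * B * v z).
  by apply: rintegrableD; exact: rintegrableZ.
move=> z hz zs; have dz : disc z.
  by rewrite discE -(@expr_lt1 _ 2) ?normc_ge0 //; case/andP: hrho => _; apply: lt_trans.
have [h1 h2] := bg z dz; have [h3 h4] := n2 z dz; have h5 := hu' z hz zs.
have bU : normc (U z) <= B by rewrite normcM -[leRHS]mul1r ler_pM ?normc_ge0 ?nt.
rewrite [B * u z]mulrC [3 * B * _]mulrC; split; apply: normc_mulD => //; rewrite ?hv //.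
- by have := b3 (- (z^* + z)) 1 z dz; rewrite mul1r normcN normc1; exact.
- by rewrite normcM normc_i mul1r.
- by apply: b3; rewrite ?normcN ?normc_i.
Qed.

(** Stokes applied to [(f z - f w) / (w - z)], which extends holomorphically
    across [w], and to the Cauchy kernel at [w]. *)
Lemma bergman_projection_sub f f' (w : C) : hol_disc f f' -> A1 f -> disc w ->
  disc_int (fun z => (f z - f w) * (1 - w * z^*) ^- 2) = 0.
Proof.
move=> hf [v0 iv0 hv0] dw.
pose g z := (f z - f w) * (w - z)^-1.
pose g' z := f' z * (w - z)^-1 + (f z - f w) * (1 / (w - z) ^+ 2).
have d0 : 0 < 1 - normc w by move: dw; rewrite discE; lra.
set e0 := (1 - normc w)^-1; have e00 : 0 < e0 by rewrite invr_gt0.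
pose G z := (1 - w^* * z)^-1; pose G' z := w^* / (1 - w^* * z) ^+ 2.
have hG : hol_disc G G' by move=> z dz; exact: hol_cauchy.
have GE z : (G z)^* = (1 - w * z^*)^-1.
  by rewrite fmorphV rmorphB rmorph1 rmorphM /= conjcK.
have G'E z : (G' z)^* = w * (1 - w * z^*)^-1 ^+ 2.
  by rewrite -GE rmorphM /= conjcK -exprVn rmorphXn.
have bG z : disc z -> normc (G z) <= e0 + e0 ^+ 2 /\ normc (G' z) <= e0 + e0 ^+ 2.
  move=> dz; have b1 : normc (G z) <= e0.
    rewrite -normc_conj GE normcV lef_pV2 ?posrE //; first exact: disc_denom_ge.
    by apply: lt_le_trans (disc_denom_ge dw dz).
  split; first by apply: (le_trans b1); rewrite lerDl sqr_ge0.
  apply: (@le_trans _ _ (1 * e0 ^+ 2)); last by rewrite mul1r lerDr ltW.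
  rewrite /G' normcM normc_conj -exprVn normcX ler_pM ?normc_ge0 ?exprn_ge0 ?normc_ge0 //.
    by apply: ltW; rewrite -discE.
  by rewrite lerXn2r ?nnegrE ?normc_ge0 // ltW.
have holg z : disc z -> z \notin [:: w] -> hol g g' z.
  rewrite inE eq_sym -subr_eq0 => dz zw.
  have hV := @holV R (fun u => w - u) (fun=> 0 - 1) z zw
    (holB (hol_cst w z) (hol_id z)).
  apply: hol_eq (holM (holB (hf z dz) (hol_cst (f w) z)) hV) => // u.
  by rewrite /g' subr0 sub0r opprK.
have [r r0 hr] := copen_disc dw.
have [d [M [dd0 dr M0 hM]]] := hol_lipschitz r0 (fun z hz => hol_partials (hf z (hr z hz))).
have bg z (B : R) : disc z -> z \notin [:: w] -> normc (f z) <= B ->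
    normc (g z) <= M + (B + normc (f w)) / d.
  rewrite inE -subr_eq0 -normc_gt0 => dz zw hB.
  have B0 : 0 <= B by apply: le_trans hB; exact: normc_ge0.
  rewrite /g normcM normcV [normc (w - z)]normc_distC ler_pdivrMr //.
  have [h|h] := ltP (normc (z - w)) d.
    apply: (le_trans (hM z h)); rewrite ler_wpM2r ?normc_ge0 // lerDl.
    by rewrite divr_ge0 ?addr_ge0 ?normc_ge0 // ltW.
  apply: (le_trans (normcB _ _)); apply: (@le_trans _ _ ((B + normc (f w)) / d * normc (z - w))).
    apply: (@le_trans _ _ (B + normc (f w))); first by rewrite lerD2r.
    by rewrite -mulrA ler_peMr ?addr_ge0 ?normc_ge0 // mulrC ler_pdivlMr // mul1r.
  by rewrite ler_wpM2r ?normc_ge0 // lerDr.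
rewrite -[RHS](@stokes_hol [:: w] g g' G G' (fun z => M + (v0 z + normc (f w)) / d) (e0 + e0 ^+ 2)) //.
- apply: eq_disc_int => z dz; rewrite /off; case: ifPn => [|zw].
    by rewrite inE => /eqP ->; rewrite subrr mul0r.
  have zw' : w - z != 0 by move: zw; rewrite inE eq_sym subr_eq0.
  have -> : (1 - normc z ^+ 2)%:C = 1 - z * z^* by rewrite mul_conjc rmorphB rmorph1.
  rewrite GE G'E /g.
  by field; rewrite zw' disc_denom_neq0.
- by rewrite addr_ge0 ?sqr_ge0 // ltW.
- apply: rintegrableD; first exact: rintegrable_cst.
  apply: (eq_rintegrable (u := fun z => d^-1 * (v0 z + normc (f w)))).
    by move=> z _; rewrite mulrC.
  by apply: rintegrableZ; apply: rintegrableD => //; exact: rintegrable_cst.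
- move=> z dz; rewrite addr_ge0 // divr_ge0 ?(ltW dd0) // addr_ge0 ?normc_ge0 //.
  by apply: le_trans (hv0 z dz); exact: normc_ge0.
- by move=> z dz zw; apply: bg => //; exact: hv0.
move=> rho hrho.
have [Mf Mf0 hMf] := bounded_subdisc hrho (fun z dz => hol_ccont (hf z dz)).
have [Mf' Mf'0 hMf'] := bounded_subdisc hrho (fun z dz => let: And5 _ _ _ h _ := hf z dz in h).
exists (fun z => (Mf' + (M + (Mf + normc (f w)) / d)) * normc (z - w) `^ (-1)).
  by apply: rintegrableZ; apply: rintegrable_power => //; lra.
move=> z hz zs; have dz : disc z.
  by rewrite discE -(@expr_lt1 _ 2) ?normc_ge0 //; case/andP: hrho => _; apply: lt_trans.
have zw : w - z != 0 by move: zs; rewrite inE eq_sym subr_eq0.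
rewrite (_ : g' z = (f' z + g z) * (w - z)^-1); last by rewrite /g' /g; field.
rewrite normcM normcV powR_inv1 ?normc_ge0 // [normc (w - z)]normc_distC.
rewrite ler_wpM2r ?invr_ge0 ?normc_ge0 // (le_trans (normcD _ _)) // lerD //.
  by apply: hMf'; exact: ltW.
by apply: bg => //; apply: hMf; exact: ltW.
Qed.

End BergmanKernel.

(** * The Bergman projection and Taylor coefficients *)

Section Coefficients.
Variable R : realType.
Local Notation C := R[i].
Local Notation "x ^*" := (conjc x) : ring_scope.
Implicit Types (f g : C -> C) (v : C -> R).

Lemma A1_mul_cintegrable f u (B : R) : A1 f ->
  (forall z, disc z -> ccont f z) -> (forall z, disc z -> ccont u z) ->
  (forall z, disc z -> normc (u z) <= B) -> cintegrable (fun z => f z * u z).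
Proof.
move=> [v iv hv] cf cu bu.
apply: (cintegrable_cont (v := fun z => B * v z)).
- by move=> z dz; apply: ccontM; [exact: cf|exact: cu].
- exact: rintegrableZ.
- move=> z dz; rewrite normcM mulrC ler_pM ?normc_ge0 //; [exact: bu|exact: hv].
Qed.

Lemma A1_cintegrable f : A1 f -> (forall z, disc z -> ccont f z) -> cintegrable f.
Proof.
move=> a1 cf; have := @A1_mul_cintegrable f (fun=> 1) 1 a1 cf.
move=> h; apply: eq_cintegrable (h _ _) => [z _|z _|z _]; rewrite ?mulr1 ?normc1 //.
exact: ccont_cst.
Qed.

Lemma A1_bounded f (B : R) : (forall z, disc z -> normc (f z) <= B) -> A1 f.
Proof. by move=> h; exists (fun=> B) => //; exact: rintegrable_cst. Qed.

Lemma A1D f g : A1 f -> A1 g -> A1 (fun z => f z + g z).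
Proof.
move=> [v iv hv] [w iw hw]; exists (fun z => v z + w z); first exact: rintegrableD.
by move=> z dz; apply: (le_trans (normcD _ _)); rewrite lerD ?hv ?hw.
Qed.

Lemma A1M f g (B : R) : A1 f -> (forall z, disc z -> normc (g z) <= B) ->
  A1 (fun z => g z * f z).
Proof.
move=> [v iv hv] hg; exists (fun z => B * v z); first exact: rintegrableZ.
by move=> z dz; rewrite normcM ler_pM ?normc_ge0 ?hg ?hv.
Qed.

Lemma disc_int_cst (k : C) : disc_int (fun=> k) = k.
Proof.
rewrite -[RHS]mulr1 -[in LHS](mulr1 k) disc_intZ; last exact: cintegrable_cst.
congr (_ * _); rewrite disc_intE; apply: complexP => /=; first exact: disc_area.
have := rintZ 0 (rintegrable_cst (1 : R)); rewrite [RHS]mul0r => h; rewrite -[RHS]h.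
by apply: eq_rint => z _; rewrite mul0r.
Qed.

Lemma ccont_cauchy (w z : C) : disc w -> disc z -> ccont (fun u => (1 - w * u^*)^-1) z.
Proof.
move=> dw dz; rewrite (_ : (fun _ => _) = (fun u => ((1 - w^* * u)^-1)^*)).
  by apply: ccont_conj; exact: (hol_ccont (hol_cauchy dw dz)).
by apply/funext => u; rewrite fmorphV rmorphB rmorph1 rmorphM /= conjcK.
Qed.

Lemma ccont_exp f z n : ccont f z -> ccont (fun u => f u ^+ n) z.
Proof.
move=> cf; elim: n => [|n IH].
  by rewrite (_ : (fun _ => _) = (fun=> 1)); [exact: ccont_cst|apply/funext => u; rewrite expr0].
rewrite (_ : (fun _ => _) = (fun u => f u * f u ^+ n)); first exact: ccontM.
by apply/funext => u; rewrite exprS.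
Qed.

Lemma cauchy_bound (w z : C) n : disc w -> disc z ->
  normc ((1 - w * z^*) ^- n) <= (1 - normc w)^-1 ^+ n.
Proof.
move=> dw dz; have w0 : 0 < 1 - normc w by move: dw; rewrite discE subr_gt0.
have h := disc_denom_ge dw dz; have h0 := lt_le_trans w0 h.
by rewrite normcV normcX -exprVn lerXn2r ?nnegrE ?invr_ge0 ?(ltW h0) ?(ltW w0) // lef_pV2.
Qed.

Lemma ccont_cauchyX (w z : C) n : disc w -> disc z ->
  ccont (fun u => (1 - w * u^*) ^- n) z.
Proof.
move=> dw dz; rewrite (_ : (fun _ => _) = (fun u => (1 - w * u^*)^-1 ^+ n)).
  by apply: ccont_exp; exact: ccont_cauchy.
by apply/funext => u; rewrite exprVn.
Qed.

(** The conjugate of the kernel is holomorphic, and its integral is its value at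
    the origin. *)
Lemma disc_int_cauchy2 (w : C) : disc w ->
  disc_int (fun z => (1 - w * z^*) ^- 2) = 1.
Proof.
move=> dw; have dw' := disc_conj dw.
pose F z : C := (1 - w^* * z)^-1 * (1 - w^* * z)^-1.
pose F' z : C := w^* / (1 - w^* * z) ^+ 2 * (1 - w^* * z)^-1 +
  (1 - w^* * z)^-1 * (w^* / (1 - w^* * z) ^+ 2).
have hF : hol_disc F F'.
  by move=> z dz; exact: holM (hol_cauchy dw dz) (hol_cauchy dw dz).
have FE z : F z = ((1 - w * z^*) ^- 2)^*.
  by rewrite fmorphV rmorphXn rmorphB rmorph1 rmorphM /= conjcK /F -expr2 exprVn.
have a1 : A1 F.
  apply: (A1_bounded (B := (1 - normc w)^-1 ^+ 2)) => z dz.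
  by rewrite FE normc_conj; exact: cauchy_bound.
have iF : cintegrable F by apply: A1_cintegrable a1 _ => z /hF /hol_ccont.
have d0 : disc (0 : C) by rewrite discE normc0.
have := bergman_projection_sub hF a1 d0.
rewrite (@eq_disc_int _ _ (fun z => F z - 1)); last first.
  by move=> z _; rewrite mul0r subr0 expr1n invr1 mulr1 /F mulr0 subr0 invr1 mulr1.
rewrite disc_intB ?disc_int_cst //; last exact: cintegrable_cst.
move=> /eqP; rewrite subr_eq0 => /eqP h.
transitivity (disc_int F)^*; last by rewrite h conjc1.
by rewrite -disc_int_conj //; apply: eq_disc_int => z _; rewrite FE conjcK.
Qed.

Theorem bergman_projection f f' (w : C) : hol_disc f f' -> A1 f -> disc w ->
  f w = disc_int (fun z => f z * (1 - w * z^*) ^- 2).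
Proof.
move=> hf a1 dw; have := bergman_projection_sub hf a1 dw.
have i1 : cintegrable (fun z => f z * (1 - w * z^*) ^- 2).
  apply: (A1_mul_cintegrable a1) => [z /hf /hol_ccont //|z dz|z dz].
    exact: ccont_cauchyX.
  exact: cauchy_bound.
have i2 : cintegrable (fun z => (1 - w * z^*) ^- 2).
  apply: (cintegrable_cont (v := fun=> (1 - normc w)^-1 ^+ 2)).
  - by move=> z dz; exact: ccont_cauchyX.
  - exact: rintegrable_cst.
  - by move=> z dz; exact: cauchy_bound.
rewrite (@eq_disc_int _ _ (fun z => f z * (1 - w * z^*) ^- 2 - f w * (1 - w * z^*) ^- 2)).
  rewrite disc_intB //; last exact: cintegrableZ.
  by rewrite disc_intZ // disc_int_cauchy2 // mulr1 => /eqP; rewrite subr_eq0 => /eqP.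
by move=> z _; rewrite mulrBl.
Qed.

(** The [n]-th Taylor coefficient at the origin, as an area integral. *)
Definition taylor n f : C := n.+1%:R * disc_int (fun z => f z * z^* ^+ n).

Lemma normc_conjX (z : C) n : disc z -> normc (z^* ^+ n) <= 1.
Proof.
by rewrite discE => dz; rewrite normcX normc_conj exprn_ile1 ?normc_ge0 // ltW.
Qed.

Lemma ccont_conjX (z : C) n : ccont (fun u : C => u^* ^+ n) z.
Proof. by apply: ccont_exp; apply: ccont_conj; exact: ccont_id. Qed.

Lemma taylor_integrable f n : A1 f -> (forall z, disc z -> ccont f z) ->
  cintegrable (fun z => f z * z^* ^+ n).
Proof.
move=> a1 cf; apply: (A1_mul_cintegrable (B := 1) a1 cf) => z dz.
  exact: ccont_conjX.
exact: normc_conjX.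
Qed.

(** Stokes with [G = z ^+ n]. *)
Lemma disc_int_shift f f' n : hol_disc f f' -> A1 f ->
  n%:R * disc_int (fun z => f z * z^* ^+ n.-1) =
  n.+1%:R * disc_int (fun z => z * f z * z^* ^+ n).
Proof.
move=> hf a1; have cf z : disc z -> ccont f z by move=> /hf /hol_ccont.
have [v iv hv] := a1.
have dn (z : C) : disc z -> normc z <= 1 by rewrite discE => /ltW.
have i1 : cintegrable (fun z => f z * z^* ^+ n.-1) by exact: taylor_integrable.
have i2 : cintegrable (fun z => z * f z * z^* ^+ n).
  apply: taylor_integrable; last first.
    by move=> z dz; apply: ccontM; [exact: ccont_id|exact: cf].
  by apply: (A1M (B := 1)) => // z; exact: dn.
apply/eqP; rewrite -subr_eq0 -!disc_intZ // -disc_intB; [|exact: cintegrableZ..].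
rewrite -(@stokes_hol R [::] f f' (fun z => z ^+ n) (fun z => n%:R * z ^+ n.-1 * 1) v n.+1%:R) //.
- apply/eqP/eq_disc_int => z _; rewrite /off in_nil mulr1.
  have -> : (1 - normc z ^+ 2)%:C = 1 - z * z^* by rewrite mul_conjc rmorphB rmorph1.
  rewrite rmorphM rmorph_nat !rmorphXn /=.
  have nE : n%:R * z^* ^+ n = n%:R * z^* * z^* ^+ n.-1.
    by case: (n) => [|m]; rewrite ?mul0r //= exprS mulrA.
  rewrite -natr1; transitivity (n%:R * (f z * z^* ^+ n.-1) - f z * z * z^* ^+ n -
    f z * z * (n%:R * z^* ^+ n)); first by ring.
  by rewrite nE; ring.
- by move=> z dz _; exact: hf.
- by move=> z dz; apply: hol_exp; exact: hol_id.
- move=> z dz; rewrite mulr1 (normcM n%:R) normc_nat !normcX.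
  split; first by rewrite (@le_trans _ _ 1) ?exprn_ile1 ?normc_ge0 ?dn // ler1n.
  rewrite (@le_trans _ _ (n%:R * 1)) //; last by rewrite mulr1 ler_nat.
  by rewrite ler_wpM2l // exprn_ile1 ?normc_ge0 ?dn.
- by move=> z dz; apply: le_trans (hv z dz); exact: normc_ge0.
- by move=> z dz _; exact: hv.
move=> rho hrho.
have [M M0 hM] := bounded_subdisc hrho (fun z dz => let: And5 _ _ _ h _ := hf z dz in h).
by exists (fun=> M) => [|z hz _]; [exact: rintegrable_cst|apply: hM; exact: ltW].
Qed.

(** This shift property replaces manipulations of power series in all later
    computations of coefficients. *)
Lemma taylor_shift f f' n : hol_disc f f' -> A1 f ->
  taylor n.+1 (fun z => z * f z) = taylor n f.
Proof. by move=> hf a1; rewrite /taylor -(disc_int_shift n.+1 hf a1). Qed.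

Lemma taylor_shift0 f f' : hol_disc f f' -> A1 f -> taylor 0 (fun z => z * f z) = 0.
Proof. by move=> hf a1; rewrite /taylor -(disc_int_shift 0 hf a1) mul0r. Qed.

End Coefficients.

(** * Complex derivatives and integrals of Cauchy type *)

Section DerivativeEps.
Variable K : numFieldType.
Implicit Types (f : K^o -> K^o) (z A : K).

(** The definition of [derivable] without division, hence without a hole at [0]. *)
Definition eps_derive f z A := forall e : K, 0 < e -> exists2 d : K, 0 < d &
  forall k : K, `|k| < d -> `|f (z + k) - f z - A * k| <= e * `|k|.

Lemma eps_derive_quotient f z A : eps_derive f z A <->
  (fun h : K => h^-1 *: ((f \o shift (z : K^o)) (h *: (1 : K^o)) - f z)) @ 0^' --> (A : K^o).
Proof.
have quotE (h : K) : h != 0 ->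
    `|(A : K^o) - h^-1 *: ((f \o shift (z : K^o)) (h *: (1 : K^o)) - f z)| =
    `|f (z + h) - f z - A * h| / `|h|.
  move=> h0; rewrite /= /GRing.scale /= mulr1 (addrC h) distrC.
  have -> : h^-1 * (f (z + h) - f z) - A = (f (z + h) - f z - A * h) / h.
    by rewrite mulrBl mulfK // mulrC.
  exact: normf_div.
split=> [hf|/cvgrPdist_le hc e e0].
  apply/cvgrPdist_le => e e0; have [d d0 hd] := hf e e0.
  near=> h.
  have h0 : h != 0 by near: h; exact: nbhs_dnbhs_neq.
  rewrite quotE // ler_pdivrMr ?normr_gt0 //; apply: hd.
  by near: h; exact: dnbhs0_lt.
have := hc e e0; rewrite near_withinE near_simpl => /nbhs_ballP[d /= d0 hd].
exists d => // k kd; have [->|k0] := eqVneq k 0.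
  by rewrite addr0 subrr mulr0 subr0 !normr0 mulr0.
have := hd k; rewrite quotE // ler_pdivrMr ?normr_gt0 //; apply => //.
by rewrite /ball /= sub0r normrN.
Unshelve. all: by end_near.
Qed.

Lemma eps_is_derive f z A : eps_derive f z A ->
  is_derive (z : K^o) (1 : K^o) f A.
Proof.
move=> /eps_derive_quotient hc; split; last first.
  by rewrite /derive; apply/cvg_lim => //; exact: hc.
by apply/cvg_ex; exists A; exact: hc.
Qed.

Lemma derivable_eps f z : derivable f (z : K^o) 1 -> exists A, eps_derive f z A.
Proof. by move=> /cvg_ex[A hA]; exists A; exact/eps_derive_quotient. Qed.

End DerivativeEps.

Section ComplexDerivative.
Variable R : realType.
Local Notation C := R[i].
Local Notation "x ^*" := (conjc x) : ring_scope.
Implicit Types (f g : C -> C).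

(** [eps_derive] for complex numbers, measured by the real-valued modulus. *)
Definition chol f (z A : C) := forall e : R, 0 < e -> exists2 d : R, 0 < d &
  forall k, normc k < d -> normc (f (z + k) - f z - A * k) <= e * normc k.

Lemma normCE (z : C) : `|z| = (normc z)%:C.
Proof. by []. Qed.

Lemma cholP f z A : chol f z A <-> @eps_derive R[i] (f : C^o -> C^o) z A.
Proof.
split=> hf.
  move=> [e ei]; rewrite ltcE /= => /andP[/eqP ei0 e0]; rewrite ei0.
  have [d d0 hd] := hf e e0; exists d%:C; first by rewrite ltcR.
  by move=> k; rewrite !normCE ltcR => /hd h; rewrite -(rmorphM (real_complex R)) lecR.
move=> e e0; have [|[d di]] := hf e%:C; first by rewrite ltcR.
rewrite ltcE /= => /andP[/eqP di0 d0] hd; exists d => // k kd.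
by rewrite -lecR rmorphM; apply: hd; rewrite normCE ltcE /= di0 eqxx.
Qed.

Lemma chol_derive1 f z A : chol f z A -> derive1 (f : C^o -> C^o) z = A.
Proof. by move=> /cholP/eps_is_derive h; rewrite derive1E derive_val. Qed.

Lemma chol_derivable f z A : chol f z A -> derivable (f : C^o -> C^o) z 1.
Proof. by move=> /cholP/eps_is_derive h; exact: ex_derive. Qed.

Lemma derivable_chol f z : derivable (f : C^o -> C^o) z 1 -> exists A, chol f z A.
Proof. by move=> /derivable_eps[A /cholP]; exists A. Qed.

Lemma chol_ccont f z A : chol f z A -> ccont f z.
Proof.
move=> hf e e0; have [d d0 hd] := hf 1 ltr01.
have h0 : 0 < 1 + normc A by rewrite ltr_wpDr ?normc_ge0.
exists (Num.min d (e / (1 + normc A))); first by rewrite lt_min d0 divr_gt0.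
move=> w; rewrite lt_min => /andP[w1 w2].
have := hd (w - z) w1; rewrite addrCA subrr addr0 mul1r => h.
rewrite (_ : f w - f z = (f w - f z - A * (w - z)) + A * (w - z)); last by rewrite subrK.
apply: (le_lt_trans (normcD _ _)); rewrite normcM.
apply: (@le_lt_trans _ _ ((1 + normc A) * normc (w - z))); first by move: h; lra.
by rewrite mulrC -ltr_pdivlMr.
Qed.

Lemma chol_unique f z A B : chol f z A -> chol f z B -> A = B.
Proof. by move=> /chol_derive1 <- /chol_derive1. Qed.

Lemma chol_near f g z A (d : R) : 0 < d ->
  (forall w, normc (w - z) < d -> f w = g w) -> chol f z A -> chol g z A.
Proof.
move=> d0 fg hf e e0; have [d1 d10 hd] := hf e e0.
exists (Num.min d d1); first by rewrite lt_min d0.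
move=> k; rewrite lt_min => /andP[k1 k2].
rewrite -!fg ?subrr ?normc0 //; first exact: hd.
by rewrite addrAC subrr add0r.
Qed.

Lemma chol_disc f g z A : disc z -> (forall w, disc w -> f w = g w) ->
  chol f z A -> chol g z A.
Proof.
move=> dz fg; have [d d0 hd] := copen_disc dz.
by apply: (chol_near d0) => w /hd; exact: fg.
Qed.

(** A line of direction [e] of modulus 1: the real derivative along it is the
    complex derivative times [e]. *)
Lemma chol_cder f (l : R -> C) (e : C) t A : chol f (l t) A ->
  (forall k, l (t + k) = l t + k%:C * e) -> normc e = 1 ->
  cder (fun x => f (l x)) t (e * A).
Proof.
move=> hf hl e1; have key (P : C -> R) : (forall z, `|P z| <= normc z) ->
    (forall z w, P (z - w) = P z - P w) -> (forall (k : R) z, P (k%:C * z) = k * P z) ->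
    is_derive t 1 (fun x => P (f (l x))) (P (e * A)).
  move=> bP addP scP; apply: (@eps_is_derive R) => eps eps0.
  have [d d0 hd] := hf eps eps0; exists d => // k kd.
  have nk : normc (k%:C * e) = `|k| by rewrite normcM normc_real e1 mulr1.
  have := hd (k%:C * e); rewrite nk => /(_ kd) h.
  rewrite hl -addP (mulrC (P _)) -scP -addP; apply: (le_trans (bP _)).
  by apply: le_trans h; rewrite le_eqVlt; apply/orP; left; apply/eqP; congr normc; ring.
split; apply: key.
- exact: Re_le_normc.
- exact: ReB.
- by move=> k z; rewrite ReM /= mul0r subr0.
- exact: Im_le_normc.
- exact: ImB.
- by move=> k z; rewrite ImM /= mul0r addr0.
Qed.

Lemma chol_hol f f' z (d : R) : 0 < d -> 
  (forall w, normc (w - z) < d -> chol f w (f' w)) -> ccont f' z -> hol f f' z.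
Proof.
move=> d0 hf cf'; have hz : chol f z (f' z) by apply: hf; rewrite subrr normc0.
split.
- rewrite /xder -[f' z]mul1r.
  apply: (@chol_cder f (fun x => x +i* Im z) 1 (Re z) (f' z)); rewrite ?normc1 ?complex_eta //.
  by move=> k; apply: complexP; rewrite /= ?ReD ?ImD ?mulr1 /= ?addr0.
- apply: (@chol_cder f (fun y => Re z +i* y) 'i (Im z) (f' z)); rewrite ?normc_i ?complex_eta //.
  by move=> k; apply: complexP; rewrite ?ReD ?ImD ?ReM ?ImM /=; ring.
- exact: chol_ccont hz.
- exact: cf'.
- by apply: ccontM => //; exact: ccont_cst.
Qed.

End ComplexDerivative.

Section CauchyIntegrals.
Variable R : realType.
Local Notation C := R[i].
Local Notation "x ^*" := (conjc x) : ring_scope.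
Implicit Types (f g P : C -> C).

(** The exponents are such that differentiation in [w] raises both of them by one
    and multiplies by [m]. *)
Definition cauchy_int P (m n : nat) (w : C) : C :=
  disc_int (fun z => P z * (z^* ^+ n * (1 - w * z^*) ^- m)).

Lemma cauchy_int_integrable P m n w : A1 P -> (forall z, disc z -> ccont P z) ->
  disc w -> cintegrable (fun z => P z * (z^* ^+ n * (1 - w * z^*) ^- m)).
Proof.
move=> a1 cP dw.
apply: (A1_mul_cintegrable (B := 1 * (1 - normc w)^-1 ^+ m) a1 cP) => z dz.
  by apply: ccontM; [exact: ccont_conjX|exact: ccont_cauchyX].
by rewrite normcM ler_pM ?normc_ge0 ?normc_conjX ?cauchy_bound.
Qed.

(** Second-order Taylor bound for [(1 - w c)^- m] in [w], by induction on [m]. *)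
Lemma inv_pow_taylor (L : R) m : 0 <= L -> exists2 B : R, 0 <= B &
  forall a b c k : C, normc a <= L -> normc b <= L -> normc c <= 1 ->
    b - a = k * c * a * b ->
    normc (b ^+ m - a ^+ m - m%:R * (k * c * a ^+ m.+1)) <= B * normc k ^+ 2.
Proof.
move=> L0; elim: m => [|m [B B0 IH]].
  by exists 0 => // a b c k _ _ _ _; rewrite !expr0 subrr sub0r mul0r oppr0 normc0 mul0r.
exists (L * B + m.+1%:R * L ^+ m.+3).
  by apply: addr_ge0; apply: mulr_ge0 => //; exact: exprn_ge0.
move=> a b c k ha hb hc E.
have -> : b ^+ m.+1 - a ^+ m.+1 - m.+1%:R * (k * c * a ^+ m.+2) =
    b * (b ^+ m - a ^+ m - m%:R * (k * c * a ^+ m.+1)) +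
    (k * c) ^+ 2 * (m.+1%:R * (a ^+ m.+2 * b)).
  have E2 : a ^+ m * b - a ^+ m * a = k * c * a ^+ m.+1 * b.
    by rewrite -mulrBr E exprS; ring.
  have E3 : k * c * a ^+ m.+1 * b - k * c * a ^+ m.+1 * a = (k * c) ^+ 2 * a ^+ m.+2 * b.
    by rewrite -mulrBr E [a ^+ m.+2]exprS; ring.
  rewrite -[(k * c) ^+ 2 * _](_ : (m.+1%:R * ((k * c) ^+ 2 * a ^+ m.+2 * b)) = _); last by ring.
  rewrite -E3 -natr1 exprS (exprS a m.+1) (exprSr a m).
  have -> : b * b ^+ m - a ^+ m * a = b * (b ^+ m - a ^+ m) + (a ^+ m * b - a ^+ m * a) by ring.
  by rewrite E2 (exprSr a m); ring.
rewrite mulrDl; apply: (le_trans (normcD _ _)); rewrite lerD //.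
  by rewrite (normcM b) -[leRHS]mulrA; apply: ler_pM; rewrite ?normc_ge0 //; exact: IH.
rewrite normcM normcX normcM [leRHS]mulrC; apply: ler_pM; rewrite ?exprn_ge0 ?normc_ge0 ?mulr_ge0 ?normc_ge0 //.
  by rewrite lerXn2r ?nnegrE ?mulr_ge0 ?normc_ge0 // ler_piMr ?normc_ge0.
rewrite (normcM m.+1%:R) normc_nat ler_wpM2l // (normcM _ b) normcX [L ^+ _]exprSr ler_pM ?exprn_ge0 ?normc_ge0 //.
by rewrite lerXn2r ?nnegrE ?normc_ge0.
Qed.

Lemma cauchy_int_chol P m n w : A1 P -> (forall z, disc z -> ccont P z) -> disc w ->
  chol (cauchy_int P m n) w (m%:R * cauchy_int P m.+1 n.+1 w).
Proof.
move=> a1 cP dw e e0; have [v iv hv] := a1.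
have d0 : 0 < 1 - normc w by move: dw; rewrite discE subr_gt0.
pose d := (1 - normc w) / 2; have dd : 0 < d by rewrite divr_gt0.
have L0 : 0 <= d^-1 by rewrite invr_ge0 ltW.
have [B B0 hB] := inv_pow_taylor m L0.
pose M := 2 * (rint v * B).
have rv0 : 0 <= rint v.
  by apply: rint_ge0 => z /hv; apply: le_trans; exact: normc_ge0.
have M0 : 0 <= M by rewrite !mulr_ge0.
exists (Num.min d (e / (M + 1))); first by rewrite lt_min dd divr_gt0 // ltr_wpDl.
move=> k; rewrite lt_min => /andP[k1 k2].
have dwk : disc (w + k).
  by rewrite discE (le_lt_trans (normcD _ _)) //; move: k1; rewrite /d; lra.
have i1 := cauchy_int_integrable m n a1 cP dwk.
have i2 := cauchy_int_integrable m n a1 cP dw.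
have i3 := cauchy_int_integrable m.+1 n.+1 a1 cP dw.
pose E z := P z * (z^* ^+ n * ((1 - (w + k) * z^*)^-1 ^+ m - (1 - w * z^*)^-1 ^+ m -
    m%:R * (k * z^* * (1 - w * z^*)^-1 ^+ m.+1))).
have EE z : P z * (z^* ^+ n * (1 - (w + k) * z^*) ^- m) -
    P z * (z^* ^+ n * (1 - w * z^*) ^- m) -
    (m%:R * k) * (P z * (z^* ^+ n.+1 * (1 - w * z^*) ^- m.+1)) = E z.
  by rewrite /E -!exprVn [z^* ^+ n.+1]exprS; ring.
rewrite {1 2}/cauchy_int mulrAC -disc_intB // -disc_intZ // -disc_intB;
  [|exact: cintegrableB|exact: cintegrableZ].
have bE z : disc z -> normc (E z) <= B * normc k ^+ 2 * v z.
  move=> dz; rewrite /E normcM [leRHS]mulrC ler_pM ?normc_ge0 ?hv //.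
  rewrite normcM -[leRHS]mul1r ler_pM ?normc_ge0 ?normc_conjX //.
  have n1 := disc_denom_neq0 dw dz; have n2 := disc_denom_neq0 dwk dz.
  have h1 := disc_denom_ge dw dz; have h2 := disc_denom_ge dwk dz.
  apply: hB.
  - rewrite normcV lef_pV2 ?posrE ?normc_gt0 //; move: h1; rewrite /d; lra.
  - rewrite normcV lef_pV2 ?posrE ?normc_gt0 //; move: h2; have := normcD w k.
    by move: k1; rewrite /d; lra.
  - by rewrite normc_conj ltW // -discE.
  - by field; rewrite n1 n2.
have iE : cintegrable E.
  apply: eq_cintegrable (cintegrableB (cintegrableB i1 i2) (cintegrableZ (m%:R * k) i3)).
  by move=> z _; rewrite -EE.
rewrite (eq_disc_int (g := E)); last by move=> z _; rewrite -EE.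
apply: (le_trans (normc_disc_int iE (rintegrableZ (B * normc k ^+ 2) iv) bE)).
rewrite rintZ //.
apply: (@le_trans _ _ ((M + 1) * normc k * normc k)).
  rewrite (_ : 2 * _ = M * normc k * normc k); last by rewrite /M; ring.
  by rewrite !ler_wpM2r ?normc_ge0 // lerDl.
by rewrite ler_wpM2r ?normc_ge0 // mulrC -ler_pdivlMr ?ltW // ltr_wpDl.
Qed.

Lemma bergman_cauchy_int f f' w : hol_disc f f' -> A1 f -> disc w ->
  f w = cauchy_int f 2 0 w.
Proof.
move=> hf a1 dw; rewrite (bergman_projection hf a1 dw).
by apply: eq_disc_int => z _; rewrite expr0 mul1r.
Qed.

End CauchyIntegrals.

(** * Goursat's theorem *)

Section Goursat.
Variable R : realType.
Local Notation C := R[i].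
Local Notation "x ^*" := (conjc x) : ring_scope.
Implicit Types (f g : C -> C).

Lemma real_primitive (u : R -> R) (a b : R) : a < b ->
  (forall x, a <= x <= b -> {for x, continuous u}) ->
  exists U : R -> R, forall x, a < x < b -> is_derive x 1 U (u x).
Proof.
move=> ab cu; exists (fun x => \int[lebesgue_measure]_(t in `[a, x]) u t).
move=> x /andP[ax xb].
have iu : (@lebesgue_measure R).-integrable `[a, b] (EFin \o u).
  apply: continuous_compact_integrable; first exact: segment_compact.
  apply: continuous_in_subspaceT => y; rewrite inE /= in_itv /= => hy; exact: cu.
have hx : a <= x <= b by rewrite !ltW.
have [dU dE] := continuous_FTC1_closed xb iu ax (cu x hx).
by split; [exact: dU|rewrite -derive1E dE].
Qed.

Lemma line_primitive (l : R -> C) (a b : R) : a < b ->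
  (forall x, a <= x <= b -> cline l x) ->
  exists L : R -> C, forall x, a < x < b -> cder L x (l x).
Proof.
move=> ab cl.
have [U1 h1] := real_primitive ab (fun x hx => (cl x hx).1).
have [U2 h2] := real_primitive ab (fun x hx => (cl x hx).2).
by exists (fun x => U1 x +i* U2 x) => x hx; split; [exact: h1|exact: h2].
Qed.

Lemma cderB (g1 g2 : R -> C) t A1 A2 :
  cder g1 t A1 -> cder g2 t A2 -> cder (fun x => g1 x - g2 x) t (A1 - A2).
Proof.
move=> h1 h2; have h := cderD h1 (cderM (cder_cst (-1) t) h2).
rewrite (_ : A1 - A2 = A1 + (0 * g2 t + -1 * A2)); last ring.
by apply: cder_ext h => x; ring.
Qed.

(** Goursat's argument. The four sides of a rectangle are integrated by means of
    primitives [H] and [V] along horizontal and vertical lines, so that the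
    integral over the boundary is additive by mere cancellation; near a point the
    function is affine up to [o(|z - z0|)], and an affine function has a genuine
    primitive. *)
Lemma goursat_rect g g' (H V : R -> R -> C) (rho : R) :
  (forall z, `|Re z| < rho -> `|Im z| < rho -> chol g z (g' z)) ->
  (forall x y, `|x| < rho -> `|y| < rho -> cder (H y) x (g (x +i* y))) ->
  (forall x y, `|x| < rho -> `|y| < rho -> cder (V x) y (g (x +i* y))) ->
  forall x0 y0 w v, 0 <= w -> 0 <= v -> - rho < x0 -> x0 + w < rho ->
    - rho < y0 -> y0 + v < rho ->
  H y0 (x0 + w) - H y0 x0 + 'i%C * (V (x0 + w) (y0 + v) - V (x0 + w) y0) =
  H (y0 + v) (x0 + w) - H (y0 + v) x0 + 'i%C * (V x0 (y0 + v) - V x0 y0).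
Proof.
move=> hg hH hV x0 y0 w v w0 v0 x0l x0r y0l y0r.
pose rect (x y a b : R) : C :=
  H y (x + a) - H y x + 'i%C * (V (x + a) (y + b) - V (x + a) y) -
  (H (y + b) (x + a) - H (y + b) x + 'i%C * (V x (y + b) - V x y)).
suff h e : 0 < e -> normc (rect x0 y0 w v) <= e.
  apply/eqP; rewrite -subr_eq0 -normc_eq0 eq_le normc_ge0 andbT leNgt; apply/negP => h1.
  have : 0 < normc (rect x0 y0 w v) / 2 by rewrite divr_gt0.
  by move=> /h; rewrite /rect; move: h1; lra.
move=> e0; pose P (x y t : R) := normc (rect x y (t * w) (t * v)) <= e * t ^+ 2.
suff : P x0 y0 1 by rewrite /P !mul1r expr1n mulr1.
apply: (@cousin_rect R P w v) => //.
  move=> x y t t0; rewrite /P => h1 h2 h3 h4.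
  have tw : t * w = t / 2 * w + t / 2 * w by field.
  have tv : t * v = t / 2 * v + t / 2 * v by field.
  have -> : rect x y (t * w) (t * v) =
      (rect x y (t / 2 * w) (t / 2 * v) + rect (x + t / 2 * w) y (t / 2 * w) (t / 2 * v)) +
      (rect x (y + t / 2 * v) (t / 2 * w) (t / 2 * v) +
       rect (x + t / 2 * w) (y + t / 2 * v) (t / 2 * w) (t / 2 * v)).
    rewrite /rect tw tv !addrA; ring.
  have -> : e * t ^+ 2 = (e * (t / 2) ^+ 2 + e * (t / 2) ^+ 2) +
      (e * (t / 2) ^+ 2 + e * (t / 2) ^+ 2) by field.
  do 2![apply: (le_trans (normcD _ _)); apply: lerD].
  - exact: h1.
  - exact: h2.
  - exact: h3.
  - exact: h4.
move=> a b ha hb.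
pose z0 : C := a +i* b.
have gz0 : chol g z0 (g' z0) by apply: hg; rewrite /z0 /= ltr_norml; lra.
(* [4 * (w + v)] bounds the sum of the four sides, each counted twice, and [w + v + 1]
   the diameter *)
pose K := 8 * (w + v + 1) ^+ 2; have K0 : 0 < K by rewrite mulr_gt0 // exprn_gt0; lra.
have [d d0 hd] := gz0 (e / K) (divr_gt0 e0 K0).
exists (d / (w + v + 1)); first by rewrite divr_gt0 //; lra.
move=> x y t t0 td xa yb xl xr yl yr; rewrite /P.
have tw0 : 0 <= t * w by rewrite mulr_ge0 // ltW.
have tv0 : 0 <= t * v by rewrite mulr_ge0 // ltW.
(* a primitive of the affine part of [g] at [z0]: its contribution to [rect] is zero *)
pose A (z : C) : C := g z0 * z + g' z0 * ((z - z0) * (z - z0)) / 2.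
pose r z := g z - (g z0 + g' z0 * (z - z0)).
have dA (l : R -> C) s c : cder l s c ->
    cder (fun u => A (l u)) s (c * (g z0 + g' z0 * (l s - z0))).
  move=> hl; have h1 := cderB hl (cder_cst z0 s).
  have h := cderD (cderM (cder_cst (g z0) s) hl)
    (cderM (cderM (cder_cst (g' z0) s) (cderM h1 h1)) (cder_cst (2^-1) s)).
  have E : c * (g z0 + g' z0 * (l s - z0)) = 0 * l s + g z0 * c + ((0 * ((l s - z0) * (l s - z0)) +
    g' z0 * ((c - 0) * (l s - z0) + (l s - z0) * (c - 0))) * 2^-1 +
    g' z0 * ((l s - z0) * (l s - z0)) * 0) by field.
  by rewrite E; apply: cder_ext h => u.
have hl y1 s : cder (fun u : R => u +i* y1 : C) s 1.
  by split; rewrite /=; [exact: is_derive_id|exact: is_derive_cst].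
have vl x1 s : cder (fun u : R => x1 +i* u : C) s 'i.
  by split; rewrite /=; [exact: is_derive_cst|exact: is_derive_id].
have br x1 y1 : x <= x1 <= x + t * w -> y <= y1 <= y + t * v ->
    normc (r (x1 +i* y1)) <= e / K * (t * (w + v + 1)).
  move=> hx1 hy1.
  have nz : normc ((x1 +i* y1) - z0) <= t * (w + v + 1).
    apply: (le_trans (normc_le_ReIm _)); rewrite ReB ImB /=.
    have h1 : `|x1 - a| <= t * w by rewrite ler_norml; lra.
    have h2 : `|y1 - b| <= t * v by rewrite ler_norml; lra.
    by move: h1 h2 t0; lra.
  have hzd : normc ((x1 +i* y1) - z0) < d.
    by apply: (le_lt_trans nz); rewrite -ltr_pdivlMr //; lra.
  have := hd _ hzd; rewrite addrCA subrr addr0 => h.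
  rewrite /r (_ : g _ - _ = g (x1 +i* y1) - g z0 - g' z0 * (x1 +i* y1 - z0)); last by ring.
  by apply: (le_trans h); rewrite ler_wpM2l // divr_ge0 // ltW.
have bd x1 y1 : x <= x1 <= x + t * w -> y <= y1 <= y + t * v ->
    `|x1| < rho /\ `|y1| < rho.
  by move=> hx1 hy1; rewrite !ltr_norml; lra.
pose M := e / K * (t * (w + v + 1)).
have M0 : 0 <= M by rewrite mulr_ge0 ?divr_ge0 ?mulr_ge0 //; lra.
have sH y1 : y <= y1 <= y + t * v ->
    normc ((H y1 (x + t * w) - A ((x + t * w) +i* y1)) - (H y1 x - A (x +i* y1))) <=
    2 * M * (t * w).
  move=> hy1; have tE : t * w = `|(x + t * w) - x| by rewrite addrAC subrr add0r ger0_norm.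
  rewrite [t * w in leRHS]tE.
  apply: (@cder_mvt_bound R (fun u => H y1 u - A (u +i* y1)) (fun u => r (u +i* y1))).
  rewrite min_l ?max_r ?lerDl // => x1 hx1; split; last exact: br.
  have [b1 b2] := bd _ _ hx1 hy1.
  have := cderB (hH _ _ b1 b2) (dA _ x1 _ (hl y1 x1)).
  by rewrite mul1r.
have sV x1 : x <= x1 <= x + t * w ->
    normc ((V x1 (y + t * v) + 'i%C * A (x1 +i* (y + t * v))) - (V x1 y + 'i%C * A (x1 +i* y))) <=
    2 * M * (t * v).
  move=> hx1; have tE : t * v = `|(y + t * v) - y| by rewrite addrAC subrr add0r ger0_norm.
  rewrite [t * v in leRHS]tE.
  apply: (@cder_mvt_bound R (fun u => V x1 u + 'i%C * A (x1 +i* u)) (fun u => r (x1 +i* u))).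
  rewrite min_l ?max_r ?lerDl // => y1 hy1; split; last exact: br.
  have [b1 b2] := bd _ _ hx1 hy1.
  have := cderD (hV _ _ b1 b2) (cderM (cder_cst 'i y1) (dA _ y1 _ (vl x1 y1))).
  rewrite mul0r add0r mulrA mul_ii mulN1r; exact.
have hxl : x <= x <= x + t * w by rewrite lexx lerDl.
have hxr : x <= x + t * w <= x + t * w by rewrite lexx lerDl tw0.
have hyl : y <= y <= y + t * v by rewrite lexx lerDl.
have hyr : y <= y + t * v <= y + t * v by rewrite lexx lerDl tv0.
have -> : rect x y (t * w) (t * v) =
   ((H y (x + t * w) - A ((x + t * w) +i* y)) - (H y x - A (x +i* y))) +
   'i%C * ((V (x + t * w) (y + t * v) + 'i%C * A ((x + t * w) +i* (y + t * v))) -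
         (V (x + t * w) y + 'i%C * A ((x + t * w) +i* y))) -
   (((H (y + t * v) (x + t * w) - A ((x + t * w) +i* (y + t * v))) -
      (H (y + t * v) x - A (x +i* (y + t * v)))) +
   'i%C * ((V x (y + t * v) + 'i%C * A (x +i* (y + t * v))) - (V x y + 'i%C * A (x +i* y)))).
  rewrite /rect.
  set A1 := A _; set A2 := A (x +i* y); set A3 := A (_ +i* (y + _)); set A4 := A (x +i* (_ + _)).
  transitivity (H y (x + t * w) - H y x + 'i%C * (V (x + t * w) (y + t * v) - V (x + t * w) y) -
    (H (y + t * v) (x + t * w) - H (y + t * v) x + 'i%C * (V x (y + t * v) - V x y)) +
    (1 + 'i%C * 'i%C) * (A3 - A1 - (A4 - A2))); last by ring.
  by rewrite mul_ii subrr mul0r addr0.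
have S1 := sH _ hyl; have S2 := sH _ hyr; have S3 := sV _ hxl; have S4 := sV _ hxr.
apply: (le_trans (normcB _ _)); apply: (le_trans (lerD (normcD _ _) (normcD _ _))).
rewrite !(normcM 'i%C) normc_i !mul1r.
apply: (le_trans (lerD (lerD S1 S4) (lerD S2 S3))).
rewrite (_ : _ + _ = 4 * M * (t * (w + v))); last by ring.
rewrite (_ : e * t ^+ 2 = 8 * (e / K * (t * (w + v + 1))) * (t * (w + v + 1))); last first.
  by rewrite /K; field; apply/eqP; lra.
rewrite -/M; apply: ler_pM; rewrite ?mulr_ge0 ?addr_ge0 //; try exact: ltW.
  by rewrite invr_ge0 ltW.
  by rewrite ler_wpM2r // ler_nat.
by rewrite ler_wpM2l ?lerDl // ltW.
Qed.

End Goursat.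

Section Regularity.
Variable R : realType.
Local Notation C := R[i].
Local Notation "x ^*" := (conjc x) : ring_scope.
Implicit Types (f g : C -> C).

Lemma cder_unique (l : R -> C) t A B : cder l t A -> cder l t B -> A = B.
Proof.
move=> [a1 a2] [b1 b2]; apply: complexP.
  by rewrite -(@derive_val _ _ _ _ _ _ _ a1) (@derive_val _ _ _ _ _ _ _ b1).
by rewrite -(@derive_val _ _ _ _ _ _ _ a2) (@derive_val _ _ _ _ _ _ _ b2).
Qed.

Lemma chol_affine f (z r w A : C) : chol f (z + r * w) A ->
  chol (fun u => f (z + r * u)) w (r * A).
Proof.
move=> hf e e0; have r1 : 0 < normc r + 1 by rewrite ltr_wpDl ?normc_ge0.
have [d d0 hd] := hf (e / (normc r + 1)) (divr_gt0 e0 r1).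
exists (d / (normc r + 1)); first exact: divr_gt0.
move=> k; rewrite ltr_pdivlMr // => hk.
have nk : normc (r * k) <= normc k * (normc r + 1).
  by rewrite normcM mulrC ler_wpM2l ?normc_ge0 // lerDl.
have := hd _ (le_lt_trans nk hk); rewrite mulrDr addrA [A * (r * k)]mulrA (mulrC A r) => h.
apply: (le_trans h); rewrite mulrAC ler_pdivrMr // -mulrA ler_wpM2l //.
exact: ltW.
Qed.

(** The primitive is an integral along a horizontal and a vertical side of a
    rectangle; by [goursat_rect] the two remaining sides give the same value, so
    that each partial derivative can be computed along a last segment. The radius
    10 leaves room for the square around the unit disc and for the bound on [g]. *)
Lemma goursat_primitive g g' : (forall z, normc z < 10 -> chol g z (g' z)) ->
  exists2 F, hol_disc F g & A1 F.
Proof.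
move=> hg.
have cg z : normc z < 10 -> ccont g z by move=> /hg /chol_ccont.
have hbox (x y t : R) : `|x| <= t -> `|y| <= t -> normc (x +i* y) <= t + t.
  by move=> hx hy; apply: (le_trans (normc_le_ReIm _)); rewrite lerD.
have n10 (z : C) : normc (10 * z) = 10 * normc z by rewrite normcM normc_nat.
have [M M0 hM] : exists2 M : R, 0 < M & forall z, normc z <= 5 -> normc (g z) <= M.
  have r1 : 0 < (4^-1 : R) < 1 by lra.
  have cG z : disc z -> ccont (fun u => g (0 + 10 * u)) z.
    rewrite discE => dz; apply: chol_ccont; apply: chol_affine.
    by apply: hg; rewrite add0r n10; lra.
  have [M M0 hM] := bounded_subdisc r1 cG; exists M => // z hz.
  have := hM (10^-1 * z); rewrite add0r mulVKf ?pnatr_eq0 //; apply.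
  rewrite normcM normcV normc_nat exprMn.
  have : normc z ^+ 2 <= 5 ^+ 2 by rewrite lerXn2r ?nnegrE ?normc_ge0.
  by lra.
have lt33 : (- 3 : R) < 3 by lra.
have hline (y : R) : exists L : R -> C, `|y| < 3 ->
    forall x, `|x| < 3 -> cder L x (g (x +i* y)).
  have [hy|_] := ltP `|y| 3; last by exists (fun=> 0).
  have [|L hL] := @line_primitive R (fun x => g (x +i* y)) (- 3) 3 lt33.
    move=> x; rewrite -ler_norml => hx.
    apply: (@ccont_lineP R g (fun x => x +i* y)); last exact: normc_hline.
    by apply: cg; have := hbox _ _ _ hx (ltW hy); lra.
  by exists L => _ x; rewrite ltr_norml => /hL.
have vline (x : R) : exists L : R -> C, `|x| < 3 ->
    forall y, `|y| < 3 -> cder L y (g (x +i* y)).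
  have [hx|_] := ltP `|x| 3; last by exists (fun=> 0).
  have [|L hL] := @line_primitive R (fun y => g (x +i* y)) (- 3) 3 lt33.
    move=> y; rewrite -ler_norml => hy.
    apply: (@ccont_lineP R g (fun y => x +i* y)); last exact: normc_vline.
    by apply: cg; have := hbox _ _ _ (ltW hx) hy; lra.
  by exists L => _ y; rewrite ltr_norml => /hL.
have [H hH] := choice hline; have [V hV] := choice vline.
pose F (z : C) : C := H (Im z) (Re z) - H (Im z) (- 2) +
  'i%C * (V (- 2) (Im z) - V (- 2) (- 2)).
pose F' (z : C) : C := H (- 2) (Re z) - H (- 2) (- 2) +
  'i%C * (V (Re z) (Im z) - V (Re z) (- 2)).
have FF' z : normc z < 3 / 2 -> F z = F' z.
  move=> nz; have h1 := Re_le_normc z; have h2 := Im_le_normc z.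
  move: h1 h2; rewrite !ler_norml => /andP[h1 h2] /andP[h3 h4].
  have := @goursat_rect R g g' H V 3 _ (fun x y hx hy => hH y hy x hx)
    (fun x y hx hy => hV x hx y hy) (- 2) (- 2) (Re z + 2) (Im z + 2).
  rewrite !(addrC (- 2)) !addrK => h; rewrite /F /F' h //; try lra.
  move=> u hu hv; apply: hg.
  by apply: (le_lt_trans (normc_le_ReIm _)); move: hu hv; lra.
have xF z : normc z < 3 / 2 -> xder F z (g z).
  move=> nz; have h1 := Re_le_normc z; have h2 := Im_le_normc z.
  have h := hH (Im z) _ (Re z) _; rewrite complex_eta in h.
  have := cderD (h _ _) (cder_cst (- H (Im z) (- 2) + 'i%C * (V (- 2) (Im z) - V (- 2) (- 2))) (Re z)).
  rewrite addr0 => h'; apply: cder_ext (h' _ _); try lra.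
  by move=> x; rewrite /F /= addrA.
have yF' z : normc z < 3 / 2 -> yder F' z ('i * g z).
  move=> nz; have h1 := Re_le_normc z; have h2 := Im_le_normc z.
  have h := hV (Re z) _ (Im z) _; rewrite complex_eta in h.
  have := cderD (cder_cst (H (- 2) (Re z) - H (- 2) (- 2) - 'i%C * V (Re z) (- 2)) (Im z))
     (cderM (cder_cst 'i (Im z)) (h _ _)).
  rewrite mul0r !add0r => h'; apply: cder_ext (h' _ _); try lra.
  by move=> x; rewrite /F' /=; ring.
have yF z : disc z -> yder F z ('i * g z).
  rewrite discE => dz; have nz : normc z < 3 / 2 by lra.
  have h12 : 0 < 1 / 2 :> R by lra.
  apply: cder_near h12 _ (yF' z nz) => y hy.
  rewrite FF' // -(subrK z (_ +i* _)); apply: (le_lt_trans (normcD _ _)).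
  by rewrite -[z in _ - z]complex_eta normc_vline; lra.
have cF z : disc z -> ccont F z.
  rewrite discE => dz.
  have r0 : 0 < 1 - normc z by rewrite subr_gt0.
  have [|d [B [d0 _ B0 hB]]] := @hol_lipschitz R F g z _ r0.
    move=> w hw; have dw : normc w < 1.
      by rewrite -(subrK z w); apply: (le_lt_trans (normcD _ _)); lra.
    split; [by apply: xF; lra|by apply: yF; rewrite discE|by apply: cg; lra].
  have B1 : 0 < B + 1 by lra.
  move=> e e0; exists (Num.min d (e / (B + 1))); first by rewrite lt_min d0 divr_gt0.
  move=> w; rewrite lt_min ltr_pdivlMr // => /andP[/hB h1 h2].
  by have := normc_ge0 (w - z); move: h1 h2; lra.
exists F => [z dz|].
  have nz : normc z < 1 by rewrite -discE.
  by split; [apply: xF; lra|exact: yF|exact: cF|apply: cg; lra|apply: ccontM; [exact: ccont_cst|apply: cg; lra]].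
apply: (A1_bounded (B := 12 * M)) => z; rewrite discE => dz.
have h1 := Re_le_normc z; have h2 := Im_le_normc z.
move: h1 h2; rewrite !ler_norml => /andP[h1 h2] /andP[h3 h4].
apply: (le_trans (normcD _ _)); rewrite normcM normc_i mul1r.
have b1 : normc (H (Im z) (Re z) - H (Im z) (- 2)) <= 2 * M * (Re z - - 2).
  have zE : Re z - - 2 = `|Re z - - 2| by rewrite ger0_norm; lra.
  rewrite [in leRHS]zE; apply: (@cder_mvt_bound R _ (fun x => g (x +i* Im z))).
  rewrite min_l ?max_r; try lra; move=> x hx; split; first by apply: hH; rewrite ltr_norml; lra.
  apply: hM; have : normc (x +i* Im z) <= 2 + 2 by apply: hbox; rewrite ler_norml; lra.
  by lra.
have b2 : normc (V (- 2) (Im z) - V (- 2) (- 2)) <= 2 * M * (Im z - - 2).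
  have zE : Im z - - 2 = `|Im z - - 2| by rewrite ger0_norm; lra.
  rewrite [in leRHS]zE; apply: (@cder_mvt_bound R _ (fun y => g (- 2 +i* y))).
  rewrite min_l ?max_r; try lra; move=> y hy; split; first by apply: hV; rewrite ltr_norml; lra.
  apply: hM; have : normc (- 2 +i* y) <= 2 + 2 by apply: hbox; rewrite ler_norml; lra.
  by lra.
apply: (le_trans (lerD b1 b2)); rewrite -mulrDr -mulrA [12 * M]mulrC.
rewrite mulrCA ler_pM2l //; lra.
Qed.

(** By the Bergman formula the function is an integral of Cauchy type. *)
Lemma hol_disc_chol f f' z : hol_disc f f' -> A1 f -> disc z -> chol f z (f' z).
Proof.
move=> hf a1 dz; have cf w : disc w -> ccont f w by move=> /hf /hol_ccont.
have h : chol f z (2%:R * cauchy_int f 3 1 z).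
  apply: (chol_disc (f := cauchy_int f 2 0) dz) => [w dw|].
    by rewrite (bergman_cauchy_int hf a1 dw).
  exact: cauchy_int_chol.
have [hx _ _ _ _] := hf z dz.
suff -> : f' z = 2%:R * cauchy_int f 3 1 z by [].
apply: cder_unique hx _; rewrite /xder -[_ * _]mul1r.
apply: (@chol_cder R f (fun x => x +i* Im z) 1 (Re z)); rewrite ?normc1 ?complex_eta //.
by move=> k; apply: complexP; rewrite /= ?ReD ?ImD ?mulr1 /= ?addr0.
Qed.

(** Goursat's theorem: a complex derivative is automatically continuous, since
    the function has a primitive, which is an integral of Cauchy type. *)
Theorem goursat f f' : (forall z, disc z -> chol f z (f' z)) -> hol_disc f f'.
Proof.
move=> hf z dz; have d0 : 0 < 1 - normc z by rewrite subr_gt0 -discE.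
have inD (w : C) : normc (w - z) < 1 - normc z -> disc w.
  move=> hw; rewrite discE -(subrK z w).
  by apply: (le_lt_trans (normcD _ _)); lra.
apply: (chol_hol d0) => [w /inD /hf //|].
pose r : C := ((1 - normc z) / 10)%:C.
have nr : normc r = (1 - normc z) / 10 by rewrite normc_real ger0_norm // divr_ge0 ?ltW.
have r0 : r != 0 by rewrite -normc_gt0 nr divr_gt0.
(* [z + r * u] runs through a disc around [z] when [u] has modulus less than 10 *)
pose g u := f (z + r * u); pose g' u := r * f' (z + r * u).
have hg u : normc u < 10 -> chol g u (g' u).
  move=> hu; apply: chol_affine; apply: hf; apply: inD.
  rewrite addrAC subrr add0r normcM nr.
  by rewrite mulrAC ltr_pdivrMr // ltr_pM2l.
have [F hF a1] := goursat_primitive hg.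
have cF w : disc w -> ccont F w by move=> /hF /hol_ccont.
have gE w : disc w -> g w = 2%:R * cauchy_int F 3 1 w.
  move=> dw; apply: (chol_unique (hol_disc_chol hF a1 dw)).
  apply: (chol_disc (f := cauchy_int F 2 0) dw) => [u du|].
    by rewrite (bergman_cauchy_int hF a1 du).
  exact: cauchy_int_chol.
have g'E w : disc w -> g' w = 2%:R * (3%:R * cauchy_int F 4 2 w).
  move=> dw; have hw : normc w < 10 by move: dw; rewrite discE; lra.
  apply: (chol_unique (hg w hw)).
  apply: (chol_disc (f := fun w => 2%:R * cauchy_int F 3 1 w) dw) => [u du|].
    by rewrite gE.
  have h := chol_affine (f := fun u => 2%:R * u).
  have c2 : (0 : R) < 2 by [].
  move=> e e0; have [d dd hd] := cauchy_int_chol 3 1 a1 cF dw (divr_gt0 e0 c2).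
  exists d => // k /hd hk; rewrite -mulrBr -mulrA -mulrBr normcM normc_nat.
  by rewrite -ler_pdivlMl // mulrA (mulrC _^-1).
have dd0 : disc (0 : C) by rewrite discE normc0.
have cg' : ccont g' 0.
  move=> e e0.
  have cc : ccont (fun w => 2%:R * (3%:R * cauchy_int F 4 2 w)) 0.
    apply: ccontM; first exact: ccont_cst.
    apply: ccontM; first exact: ccont_cst.
    exact: chol_ccont (cauchy_int_chol 4 2 a1 cF dd0).
  have [d dd hd] := cc e e0; exists (Num.min d 1); first by rewrite lt_min dd ltr01.
  move=> w; rewrite lt_min => /andP[/hd h1]; rewrite subr0 => h2.
  by rewrite (g'E w) ?(g'E 0) // discE.
have nr0 : 0 < normc r by rewrite normc_gt0.
move=> e e0; have [d dd hd] := cg' (normc r * e) (mulr_gt0 nr0 e0).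
exists (normc r * d) => [|w hw]; first by rewrite mulr_gt0 ?normc_gt0.
have := hd (r^-1 * (w - z)); rewrite subr0 normcM normcV ltr_pdivrMl ?normc_gt0 // => /(_ hw).
rewrite /g' mulVKf // mulr0 addr0 (addrC z) subrK -mulrBr normcM ltr_pM2l //.
Qed.

Corollary analytic_hol f : analytic_on_disc f -> exists f', hol_disc f f'.
Proof.
move=> af; have h z : exists A, disc z -> chol f z A.
  have [dz|ndz] := pselect (disc z); last by exists 0.
  by have [A hA] := derivable_chol (af z dz); exists A.
by have [f' hf'] := choice h; exists f'; exact: goursat.
Qed.

End Regularity.

(** * Powers of a Blaschke factor *)

Section BlaschkePower.
Variable R : realType.
Local Notation C := R[i].
Local Notation "x ^*" := (conjc x) : ring_scope.

Lemma conjc_rc (x : R) : (x%:C)^* = x%:C.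
Proof. by apply: complexP; rewrite /= ?oppr0. Qed.

Lemma conjc_mul (z w : C) : (z * w)^* = z^* * w^*.
Proof. exact: rmorphM. Qed.

Lemma conjc_div (z w : C) : (z / w)^* = z^* / w^*.
Proof. by rewrite conjc_mul; congr (_ * _); exact: fmorphV. Qed.

Definition blaschke (b z : C) : C := (z - b) / (1 - b^* * z).

Lemma denom_conj (b z : C) : normc (1 - b^* * z) = normc (1 - b * z^*).
Proof. by rewrite -[LHS]normc_conj rmorphB rmorph1 rmorphM /= conjcK. Qed.

Lemma denom_ge (b z : C) : disc b -> disc z -> 1 - normc b <= normc (1 - b^* * z).
Proof. by move=> db dz; rewrite denom_conj; exact: disc_denom_ge. Qed.

Lemma denom_neq0 (b z : C) : disc b -> disc z -> 1 - b^* * z != 0.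
Proof.
by move=> db dz; rewrite -normc_gt0 denom_conj normc_gt0 disc_denom_neq0.
Qed.

Lemma denom_le (b z : C) : disc b -> disc z -> normc (1 - b^* * z) <= 2.
Proof.
rewrite !discE => db dz; apply: (le_trans (normcB _ _)).
rewrite normc1 normcM normc_conj (_ : 2 = 1 + 1 * 1); last by ring.
by rewrite lerD // ler_pM ?normc_ge0 // ltW.
Qed.

Lemma onem_sqr_blaschke (b z : C) : disc b -> disc z ->
  1 - normc (blaschke b z) ^+ 2 =
  (1 - normc b ^+ 2) * (1 - normc z ^+ 2) / normc (1 - b^* * z) ^+ 2.
Proof.
move=> db dz; have := denom_neq0 db dz; rewrite -normc_gt0 => d0.
rewrite normcM normcV exprMn exprVn.
have E : normc (1 - b^* * z) ^+ 2 - normc (z - b) ^+ 2 =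
    (1 - normc b ^+ 2) * (1 - normc z ^+ 2).
  rewrite !sqr_normcE !ReB !ImB !ReM !ImM Re_conj Im_conj.
  by rewrite [Re 1]/= [Im 1]/=; ring.
by rewrite -E mulrBl divff // expf_neq0 // gt_eqF.
Qed.

Lemma blaschke_sqr_bounds (b z : C) (e : R) : disc b -> disc z -> 0 <= e ->
  e <= normc (z - b) -> (e / 2) ^+ 2 <= normc (blaschke b z) ^+ 2 <= 1.
Proof.
move=> db dz e0 he; have := denom_neq0 db dz; rewrite -normc_gt0 => d0.
apply/andP; split.
  rewrite normcM normcV lerXn2r ?nnegrE ?mulr_ge0 ?invr_ge0 ?normc_ge0 //.
  by rewrite ler_pM ?invr_ge0 // lef_pV2 ?posrE // denom_le.
rewrite -subr_ge0 onem_sqr_blaschke // divr_ge0 ?sqr_ge0 // mulr_ge0 // subr_ge0 ltW //;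
  exact: disc_sqr.
Qed.

Lemma expR_sub1_bound (y Y : R) : `|y| <= Y -> `|expR y - 1| <= expR Y * `|y|.
Proof.
move=> hy; have := @mvt_bound R expR expR 0 y (expR Y).
rewrite expR0 subr0; apply => x hx; split; first exact: is_derive_expR.
rewrite ger0_norm ?expR_ge0 // ler_expR.
move: hy hx; rewrite ler_norml /Num.min /Num.max; case: ifP; lra.
Qed.

Lemma abs_ln_bound (x c : R) : 0 < c -> c <= x <= 1 -> `|ln x| <= (1 - x) / c.
Proof.
move=> c0 /andP[cx x1]; have x0 : 0 < x by exact: lt_le_trans cx.
have l0 : ln x <= 0 by exact: ln_le0.
rewrite ler0_norm // -lnV ?posrE //.
have -> : x^-1 = 1 + (x^-1 - 1) by ring.
apply: (le_trans (le_ln1Dx _)); first by have : 0 < x^-1 by [rewrite invr_gt0]; lra.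
rewrite (_ : x^-1 - 1 = (1 - x) / x); last by field; rewrite gt_eqF.
by rewrite ler_wpM2l ?subr_ge0 // lef_pV2 ?posrE.
Qed.

Lemma powR_half_sqr (x q : R) : 0 <= x -> x `^ q = (x ^+ 2) `^ (q / 2).
Proof. by move=> x0; rewrite -powR_mulrn // -powRrM mulrC divfK. Qed.

(** Away from [b] the factor [|phi_b|^q] differs from 1 by [O(1 - |z|^2)],
    because [1 - |phi_b|^2] does. *)
Lemma blaschke_powR_sub1 (b : C) (q e : R) : disc b -> 0 < e ->
  exists2 B : R, 0 <= B & forall z, disc z -> e <= normc (z - b) ->
    `|normc (blaschke b z) `^ q - 1| <= B * (1 - normc z ^+ 2).
Proof.
move=> db e0; pose c := (e / 2) ^+ 2; have c0 : 0 < c by rewrite exprn_gt0 ?divr_gt0.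
pose Y := `|q / 2| * (1 / c).
have b1 : 0 < 1 - normc b by rewrite subr_gt0 -discE.
exists (expR Y * (`|q / 2| * ((1 - normc b) ^- 2 / c))).
  by rewrite mulr_ge0 ?expR_ge0 // mulr_ge0 // divr_ge0 ?invr_ge0 ?sqr_ge0 // ltW.
move=> z dz he; have := blaschke_sqr_bounds db dz (ltW e0) he.
rewrite powR_half_sqr ?normc_ge0 // -/c; set x := normc _ ^+ 2 => hx.
have x0 : 0 < x by case/andP: hx => hx _; exact: lt_le_trans hx.
have hl := abs_ln_bound c0 hx.
rewrite /powR gt_eqF //.
have hxx : 1 - x <= (1 - normc b) ^- 2 * (1 - normc z ^+ 2).
  have s1 := disc_sqr dz.
  rewrite /x onem_sqr_blaschke // mulrAC.
  rewrite ler_wpM2r ?subr_ge0 ?(ltW s1) // -[leRHS]mul1r.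
  have d1 := denom_ge db dz.
  apply: ler_pM; rewrite ?invr_ge0 ?sqr_ge0 ?subr_ge0 ?(ltW (disc_sqr db)) //.
  - by rewrite gerBl sqr_ge0.
  - rewrite lef_pV2 ?posrE ?exprn_gt0 ?lerXn2r ?nnegrE ?normc_ge0 ?(ltW b1) //.
    exact: lt_le_trans d1.
have hy : `|q / 2 * ln x| <= `|q / 2| * ((1 - x) / c) by rewrite normrM ler_wpM2l.
apply: (le_trans (expR_sub1_bound (Y := Y) _)).
  apply: (le_trans hy); rewrite ler_wpM2l // ler_wpM2r ?invr_ge0 ?ltW //.
  by move: x0; lra.
rewrite -[leRHS]mulrA ler_wpM2l ?expR_ge0 // (le_trans hy) // -[leRHS]mulrA ler_wpM2l //.
by rewrite mulrAC ler_wpM2r ?invr_ge0 // ltW.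
Qed.

(** Negative powers of [|z - b|] above [-2] are integrable in the plane. *)
Lemma blaschke_powR_majorant (b : C) (q : R) : disc b -> -2 < q ->
  exists2 v, rintegrable v &
    forall z, disc z -> normc (blaschke b z) `^ q <= v z.
Proof.
move=> db q2; have le1 z : disc z -> normc (blaschke b z) <= 1.
  move=> dz; have /andP[_] := blaschke_sqr_bounds db dz (lexx 0) (normc_ge0 _).
  by rewrite expr_le1 ?normc_ge0.
have [q0|q0] := leP 0 q.
  exists (fun=> 1); first exact: rintegrable_cst.
  move=> z /le1 h; rewrite -[leRHS](congr1 (@^~ q) (powR1 R)); apply: ge0_ler_powR => //; rewrite ?nnegrE ?normc_ge0 //.
exists (fun z => 2 `^ (- q) * normc (z - b) `^ q).
  by apply: rintegrableZ; apply: rintegrable_power => //; rewrite q2 ltW.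
move=> z dz; have := denom_neq0 db dz; rewrite -normc_gt0 => d0.
rewrite normcM normcV powRM ?invr_ge0 ?normc_ge0 // mulrC ler_wpM2r ?powR_ge0 //.
rewrite -powR_inv1 ?normc_ge0 // -powRrM mulN1r.
by apply: ge0_ler_powR; rewrite ?nnegrE ?normc_ge0 ?denom_le // oppr_ge0 ltW.
Qed.

(** The logarithmic derivative of [blaschke b]. *)
Definition blaschke_dlog (b z : C) : C :=
  (1 - normc b ^+ 2)%:C / ((z - b) * (1 - b^* * z)).

Lemma blaschke_hol (b z : C) : disc b -> disc z ->
  hol (blaschke b) (fun w => (1 - normc b ^+ 2)%:C / (1 - b^* * w) ^+ 2) z.
Proof.
move=> db dz; have [d d0 hd] := copen_disc dz.
have h := holM (holB (hol_id z) (hol_cst b z)) (hol_cauchy db dz).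
apply: (C1at_near d0) h => w /hd dw.
have n0 := denom_neq0 db dw.
have E : (1 - 0) * (1 - b^* * w)^-1 + (w - b) * (b^* / (1 - b^* * w) ^+ 2) =
    (1 - normc b ^+ 2)%:C / (1 - b^* * w) ^+ 2.
  have -> : (1 - normc b ^+ 2)%:C = 1 - b * b^* by rewrite mul_conjc rmorphB rmorph1.
  by field.
by rewrite E.
Qed.

(** As [|phi|^q = (phi phi^* )^(q/2)], the logarithmic derivative of [|phi|^q] in [z]
    is [m = (q / 2) phi' / phi], and [m^*] is the one in the conjugate variable. *)
Lemma blaschke_powR_C1at (b z : C) (q : R) : disc b -> disc z -> z != b ->
  let m w := (q / 2)%:C * blaschke_dlog b w in
  C1at (fun w => (normc (blaschke b w) `^ q)%:C)
    (fun w => (normc (blaschke b w) `^ q)%:C * (m w + (m w)^*))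
    (fun w => (normc (blaschke b w) `^ q)%:C * ('i * m w - 'i * (m w)^*)) z.
Proof.
move=> db dz zb m; have hb := blaschke_hol db dz.
have h1 := C1atM hb (C1at_conj_hol hb).
have E1 w : blaschke b w * (blaschke b w)^* = (normc (blaschke b w) ^+ 2)%:C by exact: mul_conjc.
have h2 := C1at_eq (fun w => And3 (E1 w) erefl erefl) h1.
have nz w : disc w -> w != b -> blaschke b w != 0.
  by move=> dw wb; rewrite mulf_neq0 ?subr_eq0 // invr_eq0 denom_neq0.
have pos w : disc w -> w != b -> 0 < normc (blaschke b w) ^+ 2.
  by move=> dw wb; rewrite exprn_gt0 // normc_gt0 nz.
have h3 := @C1at_rfun R (fun t => t `^ (q / 2)) (fun t => q / 2 * t `^ (q / 2 - 1))
  (fun w => normc (blaschke b w) ^+ 2) _ _ z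
  (is_derive1_powR (q / 2) (pos z dz zb)) _ h2.
have [|d d0 hd] := @notin_open R [:: b] z; first by rewrite inE.
have [d1 d10 hd1] := copen_disc dz.
apply: (@C1at_near R _ _ _ _ _ _ z (Num.min d d1) _ _ (h3 _)).
- by rewrite lt_min d0.
- move=> w; rewrite lt_min => /andP[/hd wb /hd1 dw]; move: wb; rewrite inE => wb.
  have p0 := pos _ dw wb; have n0 := nz _ dw wb; have n1 := denom_neq0 db dw.
  rewrite -powR_half_sqr ?normc_ge0 //.
  have wb0 : w - b != 0 by rewrite subr_eq0.
  set u := normc _ `^ q.
  have uE : (q / 2 * (normc (blaschke b w) ^+ 2) `^ (q / 2 - 1))%:C =
      u%:C * ((q / 2)%:C / (blaschke b w * (blaschke b w)^*)).
    rewrite powRB; last by rewrite (gt_eqF p0) implybT.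
    rewrite -powR_half_sqr ?normc_ge0 // -/u.
    rewrite powRr1 ?sqr_ge0 // mul_conjc -fmorphV -!rmorphM; congr (_ %:C); ring.
  set D := (1 - normc b ^+ 2)%:C.
  have cD : D^* = D by rewrite conjc_rc.
  have E : m w = (q / 2)%:C * (D / (1 - b^* * w) ^+ 2) / blaschke b w.
    by rewrite /m /blaschke_dlog /blaschke -/D; field; rewrite n1 wb0.
  have n0c : (blaschke b w)^* != 0 by rewrite conjc_eq0.
  have Ec : (m w)^* = (q / 2)%:C * (D / (1 - b^* * w) ^+ 2)^* / (blaschke b w)^*.
    by rewrite E conjc_div conjc_mul conjc_rc.
  rewrite uE Ec E; set x := blaschke b w in n0 n0c *; set y := _ / _ ^+ 2.
  split => //; first by field; rewrite n0 n0c.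
  by field; rewrite n0 n0c.
- apply/differentiable_continuous; apply/derivable1_diffP.
  apply: derivableM; first exact: derivable_cst.
  by apply: derivable_powR; rewrite in_itv /= andbT pos.
Qed.

End BlaschkePower.

(** * The weight and its integration by parts *)

Section Weight.
Variable R : realType.
Local Notation C := R[i].
Local Notation "x ^*" := (conjc x) : ring_scope.
Variables (s : nat) (a : 'I_s -> C) (p : 'I_s -> R).
Hypotheses (ha : forall k, disc (a k)) (inj_a : injective a) (hp : forall k, - 2 < p k).

Local Notation factor k z := (normc (blaschke (a k) z) `^ p k).
Local Notation w := (weight a p).
Local Notation S := (codom a).

Definition weight_dlog (z : C) : C :=
  \sum_(k < s) (p k / 2)%:C * blaschke_dlog (a k) z.

Lemma weight_ge0 z : 0 <= w z.
Proof. by apply: prodr_ge0 => k _; exact: powR_ge0. Qed.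

(** Logarithmic derivatives of the factors add up. *)
Lemma weight_C1at z : disc z -> z \notin S ->
  C1at (fun u => (w u)%:C)
    (fun u => (w u)%:C * (weight_dlog u + (weight_dlog u)^*))
    (fun u => (w u)%:C * ('i * weight_dlog u - 'i * (weight_dlog u)^*)) z.
Proof.
move=> dz zs; rewrite /weight /weight_dlog.
elim: (index_enum _) => [|k r IH].
  apply: C1at_eq (C1at_cst 1 z) => u; rewrite !big_nil conjc0 !mulr0 subrr addr0 mulr0.
  by rewrite rmorph1.
have zk : z != a k by apply: contra zs => /eqP ->; exact: codom_f.
apply: C1at_eq (C1atM (blaschke_powR_C1at (p k) (ha k) dz zk) IH) => u.
rewrite !big_cons; set b := \prod_(j <- r) _; set m := \sum_(j <- r) _.
rewrite -/(blaschke (a k) u) !(rmorphM (real_complex R)) (rmorphD conjc) /=.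
set x := (_ * blaschke_dlog _ _); set y := (_ `^ _)%:C.
by split => //; ring.
Qed.

Lemma common_radius (I : finType) (P : I -> R -> Prop) :
  (forall i e e', 0 < e' -> e' <= e -> P i e -> P i e') ->
  (forall i, exists2 e, 0 < e & P i e) -> exists2 e, 0 < e & forall i, P i e.
Proof.
move=> mono ex; suff [e e0 he] : exists2 e, 0 < e & {in enum I, forall i, P i e}.
  by exists e => // i; apply: he; rewrite mem_enum.
elim: (enum I) => [|i r [e e0 IH]]; first by exists 1.
have [e1 e10 h1] := ex i; have m0 : 0 < Num.min e1 e by rewrite lt_min e10.
exists (Num.min e1 e) => // j; rewrite inE => /orP[/eqP ->|/IH].
  by apply: mono h1 => //; rewrite ge_min lexx.
by apply: mono => //; rewrite ge_min lexx orbT.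
Qed.

Lemma separated_points : exists2 e : R, 0 < e & forall j k, j != k -> e + e <= normc (a j - a k).
Proof.
have [||e e0 he] := @common_radius ('I_s * 'I_s)%type
    (fun jk e => jk.1 != jk.2 -> e + e <= normc (a jk.1 - a jk.2)).
- by move=> jk e e' _ le h /h; lra.
- move=> [j k] /=; have [->|jk] := eqVneq j k; first by exists 1.
  have h : 0 < normc (a j - a k).
    by rewrite normc_gt0 subr_eq0; apply: contra jk => /eqP /inj_a ->.
  by exists (normc (a j - a k) / 2) => [|_]; lra.
by exists e => // j k; exact: (he (j, k)).
Qed.

Lemma boundary_away : exists2 e : R, 0 < e & forall k z, 1 - e <= normc z -> e <= normc (z - a k).
Proof.
have [||e e0 he] := @common_radius 'I_s
    (fun k e => forall z, 1 - e <= normc z -> e <= normc (z - a k)).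
- by move=> k e e' e0 le h z hz; have := h z; move: hz; lra.
- move=> k; have := ha k; rewrite discE => hk.
  exists ((1 - normc (a k)) / 2) => [|z]; first by lra.
  by have := normc_sub_ge z (a k); lra.
by exists e.
Qed.

Lemma factor_sub1 (e : R) : 0 < e -> exists2 B : 'I_s -> R, (forall k, 0 <= B k) &
  forall k z, disc z -> e <= normc (z - a k) ->
  `|factor k z - 1| <= B k * (1 - normc z ^+ 2).
Proof.
move=> e0; have h k : exists B : R, 0 <= B /\ forall z, disc z -> e <= normc (z - a k) ->
    `|factor k z - 1| <= B * (1 - normc z ^+ 2).
  by have [B B0 hB] := blaschke_powR_sub1 (p k) (ha k) e0; exists B.
by have [B hB] := choice h; exists B => k; [have [] := hB k|have [] := hB k].
Qed.

(** The points being separated, at most one factor is large at a time. *)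
Lemma weight_majorant : exists2 v, rintegrable v & forall z, disc z -> w z <= v z.
Proof.
have [e e0 he] := separated_points; have [B B0 hB] := factor_sub1 e0.
have far k z : disc z -> e <= normc (z - a k) -> factor k z <= 1 + B k.
  move=> dz hz; have := hB k z dz hz; rewrite ler_norml.
  have := sqr_ge0 (normc z); have := B0 k; have := disc_sqr dz.
  move=> h1 h2 h3 /andP[_ h4].
  have : B k * (1 - normc z ^+ 2) <= B k * 1 by rewrite ler_wpM2l //; lra.
  by move: h4; lra.
suff : forall r : seq 'I_s, uniq r -> exists2 v, rintegrable v &
    forall z, disc z -> \prod_(k <- r) factor k z <= v z.
  by move=> h; have [v iv hv] := h _ (index_enum_uniq _); exists v.
elim=> [_|k r IH /= /andP[kr /IH[v iv hv]]].
  by exists (fun=> 1) => [|z _]; [exact: rintegrable_cst|rewrite big_nil].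
have [vk ivk hvk] := blaschke_powR_majorant (ha k) (hp k).
pose B2 := \prod_(j <- r) (1 + B j).
have B20 : 0 <= B2 by apply: prodr_ge0 => j _; rewrite addr_ge0.
exists (fun z => (1 + B k) * v z + B2 * vk z).
  by apply: rintegrableD; exact: rintegrableZ.
move=> z dz; rewrite big_cons.
have p0 : 0 <= \prod_(j <- r) factor j z by apply: prodr_ge0 => j _; exact: powR_ge0.
have v0 : 0 <= v z by exact: le_trans (hv z dz).
have vk0 : 0 <= vk z by apply: le_trans (hvk z dz); exact: powR_ge0.
have [hz|hz] := leP e (normc (z - a k)).
  apply: (@le_trans _ _ ((1 + B k) * v z)); last by rewrite lerDl mulr_ge0.
  by rewrite ler_pM ?powR_ge0 ?far ?hv.
apply: (@le_trans _ _ (B2 * vk z)); last by rewrite lerDr mulr_ge0 ?addr_ge0.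
rewrite mulrC ler_pM ?powR_ge0 ?hvk // /B2 big_seq [leRHS]big_seq.
apply: ler_prod => j jr; rewrite powR_ge0 far //=.
have jk : j != k by apply: contraNneq kr => <-.
have := he j k jk; have := normcB (z - a k) (z - a j).
by rewrite (_ : _ - (z - a j) = a j - a k); [lra|ring].
Qed.

(** The product of factors [1 + O(1 - |z|^2)] is of this form as well. *)
Lemma weight_sub1 : exists e B : R, [/\ 0 < e, e < 1, 0 <= B &
  forall z, disc z -> 1 - e <= normc z -> `|w z - 1| <= B * (1 - normc z ^+ 2)].
Proof.
have [e e0 he] := boundary_away; have [B B0 hB] := factor_sub1 e0.
have e10 : 0 < Num.min e 2^-1 by rewrite lt_min e0 invr_gt0 ltr0n.
have [D D0 hD] : exists2 D : R, 0 <= D & forall z, disc z -> 1 - e <= normc z ->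
    `|w z - 1| <= D * (1 - normc z ^+ 2).
  rewrite /weight; elim: (index_enum _) => [|k r [D D0 IH]].
    by exists 0 => // z dz _; rewrite big_nil subrr normr0 mul0r.
  exists (B k * (1 + D) + D); first by rewrite addr_ge0 // mulr_ge0 ?addr_ge0.
  move=> z dz hz; rewrite big_cons; set x := \prod_(j <- r) _.
  have t0 : 0 <= 1 - normc z ^+ 2 by rewrite subr_ge0 ltW // disc_sqr.
  have t1 : 1 - normc z ^+ 2 <= 1 by rewrite gerBl sqr_ge0.
  have hx : `|x - 1| <= D * (1 - normc z ^+ 2) by exact: IH.
  have hf : `|factor k z - 1| <= B k * (1 - normc z ^+ 2) by apply: hB => //; exact: he.
  have x1 : `|x| <= 1 + D.
    rewrite -[x](subrK 1) (le_trans (ler_normD _ _)) // normr1 addrC lerD2l.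
    by apply: (le_trans hx); rewrite ler_piMr.
  rewrite -/(factor k z) (_ : _ * x - 1 = (factor k z - 1) * x + (x - 1)); last by ring.
  apply: (le_trans (ler_normD _ _)); rewrite [leRHS]mulrDl lerD // normrM [leRHS]mulrAC.
  by rewrite ler_pM.
exists (Num.min e 2^-1), D; split => // [|z dz hz].
  by rewrite gt_min orbC invf_lt1 // ltr1n.
apply: hD => //; apply: le_trans hz; rewrite lerD2l lerN2 ge_min lexx //.
Qed.

Lemma weight_ccont z : disc z -> z \notin S -> ccont (fun u => (w u)%:C) z.
Proof. by move=> dz zs; have [] := weight_C1at dz zs. Qed.

Lemma sqr_weight_meas f : (forall z, disc z -> ccont f z) ->
  rmeas (fun z => normc (f z) ^+ 2 * w z).
Proof.
move=> cf; have m : cmeas (fun z => f z * (f z)^* * (w z)%:C).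
  apply: (ccont_cmeas (s := S)) => z dz zs; apply: ccontM; last exact: weight_ccont.
  by apply: ccontM; [exact: cf|apply: ccont_conj; exact: cf].
have [m1 _] := m; apply: eq_measurable_fun m1 => x _ /=.
by rewrite mul_conjc -rmorphM.
Qed.

Lemma sqr_weight_integrableP f : (forall z, disc z -> ccont f z) ->
  rintegrable (fun z => normc (f z) ^+ 2 * w z) <->
  (\int[sigma (R:=R)]_(x in plane_pt (R:=R) @^-1` disc (R:=R))
     (normc (f (plane_pt x)) ^+ 2 * w (plane_pt x))%:E < +oo)%E.
Proof.
move=> cf; pose u (x : measurableTypeR R * measurableTypeR R) :=
  normc (f (plane_pt x)) ^+ 2 * w (plane_pt x).
have E : (\int[sigma (R:=R)]_(x in plane_pt (R:=R) @^-1` disc (R:=R)) `|(u x)%:E| =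
    \int[sigma (R:=R)]_(x in plane_pt (R:=R) @^-1` disc (R:=R)) (u x)%:E)%E.
  apply: eq_integral => x _.
  by rewrite abse_EFin ger0_norm // mulr_ge0 ?sqr_ge0 ?weight_ge0.
rewrite -E; split=> [/integrableP[]//|h]; apply/integrableP; split => //.
by apply/measurable_EFinP; exact: sqr_weight_meas.
Qed.

Section SpaceMember.
Variables (f f' : C -> C).
Hypotheses (hf : hol_disc f f') (f2 : bergman_space w f).

Lemma sqr_weight_integrable : rintegrable (fun z => normc (f z) ^+ 2 * w z).
Proof.
by case: f2 => _; apply: (sqr_weight_integrableP _).2 => z /hf /hol_ccont.
Qed.

(** Near the circle the weight is at least one half and [|f| <= 1 + |f|^2]; inside,
    [f] is bounded. *)
Lemma weight_space_A1 : A1 f.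
Proof.
have [e [B [e0 e1 B0 hB]]] := weight_sub1.
have cf z : disc z -> ccont f z by move=> /hf /hol_ccont.
(* for [1 - d <= |z|] one has [B * (1 - |z|^2) <= 2 * B * d <= 1 / 2] *)
pose d := Num.min e (4 * (B + 1))^-1.
have B4 : 0 < 4 * (B + 1) by lra.
have d0 : 0 < d by rewrite lt_min e0 invr_gt0.
have d1 : d < 1 by rewrite gt_min e1.
have hr : 0 < (1 - d) ^+ 2 < 1 by rewrite exprn_gt0 ?expr_lt1 //; lra.
have [M M0 hM] := bounded_subdisc hr cf.
exists (fun z => M + (1 + 2 * (normc (f z) ^+ 2 * w z))).
  apply: rintegrableD; first exact: rintegrable_cst.
  apply: rintegrableD; first exact: rintegrable_cst.
  by apply: rintegrableZ; exact: sqr_weight_integrable.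
move=> z dz; have t0 : 0 <= normc (f z) ^+ 2 * w z by rewrite mulr_ge0 ?sqr_ge0 ?weight_ge0.
have [hz|hz] := leP (normc z ^+ 2) ((1 - d) ^+ 2); first by have := hM z hz; lra.
have {}hz : 1 - d <= normc z.
  by rewrite -(@ler_pXn2r _ 2) ?nnegrE ?normc_ge0 ?ltW //; lra.
have de : d <= e by rewrite ge_min lexx.
have dB : d <= (4 * (B + 1))^-1 by rewrite ge_min lexx orbT.
have := hB z dz; rewrite ler_norml => /(_ _)/andP[|h _]; first by lra.
have z1 : normc z < 1 by rewrite -discE.
have t2 : B * (1 - normc z ^+ 2) <= 1 / 2.
  have : 1 - normc z ^+ 2 <= 2 * d.
    rewrite (_ : 1 - normc z ^+ 2 = (1 + normc z) * (1 - normc z)); last by ring.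
    by apply: ler_pM; have := normc_ge0 z; lra.
  move=> h1; apply: (@le_trans _ _ ((B + 1) * (2 * (4 * (B + 1))^-1))); last first.
    by rewrite le_eqVlt; apply/orP; left; apply/eqP; field; lra.
  by apply: ler_pM => //; rewrite ?subr_ge0 ?(ltW (disc_sqr dz)) //; lra.
have w2 : 1 / 2 <= w z by lra.
have : normc (f z) ^+ 2 * (1 / 2) <= normc (f z) ^+ 2 * w z by rewrite ler_wpM2l ?sqr_ge0.
have : 2 * normc (f z) <= 1 + normc (f z) ^+ 2.
  by have := sqr_ge0 (normc (f z) - 1); rewrite sqrrB1; lra.
by move: M0 (normc_ge0 (f z)) (sqr_ge0 (normc (f z))); lra.
Qed.

End SpaceMember.

Lemma bounded_in_space g g' (B : R) : hol_disc g g' -> analytic_on_disc g ->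
  (forall z, disc z -> normc (g z) <= B) -> bergman_space w g.
Proof.
move=> hg ag hB; split => //.
have [v iv hv] := weight_majorant.
have cg z : disc z -> ccont g z by move=> /hg /hol_ccont.
apply/(sqr_weight_integrableP cg).
apply: (rintegrable_le (sqr_weight_meas cg) (rintegrableZ (B ^+ 2) iv)) => z dz.
have B0 : 0 <= B by apply: le_trans (hB z dz); exact: normc_ge0.
rewrite ger0_norm; last by rewrite mulr_ge0 ?sqr_ge0 ?weight_ge0.
apply: ler_pM; [exact: sqr_ge0|exact: weight_ge0| |exact: hv].
by rewrite lerXn2r ?nnegrE ?normc_ge0 ?hB.
Qed.

Lemma weighted_mul_integrable f f' g : hol_disc f f' -> bergman_space w f ->
  (forall z, disc z -> ccont g z) -> rintegrable (fun z => normc (g z) ^+ 2 * w z) ->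
  cintegrable (fun z => f z * g z * (w z)%:C).
Proof.
move=> hf f2 cg g2.
apply: (cintegrable_le (v := fun z => normc (f z) ^+ 2 * w z + normc (g z) ^+ 2 * w z)).
- apply: (ccont_cmeas (s := S)) => z dz zs; apply: ccontM; last exact: weight_ccont.
  by apply: ccontM; [exact: hol_ccont (hf z dz)|exact: cg].
- by apply: rintegrableD => //; exact: sqr_weight_integrable hf f2.
move=> z dz; rewrite (normcM _ _%:C) normc_real ger0_norm ?weight_ge0 // -mulrDl.
rewrite ler_wpM2r ?weight_ge0 // normcM.
have := sqr_ge0 (normc (f z) - normc (g z)); rewrite sqrrB.
have := normc_ge0 (f z); have := normc_ge0 (g z) => g0 f0.
by have : 0 <= normc (f z) * normc (g z) by [exact: mulr_ge0]; lra.
Qed.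

(** The points of [l] meet finitely many horizontal lines. *)
Lemma disc_int_off (l : seq C) f : cintegrable f -> {subset l <= @disc R} ->
  disc_int (off l f) = disc_int f.
Proof.
move=> [i1 i2] ld.
have key (P : C -> R) : P 0 = 0 -> rintegrable (fun z => P (f z)) ->
    rint (fun z => P (off l f z)) = rint (fun z => P (f z)).
  move=> P0 ip; pose u z := if z \in l then P (f z) else 0.
  have iu : rintegrable u.
    apply: rintegrable_le (rintegrable_norm ip) _.
      apply: (rcont_measurable (s := l)) => z _ zl e e0.
      have [d d0 hd] := notin_open zl; exists d => // v /hd vl.
      by rewrite /u (negbTE vl) (negbTE zl) subrr normr0.
    by move=> z _; rewrite /u; case: ifP => // _; rewrite normr0.
  have u0 : rint u = 0.
    apply: (@rint_eq0_fubini R u [seq Im z | z <- l]) => // [z ndz|].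
      by rewrite /u; case: ifP => // /ld; rewrite inE.
    left=> y hy; apply: integral0_eq => x _; rewrite /u; case: ifP => // xl.
    by case/negP: hy; apply/mapP; exists (x +i* y).
  rewrite (eq_rint (v := fun z => P (f z) + - u z)); last first.
    by move=> z _; rewrite /off /u; case: ifP => _; rewrite ?subrr ?subr0.
  by rewrite rintD ?rintN ?u0 ?subr0 //; exact: rintegrableN.
rewrite !disc_intE; congr (_ +i* _).
  exact: (key (@complex.Re R)).
exact: (key (@complex.Im R)).
Qed.

(** Stokes applied to [f g^* (h - 1)], which vanishes at the boundary because
    [h - 1] does; at the points [a k] the zeros of [g] absorb the singularity of
    the logarithmic derivative of [h]. *)
Lemma weighted_stokes f f' g g' G (B : R) : hol_disc f f' -> bergman_space w f ->
  hol_disc g g' -> (forall z, disc z -> ccont G z) -> 0 <= B ->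
  (forall z, disc z -> [/\ normc (g z) <= B, normc (g' z) <= B & normc (G z) <= B]) ->
  (forall z, disc z -> z \notin S -> g z * weight_dlog z = G z) ->
  disc_int (fun z => f z * (g' z + G z)^* * (w z)%:C) =
  disc_int (fun z => f z * (g' z)^*).
Proof.
move=> hf f2 hg cG B0 hB gG.
have a1 := weight_space_A1 hf f2; have [v1 iv1 hv1] := a1.
have if2 := sqr_weight_integrable hf f2.
have [vw ivw hvw] := weight_majorant.
have [e [B1 [e0 e1 B10 hB1]]] := weight_sub1.
have cf z : disc z -> ccont f z by move=> /hf /hol_ccont.
have cg' z : disc z -> ccont g' z by move=> /hg[].
have subS : {subset S <= @disc R} by move=> _ /codomP[k ->]; apply/asboolP; exact: ha.
pose fw z := vw z + normc (f z) ^+ 2 * w z.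
have ifw : rintegrable fw by exact: rintegrableD.
have hfw z : disc z -> normc (f z) * w z <= fw z.
  move=> dz; rewrite /fw; have h1 := hvw z dz; have w0 := weight_ge0 z.
  apply: (@le_trans _ _ (w z + normc (f z) ^+ 2 * w z)); last by rewrite lerD2r.
  rewrite -[X in X + _]mul1r -mulrDl ler_wpM2r //.
  by have := sqr_ge0 (normc (f z) - 1); have := normc_ge0 (f z); rewrite sqrrB1; lra.
pose M z := weight_dlog z.
pose Phi z := f z * (g z)^* * ((w z)%:C - 1).
pose Px z := (f' z * (g z)^* + f z * (g' z)^*) * ((w z)%:C - 1) +
  f z * (g z)^* * ((w z)%:C * (M z + (M z)^*)).
pose Py z := ('i * f' z * (g z)^* + f z * (- 'i * (g' z)^*)) * ((w z)%:C - 1) +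
  f z * (g z)^* * ((w z)%:C * ('i * M z - 'i * (M z)^*)).
have CP z : disc z -> z \notin S -> C1at Phi Px Py z.
  move=> dz zs.
  apply: C1at_eq (C1atM (C1atM (hf z dz) (C1at_conj_hol (hg z dz)))
    (C1atD (weight_C1at dz zs) (C1at_cst (-1) z))) => u.
  by split => //; rewrite /Px /Py /M addr0.
have PE z : disc z -> z \notin S -> Px z + 'i * Py z =
    2 * (f z * (g' z + G z)^* * (w z)%:C - f z * (g' z)^*).
  move=> dz zs; rewrite -(gG z dz zs) (rmorphD conjc) /= conjc_mul -/(M z) /Px /Py.
  set x := (g z)^*; set y := (g' z)^*; set t := (w z)%:C; set m := M z; set n := m^*.
  transitivity ((1 + 'i * 'i) * (f' z * x * (t - 1) + f z * x * t * m) +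
    (1 - 'i * 'i) * (f z * y * (t - 1) + f z * x * t * n)); first by ring.
  by rewrite mul_ii; ring.
(* [4 * B] is for the derivative of [Phi]; [B * B1] is for [Phi] near the circle, and
   [2 * B / e] for [Phi] where [e <= 1 - |z|^2] *)
pose C1 := 4 * B + B * B1 + 2 * B / e.
have ev0 : 0 <= 2 * B / e by rewrite divr_ge0 ?mulr_ge0 // ltW.
have BB0 : 0 <= B * B1 by exact: mulr_ge0.
have i1 : cintegrable (fun z => f z * (g' z + G z)^* * (w z)%:C).
  apply: (cintegrable_le (v := fun z => (2 * B) * fw z)).
  - apply: (ccont_cmeas (s := S)) => z dz zs; apply: ccontM; last exact: weight_ccont.
    apply: ccontM; first exact: cf.
    by apply: ccont_conj; apply: ccontD; [exact: cg'|exact: cG].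
  - exact: rintegrableZ.
  move=> z dz; rewrite (normcM _ _%:C) (normcM (f z)) normc_conj normc_real.
  rewrite ger0_norm ?weight_ge0 // mulrAC mulrC; have [b1 b2 b3] := hB z dz.
  rewrite ler_pM ?normc_ge0 ?mulr_ge0 ?normc_ge0 ?weight_ge0 ?hfw //.
  by apply: (le_trans (normcD _ _)); lra.
have i2 : cintegrable (fun z => f z * (g' z)^*).
  apply: (A1_mul_cintegrable (B := B) a1 cf) => z dz.
    by apply: ccont_conj; exact: cg'.
  by rewrite normc_conj; have [] := hB z dz.
pose F z := 2 * (f z * (g' z + G z)^* * (w z)%:C - f z * (g' z)^*).
have iF : cintegrable F by apply: cintegrableZ; exact: cintegrableB.
suff h : disc_int F = 0.
  move: h; rewrite /F disc_intZ ?disc_intB //; last exact: cintegrableB.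
  by move=> /eqP; rewrite mulf_eq0 pnatr_eq0 /= subr_eq0 => /eqP.
rewrite -(disc_int_off iF subS).
have E : disc_int (off S F) = disc_int (off S (fun z => Px z + 'i * Py z)).
  apply: eq_disc_int => z dz; rewrite /off; case: ifPn => // zs; by rewrite PE.
rewrite E; apply: (limit_stokes CP (v := fun z => C1 * (fw z + v1 z))).
- by apply: rintegrableZ; exact: rintegrableD.
- move=> z dz zs; rewrite PE //; have [b1 b2 b3] := hB z dz.
  have fw1 := hfw z dz; have fv := hv1 z dz; have w0 := weight_ge0 z.
  have fw0 : 0 <= normc (f z) * w z by rewrite mulr_ge0 ?normc_ge0.
  have f0 := normc_ge0 (f z).
  rewrite (normcM 2) normc_nat.
  have e3 : normc (f z * (g' z + G z)^* * (w z)%:C - f z * (g' z)^*) <= (2 * B) * fw z + B * v1 z.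
    apply: (le_trans (normcB _ _)); rewrite (normcM _ _%:C) !(normcM (f z)) !normc_conj normc_real.
    rewrite (ger0_norm w0); apply: lerD.
      rewrite mulrAC mulrC ler_pM ?normc_ge0 //.
      by apply: (le_trans (normcD _ _)); lra.
    by rewrite mulrC ler_pM ?normc_ge0.
  have p1 : 0 <= fw z by lra.
  have p2 : 0 <= v1 z by lra.
  have p3 : 0 <= (B * B1 + 2 * B / e) * (fw z + v1 z) by apply: mulr_ge0; exact: addr_ge0.
  have p4 : 0 <= B * v1 z by exact: mulr_ge0.
  rewrite /C1 -addrA mulrDl; move: e3 p3 p4; lra.
- move=> z dz zs; have [b1 b2 b3] := hB z dz.
  have fw1 := hfw z dz; have fv := hv1 z dz; have w0 := weight_ge0 z.
  have f0 := normc_ge0 (f z); have fw0 : 0 <= normc (f z) * w z by rewrite mulr_ge0.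
  have t0 : 0 <= 1 - normc z ^+ 2 by rewrite subr_ge0 ltW // disc_sqr.
  have p1 : 0 <= fw z by lra.
  have p2 : 0 <= v1 z by lra.
  have nP : normc (Phi z) = normc (g z) * (normc (f z) * `|w z - 1|).
    rewrite /Phi normcM normcM normc_conj.
    by rewrite -[1]/(1%:C) -rmorphB normc_real; ring.
  have [hz|hz] := leP (1 - e) (normc z).
    have h := hB1 z dz hz; rewrite nP.
    apply: (@le_trans _ _ (B * (v1 z * (B1 * (1 - normc z ^+ 2))))).
      by rewrite ler_pM ?mulr_ge0 ?normc_ge0 // ler_pM.
    rewrite (_ : B * _ = B * B1 * v1 z * (1 - normc z ^+ 2)); last by ring.
    rewrite ler_wpM2r // /C1.
    have q1 : 0 <= (4 * B + 2 * B / e) * (fw z + v1 z).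
      by apply: mulr_ge0; apply: addr_ge0 => //; exact: mulr_ge0.
    have q2 : 0 <= B * B1 * fw z by exact: mulr_ge0.
    by move: q1 q2; lra.
  have he : e <= 1 - normc z ^+ 2.
    have : normc z * normc z <= normc z * 1.
      by rewrite ler_wpM2l ?normc_ge0 // ltW // -discE.
    by rewrite -expr2; lra.
  have e3 : normc (f z) * `|w z - 1| <= fw z + v1 z.
    apply: (@le_trans _ _ (normc (f z) * (w z + 1))); last by lra.
    rewrite ler_wpM2l // (le_trans (ler_normB _ _)) // normr1 ger0_norm //.
  rewrite nP; apply: (@le_trans _ _ (B * (fw z + v1 z))).
    by rewrite ler_pM ?mulr_ge0 ?normc_ge0.
  apply: (@le_trans _ _ (2 * B / e * e * (fw z + v1 z))).
    by rewrite divfK ?gt_eqF //; apply: ler_wpM2r; [exact: addr_ge0|lra].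
  have s0 : 0 <= fw z + v1 z by exact: addr_ge0.
  rewrite mulrAC; apply: ler_pM => //; [exact: mulr_ge0|exact: ltW|].
  apply: ler_wpM2r => //; rewrite /C1 lerDr.
  by apply: addr_ge0 => //; exact: mulr_ge0.
- move=> rho hrho.
  have [Mf Mf0 hMf] := bounded_subdisc hrho cf.
  have [Mf' Mf'0 hMf'] := bounded_subdisc hrho (fun z dz => let: And5 _ _ _ h _ := hf z dz in h).
  exists (fun z => ((Mf' + Mf) * B) * (vw z + 1) + (2 * Mf * B) * vw z).
    apply: rintegrableD; last exact: rintegrableZ.
    by apply: rintegrableZ; apply: rintegrableD => //; exact: rintegrable_cst.
  move=> z hz zs; have dz : disc z.
    by rewrite discE -(@expr_lt1 _ 2) ?normc_ge0 //; case/andP: hrho => _; apply: lt_trans.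
  have h1 : normc (f' z) <= Mf' by apply: hMf'; exact: ltW.
  have h2 : normc (f z) <= Mf by apply: hMf; exact: ltW.
  have [b1 b2 b3] := hB z dz; have w0 := weight_ge0 z; have w1 := hvw z dz.
  have nw : normc ((w z)%:C - 1) <= vw z + 1.
    by rewrite (le_trans (normcB _ _)) // normc1 normc_real ger0_norm // lerD2r.
  have gM : normc (g z)^* * normc (M z) <= B.
    by rewrite normc_conj -normcM gG.
  have last2 (c1 c2 : C) : normc c1 <= 1 -> normc c2 <= 1 ->
      normc (f z * (g z)^* * ((w z)%:C * (c1 * M z - c2 * (M z)^*))) <= 2 * Mf * B * vw z.
    move=> n1 n2; rewrite (normcM _ (_%:C * _)) (normcM (f z)) (normcM _%:C) normc_real.
    rewrite (ger0_norm w0) [w z * _]mulrC mulrA ler_pM ?mulr_ge0 ?normc_ge0 //.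
    rewrite -[leLHS]mulrA (mulrC 2) -mulrA ler_pM ?mulr_ge0 ?normc_ge0 //.
    apply: (@le_trans _ _ (normc (g z)^* * (2 * normc (M z)))); last by move: gM; lra.
    rewrite ler_wpM2l ?normc_ge0 // (le_trans (normcB _ _)) // !normcM normc_conj.
    rewrite mulr_natl mulr2n lerD // -[leRHS]mul1r ler_wpM2r ?normc_ge0 //.
  have first2 (c1 c2 : C) : normc c1 <= 1 -> normc c2 <= 1 ->
      normc ((c1 * f' z * (g z)^* + f z * (c2 * (g' z)^*)) * ((w z)%:C - 1)) <=
      (Mf' + Mf) * B * (vw z + 1).
    move=> n1 n2; rewrite normcM ler_pM ?normc_ge0 // mulrDl.
    apply: normc_mulD; rewrite ?normc_conj //.
      by rewrite normcM -[leRHS]mul1r ler_pM ?normc_ge0.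
    by rewrite normcM normc_conj -[leRHS]mul1r ler_pM ?normc_ge0.
  split; apply: (le_trans (normcD _ _)); apply: lerD.
  - by have := first2 1 1; rewrite !mul1r normc1 => /(_ (lexx _) (lexx _)).
  - have := last2 1 (-1); rewrite mul1r mulN1r opprK normcN normc1; exact.
  - by apply: first2; rewrite ?normcN normc_i.
  - by apply: last2; rewrite normc_i.
Qed.

End Weight.

(** * Power series of integrable holomorphic functions *)

Section BoundedHolomorphic.
Variable R : realType.
Local Notation C := R[i].
Local Notation "x ^*" := (conjc x) : ring_scope.
Implicit Types (f g : C -> C) (u z : C).

(** Bounded holomorphic functions, which multiply the following class into
    itself. *)
Definition bhol f := (exists f', hol_disc f f') /\
  exists2 B : R, 0 <= B & forall z, disc z -> normc (f z) <= B.

Lemma bholD f g : bhol f -> bhol g -> bhol (fun z => f z + g z).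
Proof.
move=> [[f' hf] [A A0 hA]] [[g' hg] [B B0 hB]]; split.
  by exists (fun z => f' z + g' z) => z dz; apply: holD; [exact: hf|exact: hg].
exists (A + B) => [|z dz]; first exact: addr_ge0.
by apply: (le_trans (normcD _ _)); rewrite lerD ?hA ?hB.
Qed.

Lemma bholM f g : bhol f -> bhol g -> bhol (fun z => f z * g z).
Proof.
move=> [[f' hf] [A A0 hA]] [[g' hg] [B B0 hB]]; split.
  by exists (fun z => f' z * g z + f z * g' z) => z dz; apply: holM; [exact: hf|exact: hg].
exists (A * B) => [|z dz]; first exact: mulr_ge0.
by rewrite normcM ler_pM ?normc_ge0 ?hA ?hB.
Qed.

Lemma horner_bounded (Q : {poly C}) : exists2 B : R, 0 <= B &
  forall z, disc z -> normc Q.[z] <= B.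
Proof.
elim/poly_ind: Q => [|Q c [B B0 hB]].
  by exists 0 => // z _; rewrite horner0 normc0.
exists (B + normc c) => [|z dz]; first by rewrite addr_ge0 ?normc_ge0.
rewrite hornerMXaddC (le_trans (normcD _ _)) // lerD2r normcM -[leRHS]mulr1.
by rewrite ler_pM ?normc_ge0 ?hB // ltW // -discE.
Qed.

Lemma horner_hol_disc (Q : {poly C}) : hol_disc (fun z => Q.[z]) (fun z => Q^`().[z]).
Proof. by move=> z _; exact: hol_horner. Qed.

Lemma bhol_horner (Q : {poly C}) : bhol (fun z => Q.[z]).
Proof. by split; [exists (fun z => Q^`().[z]); exact: horner_hol_disc|exact: horner_bounded]. Qed.

Lemma bhol_cst k : bhol (fun=> k : C).
Proof.
split; first by exists (fun=> 0) => z _; exact: hol_cst.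
by exists (normc k) => //; exact: normc_ge0.
Qed.

Lemma geometric_neq0 u z : disc u -> disc z -> 1 - u * z != 0.
Proof. by move=> du dz; have := disc_denom_neq0 du (disc_conj dz); rewrite conjcK. Qed.

Lemma bhol_geometric (u : C) : disc u -> bhol (fun z => (1 - u * z)^-1).
Proof.
move=> du; have du' := disc_conj du; split.
  exists (fun z => u / (1 - u * z) ^+ 2) => z dz.
  have := hol_cauchy du' dz; rewrite conjcK; exact.
have u0 : 0 < 1 - normc u by rewrite subr_gt0 -discE.
exists (1 - normc u)^-1 => [|z dz]; first by rewrite invr_ge0 ltW.
have := disc_denom_ge du (disc_conj dz); rewrite conjcK => h.
by rewrite normcV lef_pV2 ?posrE //; exact: lt_le_trans h.
Qed.

Lemma bhol_eq f g : (forall z, f z = g z) -> bhol f -> bhol g.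
Proof. by move=> /funext ->. Qed.

Lemma bhol_sum (I : Type) (r : seq I) (F : I -> C -> C) :
  (forall i, bhol (F i)) -> bhol (fun z => \sum_(i <- r) F i z).
Proof.
move=> hF; elim: r => [|i r IH].
  by apply: bhol_eq (bhol_cst 0) => z; rewrite big_nil.
by apply: bhol_eq (bholD (hF i) IH) => z; rewrite big_cons.
Qed.

Lemma bhol_prod (I : Type) (r : seq I) (F : I -> C -> C) :
  (forall i, bhol (F i)) -> bhol (fun z => \prod_(i <- r) F i z).
Proof.
move=> hF; elim: r => [|i r IH].
  by apply: bhol_eq (bhol_cst 1) => z; rewrite big_nil.
by apply: bhol_eq (bholM (hF i) IH) => z; rewrite big_cons.
Qed.

End BoundedHolomorphic.

Section PowerSeries.
Variable R : realType.
Local Notation C := R[i].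
Local Notation "x ^*" := (conjc x) : ring_scope.
Implicit Types (f g : C -> C) (u v w z : C).

(** The Bergman space of exponent 1. *)
Definition bergman1 f := A1 f /\ exists f', hol_disc f f'.

Lemma bergman1_ccont f z : bergman1 f -> disc z -> ccont f z.
Proof. by move=> [_ [f' hf]] /hf /hol_ccont. Qed.

Lemma eq_bergman1 f g : (forall z, disc z -> f z = g z) -> bergman1 f -> bergman1 g.
Proof.
move=> fg [[v iv hv] [f' hf]]; split; first by exists v => // z dz; rewrite -fg ?hv.
exists f' => z dz; have [d d0 hd] := copen_disc dz.
by apply: (C1at_near d0) (hf z dz) => w /hd /fg.
Qed.

Lemma bhol_bergman1 f : bhol f -> bergman1 f.
Proof. by move=> [hf [B _ hB]]; split => //; exact: A1_bounded hB. Qed.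

Lemma bergman1_cst k : bergman1 (fun=> k).
Proof. exact: bhol_bergman1 (bhol_cst k). Qed.

Lemma bergman1D f g : bergman1 f -> bergman1 g -> bergman1 (fun z => f z + g z).
Proof.
move=> [a1 [f' hf]] [b1 [g' hg]]; split; first exact: A1D.
by exists (fun z => f' z + g' z) => z dz; apply: holD; [exact: hf|exact: hg].
Qed.

Lemma bergman1M f g : bergman1 f -> bhol g -> bergman1 (fun z => g z * f z).
Proof.
move=> [a1 [f' hf]] [[g' hg] [B _ hB]]; split; first exact: A1M a1 hB.
by exists (fun z => g' z * f z + g z * f' z) => z dz; apply: holM; [exact: hg|exact: hf].
Qed.

Lemma bergman1Z k f : bergman1 f -> bergman1 (fun z => k * f z).
Proof. by move=> hf; exact: bergman1M hf (bhol_cst k). Qed.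

Lemma bergman1B f g : bergman1 f -> bergman1 g -> bergman1 (fun z => f z - g z).
Proof.
move=> hf hg; apply: eq_bergman1 (bergman1D hf (bergman1Z (-1) hg)) => z _.
by rewrite mulN1r.
Qed.

Lemma bergman1_sum (I : Type) (r : seq I) (F : I -> C -> C) :
  (forall i, bergman1 (F i)) -> bergman1 (fun z => \sum_(i <- r) F i z).
Proof.
move=> hF; elim: r => [|i r IH].
  by apply: eq_bergman1 (bergman1_cst 0) => z _; rewrite big_nil.
by apply: eq_bergman1 (bergman1D (hF i) IH) => z _; rewrite big_cons.
Qed.

Lemma bergman1_horner (Q : {poly C}) f : bergman1 f -> bergman1 (fun z => Q.[z] * f z).
Proof. by move=> hf; exact: bergman1M hf (bhol_horner Q). Qed.

Lemma bergman1_poly (Q : {poly C}) : bergman1 (fun z => Q.[z]).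
Proof. exact: bhol_bergman1 (bhol_horner Q). Qed.

Lemma eq_taylor f g n : (forall z, disc z -> f z = g z) -> taylor n f = taylor n g.
Proof.
by move=> fg; congr (_ * _); apply: eq_disc_int => z dz; rewrite fg.
Qed.

Lemma taylorD f g n : bergman1 f -> bergman1 g ->
  taylor n (fun z => f z + g z) = taylor n f + taylor n g.
Proof.
move=> hf hg; rewrite /taylor -mulrDr -disc_intD; first last.
- by apply: taylor_integrable hg.1 _ => z dz; exact: bergman1_ccont.
- by apply: taylor_integrable hf.1 _ => z dz; exact: bergman1_ccont.
by congr (_ * _); apply: eq_disc_int => z _; rewrite mulrDl.
Qed.

Lemma taylorZ k f n : bergman1 f -> taylor n (fun z => k * f z) = k * taylor n f.
Proof.
move=> hf; rewrite /taylor mulrCA -(disc_intZ k); last first.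
  by apply: taylor_integrable hf.1 _ => z dz; exact: bergman1_ccont.
by congr (_ * _); apply: eq_disc_int => z _; rewrite mulrA.
Qed.

Lemma taylorB f g n : bergman1 f -> bergman1 g ->
  taylor n (fun z => f z - g z) = taylor n f - taylor n g.
Proof.
move=> hf hg; rewrite -mulN1r -taylorZ // -taylorD //; last exact: bergman1Z.
by apply: eq_taylor => z _; rewrite mulN1r.
Qed.

Lemma taylor_cst0 n : taylor n (fun=> 0 : C) = 0.
Proof.
have := taylorZ 0 n (bergman1_cst 0); rewrite !mul0r; exact.
Qed.

Lemma taylor_sum (I : Type) (r : seq I) (F : I -> C -> C) n :
  (forall i, bergman1 (F i)) ->
  taylor n (fun z => \sum_(i <- r) F i z) = \sum_(i <- r) taylor n (F i).
Proof.
move=> hF; elim: r => [|i r IH].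
  by rewrite big_nil -[RHS](taylor_cst0 n); apply: eq_taylor => z _; rewrite big_nil.
rewrite big_cons -IH -taylorD //; last exact: bergman1_sum.
by apply: eq_taylor => z _; rewrite big_cons.
Qed.

Lemma taylor_mulXS f n : bergman1 f -> taylor n.+1 (fun z => z * f z) = taylor n f.
Proof. by move=> [a1 [f' hf]]; exact: taylor_shift hf a1. Qed.

Lemma taylor_mulX0 f : bergman1 f -> taylor 0 (fun z => z * f z) = 0.
Proof. by move=> [a1 [f' hf]]; exact: taylor_shift0 hf a1. Qed.

Lemma taylor_cst1 n : taylor n (fun=> 1 : C) = (n == 0)%:R.
Proof.
case: n => [|n].
  rewrite /taylor mul1r -[RHS](disc_int_cst (1 : C)).
  by apply: eq_disc_int => z _; rewrite expr0 mulr1.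
have hX : bergman1 (fun z => z ^+ n).
  by apply: eq_bergman1 (bergman1_poly 'X^n) => z _; rewrite hornerXn.
have h0 : disc_int (fun z => z * z ^+ n) = 0.
  have := taylor_mulX0 hX; rewrite /taylor mul1r => h; rewrite -[RHS]h.
  by apply: eq_disc_int => z _; rewrite expr0 mulr1.
rewrite /taylor (eq_disc_int (g := fun z => (z * z ^+ n)^*)); last first.
  by move=> z _; rewrite mul1r -exprS rmorphXn.
rewrite disc_int_conj ?h0 ?conjc0 ?mulr0 //.
apply: (cintegrable_cont (v := fun=> 1)) => [z _| |z dz].
- by rewrite (_ : (fun _ => _) = (fun z => z ^+ n.+1)); [apply: ccont_exp; exact: ccont_id|
    apply/funext => u; rewrite exprS].
- exact: rintegrable_cst.
by rewrite -exprS normcX exprn_ile1 ?normc_ge0 // ltW // -discE.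
Qed.

Lemma taylor_horner_mul (Q : {poly C}) f n : bergman1 f ->
  taylor n (fun z => Q.[z] * f z) = \sum_(l < n.+1) Q`_l * taylor (n - l) f.
Proof.
move=> hf; elim/poly_ind: Q n => [|Q c IH] n.
  rewrite big1 => [|l _]; last by rewrite polyseq0 nth_nil mul0r.
  by rewrite -[RHS](taylor_cst0 n); apply: eq_taylor => z _; rewrite horner0 mul0r.
have hQ := bergman1_horner Q hf.
have hXQ : bergman1 (fun z => z * (Q.[z] * f z)).
  by apply: eq_bergman1 (bergman1_horner 'X hQ) => z _; rewrite hornerX.
rewrite (eq_taylor (g := fun z => z * (Q.[z] * f z) + c * f z)); last first.
  by move=> z _; rewrite hornerMXaddC mulrDl mulrCA mulrA.
rewrite (taylorD n hXQ (bergman1Z c hf)) (taylorZ c n hf) big_ord_recl.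
rewrite {1}coefD coefMX coefC /= add0r subn0 addrC; congr (_ + _).
have E (l : nat) : (Q * 'X + c%:P)`_l.+1 = Q`_l by rewrite coefD coefMX coefC /= addr0.
case: n => [|n]; first by rewrite (taylor_mulX0 hQ) big_ord0.
rewrite (taylor_mulXS n hQ) IH; apply: eq_bigr => l _.
by rewrite /bump /= add1n E subSS.
Qed.

Lemma taylor_poly (Q : {poly C}) n : taylor n (fun z => Q.[z]) = Q`_n.
Proof.
rewrite (eq_taylor (g := fun z => Q.[z] * 1)); last by move=> z _; rewrite mulr1.
rewrite (taylor_horner_mul Q n (bergman1_cst 1)) (bigD1 ord_max) //=.
rewrite taylor_cst1 subnn eqxx mulr1 big1 ?addr0 // => l ln.
rewrite taylor_cst1 (_ : (n - l == 0)%N = false) ?mulr0 //.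
by rewrite subn_eq0; apply/negbTE; rewrite -ltnNge ltn_neqAle -ltnS ltn_ord andbT.
Qed.

Lemma bergman1_geometric u : disc u -> bergman1 (fun z => (1 - u * z)^-1).
Proof. by move=> du; exact: bhol_bergman1 (bhol_geometric du). Qed.

Lemma bergman1_geometric_mul u f : disc u -> bergman1 f ->
  bergman1 (fun z => (1 - u * z)^-1 * f z).
Proof. by move=> du hf; exact: bergman1M hf (bhol_geometric du). Qed.

(** Comparing coefficients in [f = (1 - u z) (f / (1 - u z))]. *)
Lemma taylor_geometric_mul u f n : disc u -> bergman1 f ->
  taylor n (fun z => (1 - u * z)^-1 * f z) = \sum_(l < n.+1) u ^+ l * taylor (n - l) f.
Proof.
move=> du hf; have hg := bergman1_geometric_mul du hf.
set g := (fun z => (1 - u * z)^-1 * f z) in hg *.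
have hX : bergman1 (fun z => z * g z).
  by apply: eq_bergman1 (bergman1_horner 'X hg) => z _; rewrite hornerX.
have E m : taylor m g = taylor m f + u * taylor m (fun z => z * g z).
  rewrite -(taylorZ u m hX) -(taylorD m hf (bergman1Z u hX)).
  apply: eq_taylor => z dz; have n0 := geometric_neq0 du dz.
  by rewrite /g; field.
elim: n => [|n IH].
  by rewrite E (taylor_mulX0 hg) mulr0 addr0 big_ord_recl big_ord0 expr0 mul1r addr0.
rewrite E (taylor_mulXS n hg) IH [RHS]big_ord_recl expr0 mul1r subn0; congr (_ + _).
by rewrite mulr_sumr; apply: eq_bigr => l _; rewrite lift0 subSS exprS mulrA.
Qed.

Lemma taylor_geometric u n : disc u -> taylor n (fun z => (1 - u * z)^-1) = u ^+ n.
Proof.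
move=> du; rewrite (eq_taylor (g := fun z => (1 - u * z)^-1 * 1)); last by move=> z _; rewrite mulr1.
rewrite (taylor_geometric_mul n du (bergman1_cst 1)) (bigD1 ord_max) //=.
rewrite taylor_cst1 subnn eqxx mulr1 big1 ?addr0 // => l ln.
rewrite taylor_cst1 (_ : (n - l == 0)%N = false) ?mulr0 //.
by rewrite subn_eq0; apply/negbTE; rewrite -ltnNge ltn_neqAle -ltnS ltn_ord andbT.
Qed.

Lemma taylor_geometric2 u v n : disc u -> disc v ->
  taylor n (fun z => (1 - u * z)^-1 * (1 - v * z)^-1) = \sum_(l < n.+1) u ^+ l * v ^+ (n - l).
Proof.
move=> du dv; rewrite (taylor_geometric_mul n du (bergman1_geometric dv)).
by apply: eq_bigr => l _; rewrite taylor_geometric.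
Qed.

Lemma taylor_geometric_sqr u n : disc u ->
  taylor n (fun z => (1 - u * z)^-1 * (1 - u * z)^-1) = n.+1%:R * u ^+ n.
Proof.
move=> du; rewrite taylor_geometric2 // (eq_bigr (fun=> u ^+ n)) => [|l _].
  by rewrite sumr_const card_ord mulr_natl.
by rewrite -exprD subnKC // -ltnS.
Qed.

Lemma le0_geometric (x r B : R) : 0 <= r < 1 -> (forall n, x <= r ^+ n * B) -> x <= 0.
Proof.
move=> /andP[r0 r1] h; have c : r ^+ n * B @[n --> \oo] --> 0 * B.
  by apply: cvgM; [apply: cvg_expr; rewrite ger0_norm|exact: cvg_cst].
rewrite mul0r in c; rewrite -(cvg_lim _ c) //; apply: limr_ge; last by near=> n.
by apply/cvg_ex; exists 0.
Unshelve. all: by end_near.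
Qed.

(** By the Bergman formula the function is a superposition of Cauchy kernels,
    whose expansion only involves the Taylor coefficients. *)
Lemma taylor_eq0 f w : bergman1 f -> (forall n, taylor n f = 0) -> disc w -> f w = 0.
Proof.
move=> hf c0; have [a1 [f' hf']] := hf.
have cf z : disc z -> ccont f z by move=> dz; exact: bergman1_ccont.
have int0 n : disc_int (fun z => f z * z^* ^+ n) = 0.
  by apply/eqP; have /eqP := c0 n; rewrite /taylor mulf_eq0 pnatr_eq0.
have step u n : disc u -> cauchy_int f 1 n u = u * cauchy_int f 1 n.+1 u.
  move=> du; rewrite /cauchy_int -disc_intZ; last exact: cauchy_int_integrable.
  rewrite -[RHS]add0r -(int0 n) -disc_intD; first last.
  - by apply: cintegrableZ; exact: cauchy_int_integrable.
  - exact: taylor_integrable.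
  apply: eq_disc_int => z dz; have n0 := disc_denom_neq0 du dz.
  by rewrite [_ ^+ n.+1]exprS expr1; field.
have it u n : disc u -> cauchy_int f 1 0 u = u ^+ n * cauchy_int f 1 n u.
  move=> du; elim: n => [|n ->]; first by rewrite expr0 mul1r.
  by rewrite exprSr -mulrA -step.
have A0 u : disc u -> cauchy_int f 1 0 u = 0.
  move=> du; apply/eqP; rewrite -normc_eq0 eq_le normc_ge0 andbT.
  have [v iv hv] := a1; have u0 : 0 < 1 - normc u by rewrite subr_gt0 -discE.
  apply: (@le0_geometric _ (normc u) (2 * rint (fun z => (1 - normc u)^-1 * v z))).
    by rewrite normc_ge0 -discE.
  move=> n; rewrite (it u n du) normcM normcX ler_wpM2l ?exprn_ge0 ?normc_ge0 //.
  apply: normc_disc_int; [exact: cauchy_int_integrable|exact: rintegrableZ|].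
  move=> z dz; rewrite normcM mulrC ler_pM ?normc_ge0 ?hv //.
  rewrite normcM -[leRHS]mul1r ler_pM ?normc_ge0 ?normc_conjX //.
  by have := cauchy_bound 1 du dz; rewrite !expr1.
move=> dw; have B0 : cauchy_int f 2 1 w = 0.
  have h := cauchy_int_chol 1 0 a1 cf dw; rewrite mul1r in h.
  apply: (chol_unique h); apply: (chol_disc (f := fun=> 0) dw) => [u /A0 //|].
  move=> e e0; exists 1 => // k _.
  by rewrite mul0r !subr0 normc0 mulr_ge0 ?normc_ge0 // ltW.
rewrite (bergman_cauchy_int hf' a1 dw).
transitivity (cauchy_int f 1 0 w + w * cauchy_int f 2 1 w); last by rewrite A0 // B0 mulr0 addr0.
rewrite /cauchy_int -disc_intZ; last exact: cauchy_int_integrable.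
rewrite -disc_intD; [|exact: cauchy_int_integrable|apply: cintegrableZ; exact: cauchy_int_integrable].
apply: eq_disc_int => z dz; have n0 := disc_denom_neq0 dw dz.
by rewrite expr0 !expr1; field.
Qed.

Lemma bergman1_polynomial f N w : bergman1 f ->
  (forall n, (N <= n)%N -> taylor n f = 0) -> disc w ->
  f w = (\poly_(i < N) taylor i f).[w].
Proof.
move=> hf h dw; set P := \poly_(i < N) _; apply/eqP; rewrite -subr_eq0; apply/eqP.
have hP := bergman1_poly P.
apply: (@taylor_eq0 (fun z => f z - P.[z])) => // [|n]; first exact: bergman1B.
rewrite taylorB // taylor_poly coef_poly; case: ltnP => hn; first by rewrite subrr.
by rewrite h // subr0.
Qed.

(** Differentiate the Bergman formula under the integral sign. The function [f]
    may take arbitrary values outside the disc, as kernels do. *)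
Lemma derive1n_taylor f g n : bergman1 g -> (forall z, disc z -> f z = g z) ->
  derive1n n (f : C^o -> C^o) 0 = n`!%:R * taylor n g.
Proof.
move=> [a1 [g' hg]] fg; have cg z : disc z -> ccont g z by move=> /hg /hol_ccont.
have key m z : disc z ->
    derive1n m (f : C^o -> C^o) z = (m.+1)`!%:R * cauchy_int g m.+2 m z.
  elim: m z => [|m IH] z dz.
    by rewrite derive1n0 factS fact0 muln1 mul1r fg // (bergman_cauchy_int hg a1 dz).
  rewrite derive1nS; apply: chol_derive1.
  apply: (chol_disc (f := fun u => (m.+1)`!%:R * cauchy_int g m.+2 m u) dz) => [u du|].
    by rewrite IH.
  have h := cauchy_int_chol m.+2 m a1 cg dz.
  rewrite [(m.+2)`!]factS natrM (mulrC m.+2%:R) -mulrA.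
  move=> e e0; have c0 : (0 : R) < (m.+1)`!%:R by rewrite ltr0n fact_gt0.
  have [d d0 hd] := h _ (divr_gt0 e0 c0); exists d => // k /hd hk.
  rewrite -mulrBr -mulrA -mulrBr normcM normc_nat.
  by rewrite -ler_pdivlMl // mulrA (mulrC _^-1).
have d0 : disc (0 : C) by rewrite discE normc0.
rewrite key // factS mulnC natrM -mulrA; congr (_ * (_ * _)).
by apply: eq_disc_int => z _; rewrite mul0r subr0 expr1n invr1 mulr1.
Qed.

End PowerSeries.

(** * Reciprocal polynomials and truncation *)

Section Reciprocal.
Variable R : realType.
Local Notation C := R[i].
Local Notation "x ^*" := (conjc x) : ring_scope.
Implicit Types (P Q : {poly C}) (f : C -> C).

(** With [n] the degree of [Q], this is [z ^+ n * (Q.[1 / z^* ])^*]. *)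
Definition recip n Q : {poly C} := \poly_(l < n.+1) (Q`_(n - l))^*.

(** Multiplying by [X - b] adds to the coefficients the shifted ones times [- b];
    after reversal and conjugation this is the multiplication by [1 - b^* X]. *)
Lemma recip_prod (I : Type) (r : seq I) (b : I -> C) :
  recip (size r) (\prod_(j <- r) ('X - (b j)%:P)) =
  \prod_(j <- r) (1 - ((b j)^*)%:P * 'X).
Proof.
elim: r => [|j r IH].
  rewrite !big_nil; apply/polyP => i; rewrite coef_poly !coef1 sub0n /=.
  by case: i => [|i] //=; exact: conjc1.
rewrite !big_cons -IH; set Q := \prod_(i <- r) _; set m := size r.
have sQ : (size Q <= m.+1)%N by rewrite size_prod_XsubC.
apply/polyP => l; rewrite !mulrBl mul1r coefB -mulrA coefCM coefXM !coef_poly /=.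
rewrite -/m; case: l => [|l] /=.
  rewrite !subn0 mulr0 subr0 coefB coefXM coefCM /= [Q`_m.+1]nth_default //.
  by rewrite mulr0 subr0.
have -> : (l.+1 < m.+2)%N = (l <= m)%N by [].
have -> : (l.+1 < m.+1)%N = (l < m)%N by [].
have -> : (l < m.+1)%N = (l <= m)%N by [].
rewrite subSS; have [lm|lm] := ltnP m l; first by rewrite ltnNge (ltnW lm) /= mulr0 subr0.
rewrite coefB coefXM coefCM (rmorphB conjc) /= conjc_mul.
have [->|lm'] := eqVneq l m; first by rewrite subnn ltnn eqxx (rmorph0 conjc).
have lm2 : (l < m)%N by rewrite ltn_neqAle lm'.
by rewrite lm2 subn_eq0 leqNgt lm2 /= -subnS.
Qed.

Lemma size_mulXn_leq P d m : (size P <= d)%N -> (size (P * 'X^m)%R <= m + d)%N.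
Proof.
move=> sP; apply: leq_trans (size_polyMleq _ _) _.
by rewrite size_polyXn addnS /= addnC leq_add2l.
Qed.

Lemma coef_recip Q d m i : (size Q <= d.+1)%N -> (i <= m + d)%N ->
  (recip d Q)`_(m + d - i) = ((Q * 'X^m)`_i)^*.
Proof.
move=> sQ im; rewrite coef_poly coefMXn; have [h|h] := ltnP i m.
  by rewrite ltnNge (_ : (d < m + d - i)%N) ?conjc0 //; lia.
by rewrite (_ : (m + d - i < d.+1)%N); [congr ((Q`_ _)^* ); lia|lia].
Qed.

Lemma horner_conj P (w : C) : (map_poly conjc P).[w] = (P.[w^*])^*.
Proof. by rewrite -[in LHS](conjcK w); exact: (horner_map conjc P w^*). Qed.

Lemma horner_take n P (z : C) : (take_poly n P).[z] = \sum_(l < n) P`_l * z ^+ l.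
Proof. exact: horner_poly. Qed.

(** Both sides are the truncation of the convolution of the coefficients of [f]
    with those of [Q]. *)
Lemma taylor_truncation n Q f : bergman1 f ->
  \sum_(k < n) taylor k f *: take_poly n ('X^k * Q) =
  \poly_(i < n) taylor i (fun z => Q.[z] * f z).
Proof.
move=> hf; apply/polyP => i; rewrite coef_sum coef_poly.
have [hi|hi] := ltnP i n; last first.
  by rewrite big1 // => k _; rewrite coefZ coef_take_poly ltnNge hi mulr0.
rewrite taylor_horner_mul //.
rewrite [RHS](reindex_inj rev_ord_inj) /= [RHS](big_ord_widen n
  (fun k => Q`_(i.+1 - k.+1) * taylor (i - (i.+1 - k.+1)) f)) // [RHS]big_mkcond /=.
apply: eq_bigr => k _; rewrite coefZ coef_take_poly hi -commr_polyXn coefMXn ltnS.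
case: (ltnP i k) => hk; first by rewrite mulr0.
by rewrite mulrC subSS subKn.
Qed.

Lemma taylor_truncation_poly n Q G f : bergman1 f ->
  (forall z, disc z -> Q.[z] * f z = G.[z]) ->
  \sum_(k < n) taylor k f *: take_poly n ('X^k * Q) = take_poly n G.
Proof.
move=> hf h; rewrite taylor_truncation //; apply/polyP => i.
by rewrite coef_poly coef_take_poly (eq_taylor i h) taylor_poly.
Qed.

Lemma disc_int_deriv_conj N P f : bergman1 f -> (size P <= N.+1)%N ->
  disc_int (fun z => f z * (P^`().[z])^*) = \sum_(i < N) (P`_i.+1)^* * taylor i f.
Proof.
move=> hf sP; have sP' : (size P^`() <= N)%N.
  have [->|P0] := eqVneq P 0; first by rewrite deriv0 size_poly0.
  by rewrite -ltnS (leq_trans (lt_size_deriv P0)).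
have ic i : cintegrable (fun z => f z * z^* ^+ i).
  by apply: taylor_integrable hf.1 _ => z dz; exact: bergman1_ccont.
rewrite (eq_disc_int (g := fun z => \sum_(i < N) (P^`()`_i)^* * (f z * z^* ^+ i))).
  rewrite disc_int_sum => [|i]; last exact: cintegrableZ.
  apply: eq_bigr => i _; rewrite disc_intZ // /taylor coef_deriv mulrA.
  by congr (_ * _); rewrite -(mulr_natr P`_i.+1) conjc_mul; congr (_ * _); exact: rmorph_nat.
move=> z _; rewrite (horner_coef_wide z sP') (rmorph_sum conjc) mulr_sumr /=.
by apply: eq_bigr => i _; rewrite conjc_mul (rmorphXn conjc) mulrCA.
Qed.

(** Reversing the order of the coefficients turns the convolution into the
    pairing of [f] with [P X^m]; the factor [i + 1] of the Taylor coefficient is the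
    one produced by the derivative. *)
Lemma taylor_recip d m P f : bergman1 f -> (size P <= d.+2)%N ->
  taylor (m + d) (fun z => (recip d.+1 P).[z] * f z) =
  disc_int (fun z => f z * ((P * 'X^m)^`().[z])^*).
Proof.
move=> hf sP; rewrite (@disc_int_deriv_conj (m + d).+1) //; last first.
  by rewrite -!addnS; exact: size_mulXn_leq.
rewrite taylor_horner_mul // (reindex_inj rev_ord_inj) /=.
apply: eq_bigr => i _; have hi := ltn_ord i.
have := @coef_recip P d.+1 m i.+1 sP; rewrite addnS ltnS subSS => <- //.
rewrite ltnS in hi; congr (_ * taylor _ f); last by lia.
Qed.

Lemma taylor_recip_geometric d m P (u : C) : disc u -> (size P <= d.+1)%N ->
  taylor (m + d) (fun z => (recip d P).[z] * (1 - u * z)^-1) = ((P * 'X^m).[u^*])^*.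
Proof.
move=> du sP; rewrite taylor_horner_mul; last exact: bergman1_geometric.
rewrite (@horner_coef_wide _ (m + d).+1); last first.
  by rewrite -addnS; exact: size_mulXn_leq.
rewrite (reindex_inj rev_ord_inj) /= (rmorph_sum conjc) /=.
apply: eq_bigr => i _; have hi := ltn_ord i; rewrite ltnS in hi.
rewrite subSS coef_recip // subKn // taylor_geometric //.
by rewrite conjc_mul (rmorphXn conjc) /= conjcK.
Qed.

Lemma disc_int_geometric_sqr P (u : C) : disc u ->
  disc_int (fun z => ((1 - u * z)^-1 * (1 - u * z)^-1) * (P^`().[z])^*) =
  (P^`().[u^*])^*.
Proof.
move=> du; have hf := bergman1_geometric_mul du (bergman1_geometric du).
rewrite (disc_int_deriv_conj hf (leqnSn _)).
have sP' : (size P^`() <= size P)%N.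
  have [->|P0] := eqVneq P 0; first by rewrite deriv0 size_poly0.
  by rewrite ltnW // lt_size_deriv.
rewrite (horner_coef_wide _ sP') (rmorph_sum conjc) /=.
apply: eq_bigr => i _; rewrite taylor_geometric_sqr // coef_deriv -(mulr_natr P`_i.+1).
have nE : (i.+1%:R : C)^* = i.+1%:R by exact: rmorph_nat.
by rewrite !conjc_mul (rmorphXn conjc) nE /= conjcK mulrA.
Qed.

End Reciprocal.

Section NodePolynomials.
Variable R : realType.
Local Notation C := R[i].
Local Notation "x ^*" := (conjc x) : ring_scope.
Variables (s : nat) (a : 'I_s -> C).

Definition qrecip : {poly C} := \prod_(k < s) (1 - ((a k)^*)%:P * 'X).
Definition qrecip_omit (k : 'I_s) : {poly C} :=
  \prod_(j < s | j != k) (1 - ((a j)^*)%:P * 'X).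

Lemma size_index_ord : size (index_enum 'I_s) = s.
Proof. by have := card_ord s; rewrite cardE size_filter count_predT. Qed.

Lemma qrecipE : qrecip = recip s (Defs.qpoly a).
Proof.
rewrite /qrecip /Defs.qpoly -recip_prod; congr (recip _ _).
by rewrite size_index_ord.
Qed.

Lemma size_qpoly : size (Defs.qpoly a) = s.+1.
Proof. by rewrite size_prod_XsubC size_index_ord. Qed.

Lemma size_filter_omit (k : 'I_s) : size [seq j <- index_enum 'I_s | j != k] = s.-1.
Proof.
have h := cardC1 k; rewrite card_ord in h; rewrite -h cardE size_filter.
by [].
Qed.

Lemma qrecip_omitE (k : 'I_s) : qrecip_omit k = recip s.-1 (qpoly_omit a k).
Proof.
rewrite /qrecip_omit /qpoly_omit -!(big_filter (index_enum _)) -recip_prod.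
by rewrite size_filter_omit.
Qed.

Lemma size_qpoly_omit (k : 'I_s) : (size (qpoly_omit a k) <= s.-1.+1)%N.
Proof. by rewrite /qpoly_omit -big_filter size_prod_XsubC size_filter_omit. Qed.

Lemma qpoly_split (k : 'I_s) : Defs.qpoly a = ('X - (a k)%:P) * qpoly_omit a k.
Proof. by rewrite /Defs.qpoly (bigD1 k). Qed.

Lemma qrecip_split (k : 'I_s) : qrecip = (1 - ((a k)^*)%:P * 'X) * qrecip_omit k.
Proof. by rewrite /qrecip (bigD1 k). Qed.

Lemma horner_linear_recip (b z : C) : (1 - b%:P * 'X).[z] = 1 - b * z.
Proof. by rewrite !hornerE. Qed.

Lemma horner_qrecip z : qrecip.[z] = qstar a z.
Proof. by rewrite horner_prod; apply: eq_bigr => k _; rewrite horner_linear_recip. Qed.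

Lemma horner_Tterm k z : (take_poly s.-1 ('X^k * qrecip)).[z] = Tterm a k z.
Proof.
rewrite -commr_polyXn take_polyMXn hornerM hornerXn horner_take mulrC.
congr (_ * _); apply: eq_bigr => l _; congr (_ * _).
by rewrite qrecipE coef_poly (_ : (l < s.+1)%N) //; have := ltn_ord l; lia.
Qed.

(** The polynomials of which [Lterm] is the diagonal sum: the analogue of [Tterm]
    for [qrecip_omit]. *)
Definition Qterm (m : 'I_s) k : {poly C} := take_poly s.-1 ('X^k * qrecip_omit m).

Lemma horner_Qterm m k z :
  (Qterm m k).[z] = z ^+ k * \sum_(l < s.-1 - k) ((qpoly_omit a m)`_(s.-1 - l))^* * z ^+ l.
Proof.
rewrite /Qterm -commr_polyXn take_polyMXn hornerM hornerXn horner_take mulrC.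
congr (_ * _); apply: eq_bigr => l _; congr (_ * _).
by rewrite qrecip_omitE coef_poly (_ : (l < s.-1.+1)%N) //; have := ltn_ord l; lia.
Qed.

Lemma LtermE m z w : Lterm a m z w = \sum_(r < s.-1) (Qterm m r).[z] * ((Qterm m r).[w])^*.
Proof.
apply: eq_bigr => r _; rewrite !horner_Qterm; congr (_ * _).
rewrite conjc_mul (rmorphXn conjc) (rmorph_sum conjc) /=; congr (_ * _).
by apply: eq_bigr => l _; rewrite conjc_mul conjcK (rmorphXn conjc).
Qed.

End NodePolynomials.

(** * The reproducing kernel *)

Section Interpolation.
Variable F : numFieldType.

(** The shift by 2 puts the nodes inside the unit disc. *)
Definition node (i : nat) : F := i.+2%:R^-1.

Lemma node_inj : injective node.
Proof. by move=> i j /invr_inj /eqP; rewrite eqr_nat => /eqP[]. Qed.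

(** Invert the Vandermonde matrix of the nodes. *)
Lemma interpolation n : exists c : nat -> nat -> F, forall P : {poly F},
  (size P <= n)%N -> forall l, (l < n)%N -> P`_l = \sum_(i < n) c i l * P.[node i].
Proof.
pose x : 'rV[F]_n := \row_i node i; pose V := Vandermonde n x.
have uV : V \in unitmx.
  rewrite unitmxE unitfE det_Vandermonde; apply/prodf_neq0 => i _.
  apply/prodf_neq0 => j ij; rewrite !mxE subr_eq0; apply/eqP => /node_inj h.
  by rewrite h ltnn in ij.
have [n0|n0] := posnP n; first by exists (fun _ _ => 0) => P _ l; rewrite n0.
exists (fun i l => invmx V (insubd (Ordinal n0) i) (insubd (Ordinal n0) l)) => P sP l ln.
pose r : 'rV[F]_n := \row_i P`_i.
have E : r *m V = \row_i P.[node i].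
  apply/rowP => i; rewrite !mxE (horner_coef_wide _ sP).
  by apply: eq_bigr => k _; rewrite !mxE.
have -> : P`_l = r 0 (Ordinal ln) by rewrite mxE.
rewrite -[r](mulmxK uV) E mxE; apply: eq_bigr => i _; rewrite mxE mulrC; congr (_ * _).
congr (invmx V _ _); apply: val_inj; rewrite val_insubd ?ltn_ord // ln //.
Qed.

End Interpolation.

Section Kernel.
Variable R : realType.
Local Notation C := R[i].
Local Notation "x ^*" := (conjc x) : ring_scope.
Variables (s : nat) (a : 'I_s -> C) (p : 'I_s -> R) (K : C -> C -> C).
Hypotheses (s0 : (1 <= s)%N) (ha : forall k, disc (a k)) (inj_a : injective a)
  (hp : forall k, - 2 < p k) (hK : reproducing_kernel (weight a p) K).
Local Notation w := (weight a p).
Local Notation pc := (pcoef a p).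
Local Notation n := s.-1.

Lemma conjc_inv (u : C) : (u^-1)^* = (u^*)^-1.
Proof. exact: fmorphV. Qed.

Lemma conjc_onem (u : C) : (1 - u)^* = 1 - u^*.
Proof. by rewrite (rmorphB conjc) (rmorph1 conjc). Qed.

Lemma pcoef_conj k : (pc k)^* = pc k.
Proof. exact: conjc_rc. Qed.

Lemma kernel_space z : disc z -> bergman_space w (fun x => (K z x)^*).
Proof. by case: hK => _ _ h _ /h. Qed.

Lemma kernel_hol z : disc z -> exists f', hol_disc (fun x => (K z x)^*) f'.
Proof. by move=> /kernel_space[af _]; exact: analytic_hol. Qed.

Lemma kernel_bergman1 z : disc z -> bergman1 (fun x => (K z x)^*).
Proof.
move=> dz; have [f' hf] := kernel_hol dz; split; last by exists f'.
exact: (weight_space_A1 ha hf (kernel_space dz)).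
Qed.

Lemma kernel_mul_integrable z f : disc z -> bergman_space w f ->
  cintegrable (fun x => f x * K z x * (w x)%:C).
Proof.
move=> dz f2; have [f' hf] := analytic_hol f2.1; have [g' hg] := kernel_hol dz.
apply: (weighted_mul_integrable ha hf f2).
  move=> x dx; rewrite -[K z](_ : (fun x => ((K z x)^*)^*) = _).
    by apply: ccont_conj; exact: hol_ccont (hg x dx).
  by apply/funext => u; rewrite conjcK.
apply: eq_rintegrable (sqr_weight_integrable ha hg (kernel_space dz)) => x _.
by rewrite normc_conj.
Qed.

(** Apply the reproducing property at [x] to the representer of [z], and
    conversely: the two integrals are conjugate. *)
Lemma kernel_sym z x : disc z -> disc x -> K z x = (K x z)^*.
Proof.
case: hK => _ _ _ rep dz dx.
have h1 := rep _ (kernel_space dx) z dz; have h2 := rep _ (kernel_space dz) x dx.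
rewrite h1 -[LHS]conjcK h2 -disc_int_conj; last exact: kernel_mul_integrable (kernel_space dz).
by apply: eq_disc_int => u _; rewrite !conjc_mul conjcK conjc_rc mulrAC [in RHS](mulrC _ (K z u)) mulrAC.
Qed.

Section Moments.
Variable m : nat.
Local Notation P := (Defs.qpoly a * 'X^m).

(** The holomorphic extension of [P] times the logarithmic derivative of the
    weight, for [P = q X^m]. *)
Definition dlog_part (z : C) : C :=
  \sum_(k < s) pc k * (((qpoly_omit a k * 'X^m).[z]) * (1 - (a k)^* * z)^-1).

Lemma dlog_part_bhol : bhol dlog_part.
Proof.
apply: bhol_sum => k; apply: bholM; first exact: bhol_cst.
by apply: bholM; [exact: bhol_horner|apply: bhol_geometric; exact: disc_conj].
Qed.

Lemma dlog_partE z : disc z -> z \notin codom a -> P.[z] * weight_dlog a p z = dlog_part z.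
Proof.
move=> dz za; rewrite mulr_sumr; apply: eq_bigr => k _.
have zk : z - a k != 0.
  by rewrite subr_eq0; apply: contra za => /eqP ->; exact: codom_f.
have dk := denom_neq0 (ha k) dz.
rewrite (qpoly_split a k) !hornerM hornerXsubC /blaschke_dlog /pcoef (rmorphM (real_complex R)) /=.
by field; rewrite zk dk.
Qed.

(** Reproduce the function [P' + dlog_part], then remove the weight by
    [weighted_stokes]. *)
Lemma kernel_moment z : disc z ->
  disc_int (fun x => (K z x)^* * (P^`().[x])^*) = (P^`().[z] + dlog_part z)^*.
Proof.
move=> dz; have [f' hf] := kernel_hol dz.
have bG := dlog_part_bhol; have bP := bhol_horner P; have bP' := bhol_horner P^`().
have bF := bholD bP' bG.
have F2 : bergman_space w (fun x => P^`().[x] + dlog_part x).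
  have [[g' hg] [B B0 hB]] := bF.
  apply: (bounded_in_space ha inj_a hp hg _ hB) => u du.
  apply: chol_derivable; apply: (hol_disc_chol hg _ du).
  exact: A1_bounded hB.
case: hK => _ _ _ rep; rewrite (rep _ F2 z dz) -disc_int_conj; last exact: kernel_mul_integrable.
have [_ [B1 B10 hB1]] := bP; have [_ [B2 B20 hB2]] := bP'; have [[G' hG] [B3 B30 hB3]] := bG.
rewrite -(@weighted_stokes R s a p ha inj_a hp _ f' _ _ dlog_part (B1 + B2 + B3) hf (kernel_space dz)
   (horner_hol_disc P)).
- by apply: eq_disc_int => u _; rewrite !conjc_mul conjc_rc [_ * (K z u)^*]mulrC.
- by move=> u du; exact: hol_ccont (hG u du).
- by rewrite !addr_ge0.
- by move=> u du; have := hB1 u du; have := hB2 u du; have := hB3 u du; split; lra.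
- exact: dlog_partE.
Qed.

End Moments.

(** The part of the kernel given by the first two terms of the formula. *)
Definition kernel0 (z x : C) : C :=
  (1 - x^* * z)^-1 * (1 - x^* * z)^-1 +
  \sum_(k < s) pc k * (1 - a k * x^*)^-1 * ((1 - (a k)^* * z)^-1 * (1 - x^* * z)^-1).

Lemma kernel0_sym z x : kernel0 z x = (kernel0 x z)^*.
Proof.
have E (u v : C) : ((1 - u^* * v)^-1)^* = (1 - v^* * u)^-1.
  by rewrite conjc_inv conjc_onem conjc_mul conjcK mulrC.
rewrite /kernel0 (rmorphD conjc) /= conjc_mul !E; congr (_ + _).
rewrite (rmorph_sum conjc); apply: eq_bigr => k _ /=.
rewrite !conjc_mul pcoef_conj !E -[a k * z^*]mulrC E [a k * x^*]mulrC.
by rewrite -!mulrA; congr (_ * _); ring.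
Qed.

Lemma kernel0_bhol x : disc x -> bhol (fun z => kernel0 z x).
Proof.
move=> dx; have hx := bhol_geometric (disc_conj dx).
apply: bholD; first exact: bholM.
apply: bhol_sum => k; apply: bholM; first exact: bhol_cst.
by apply: bholM hx; apply: bhol_geometric; exact: disc_conj.
Qed.

(** Multiplying by [qrecip] cancels the factor [1 - (a k)^* z] of the k-th term. *)
Lemma kernel0_qrecip z x : disc z -> disc x -> (qrecip a).[z] * kernel0 z x =
  (qrecip a).[z] * ((1 - x^* * z)^-1 * (1 - x^* * z)^-1) +
  \sum_(k < s) pc k * (1 - a k * x^*)^-1 * ((qrecip_omit a k).[z] * (1 - x^* * z)^-1).
Proof.
move=> dz dx; rewrite mulrDr; congr (_ + _); rewrite mulr_sumr; apply: eq_bigr => k _.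
rewrite (qrecip_split a k) hornerM horner_linear_recip.
have n0 := geometric_neq0 (disc_conj (ha k)) dz.
set c := _ / (1 - a k * _); set d := (1 - x^* * z)^-1; set u := 1 - _ in n0 *.
transitivity (u * u^-1 * (c * ((qrecip_omit a k).[z] * d))); first by ring.
by rewrite divff // mul1r.
Qed.

Lemma taylor_kernel0 m z : disc z ->
  taylor (m + n) (fun x => (qrecip a).[x] * kernel0 x z) =
  ((Defs.qpoly a * 'X^m)^`().[z] + dlog_part m z)^*.
Proof.
move=> dz; have dz' := disc_conj dz; have sn : n.+1 = s by rewrite prednK.
have b0 := bergman1_geometric dz'; have b1 := bergman1_geometric_mul dz' b0.
have bq := bergman1_horner (qrecip a) b1.
have bk k := bergman1Z (pc k * (1 - a k * z^*)^-1) (bergman1_horner (qrecip_omit a k) b0).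
rewrite (eq_taylor (m + n) (fun x dx => kernel0_qrecip dx dz)).
rewrite taylorD //; last exact: bergman1_sum.
rewrite taylor_sum // (rmorphD conjc); congr (_ + _).
  rewrite qrecipE -[in recip s]sn taylor_recip ?size_qpoly ?sn //.
  by rewrite disc_int_geometric_sqr // conjcK.
rewrite (rmorph_sum conjc) /=; apply: eq_bigr => k _.
rewrite taylorZ; last exact: bergman1_horner.
rewrite qrecip_omitE taylor_recip_geometric ?size_qpoly_omit // conjcK !conjc_mul pcoef_conj.
rewrite -mulrA; congr (_ * _); rewrite mulrC; congr (_ * _).
by rewrite conjc_inv conjc_onem conjc_mul conjcK.
Qed.

(** What remains to be identified: the third term of the formula. *)
Definition kernel1 (z x : C) : C := K z x - kernel0 z x.

Lemma kernel1_sym z x : disc z -> disc x -> kernel1 z x = (kernel1 x z)^*.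
Proof. by move=> dz dx; rewrite /kernel1 (rmorphB conjc) /= -kernel_sym // -kernel0_sym. Qed.

Lemma kernel1_bergman1 x : disc x -> bergman1 (fun z => kernel1 z x).
Proof.
move=> dx; apply: bergman1B; last exact: bhol_bergman1 (kernel0_bhol dx).
by apply: eq_bergman1 (kernel_bergman1 dx) => z dz; rewrite -kernel_sym.
Qed.

(** All high moments of the two kernels agree, so only a polynomial is left. *)
Lemma kernel1_poly x : disc x -> exists2 G : {poly C}, (size G <= n)%N &
  forall z, disc z -> (qrecip a).[z] * kernel1 z x = G.[z].
Proof.
move=> dx; have sn : n.+1 = s by rewrite prednK.
have b1 := bergman1_horner (qrecip a) (kernel1_bergman1 dx).
exists (\poly_(i < n) taylor i (fun z => (qrecip a).[z] * kernel1 z x)).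
  exact: size_poly.
move=> z dz; apply: (bergman1_polynomial b1) => // i ni.
have -> : i = (i - n + n)%N by rewrite subnK.
have bK := bergman1_horner (qrecip a) (kernel_bergman1 dx).
have b0 := bergman1_horner (qrecip a) (bhol_bergman1 (kernel0_bhol dx)).
rewrite (eq_taylor (g := fun z => (qrecip a).[z] * (K x z)^* - (qrecip a).[z] * kernel0 z x)).
  rewrite taylorB // taylor_kernel0 // qrecipE -[in recip s]sn.
  rewrite taylor_recip ?size_qpoly ?sn //; last exact: kernel_bergman1.
  by rewrite kernel_moment // subrr.
by move=> u du; rewrite -mulrBr -kernel_sym.
Qed.

(** Rational functions with denominator [qrecip] and bounded degree. Being linear,
    this property passes from the sections of [kernel1] to its Taylor
    coefficients in the other variable. *)
Definition polar f := bergman1 f /\ exists2 G : {poly C}, (size G <= n)%N &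
  forall z, disc z -> (qrecip a).[z] * f z = G.[z].

Lemma polar_kernel1 x : disc x -> polar (fun z => kernel1 z x).
Proof. by move=> dx; split; [exact: kernel1_bergman1|exact: kernel1_poly]. Qed.

Lemma polar_sum (m : nat) (c : nat -> C) (F : nat -> C -> C) :
  (forall i, (i < m)%N -> polar (F i)) -> polar (fun z => \sum_(i < m) c i * F i z).
Proof.
elim: m => [_|m IH hF].
  split; first by apply: eq_bergman1 (bergman1_cst 0) => z _; rewrite big_ord0.
  by exists 0 => [|z _]; rewrite ?size_poly0 // big_ord0 mulr0 horner0.
have [b1 [G1 s1 h1]] := IH (fun i hi => hF i (leqW hi)); have [b2 [G2 s2 h2]] := hF m (ltnSn m).
split; first by apply: eq_bergman1 (bergman1D b1 (bergman1Z (c m) b2)) => z _; rewrite big_ord_recr.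
exists (G1 + c m *: G2) => [|z dz].
  rewrite (leq_trans (size_polyD _ _)) // geq_max s1 /=.
  exact: leq_trans (size_scale_leq _ _) s2.
by rewrite big_ord_recr /= mulrDr h1 // mulrCA h2 // !hornerE.
Qed.

(** Truncation leaves [qrecip * f] unchanged. *)
Lemma polar_expand f z : polar f -> disc z ->
  (qrecip a).[z] * f z = \sum_(k < n) taylor k f * Tterm a k z.
Proof.
move=> [b1 [G sG hG]] dz; rewrite hG // -(take_poly_id sG).
rewrite -(taylor_truncation_poly n b1 hG) horner_sum.
by apply: eq_bigr => k _; rewrite hornerZ horner_Tterm.
Qed.

(** The denominator of the formula in the variable [x^*], as a polynomial. *)
Definition qconj : {poly C} := map_poly conjc (qrecip a).

Lemma horner_qconj (x : C) : qconj.[x] = (qstar a x^*)^*.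
Proof. by rewrite horner_conj horner_qrecip. Qed.

Lemma qconj_prod (x : C) : qconj.[x] = \prod_(k < s) (1 - a k * x).
Proof.
rewrite horner_qconj /qstar (rmorph_prod conjc); apply: eq_bigr => k _ /=.
by rewrite conjc_onem conjc_mul !conjcK.
Qed.

Lemma qconj_neq0 x : disc x -> qconj.[x] != 0.
Proof.
by move=> dx; rewrite qconj_prod; apply/prodf_neq0 => k _; exact: geometric_neq0.
Qed.

Lemma qconj_inv_bhol : bhol (fun x => qconj.[x]^-1).
Proof.
have h := bhol_prod (index_enum 'I_s) (fun k => bhol_geometric (ha k)).
by apply: bhol_eq h => x; rewrite qconj_prod prodfV.
Qed.

Lemma kernel1_poly_conj z : disc z -> exists2 G : {poly C}, (size G <= n)%N &
  forall x, disc x -> qconj.[x] * kernel1 z x^* = G.[x].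
Proof.
move=> dz; have [G sG hG] := kernel1_poly dz; exists (map_poly conjc G).
  by rewrite size_map_inj_poly ?rmorph0 //; exact: (can_inj (@conjcK R)).
move=> x dx; have dx' := disc_conj dx; rewrite [RHS]horner_conj -hG // conjc_mul -kernel1_sym //.
by rewrite horner_qconj horner_qrecip.
Qed.

(** As a function of [x^*], [kernel1 z x] is a polynomial of bounded degree divided
    by [qconj]. Interpolation at fixed nodes [x_i] expresses its Taylor coefficients
    as combinations of the [kernel1 z x_i] with coefficients independent of [z];
    in this way they are seen to be [polar] in [z]. *)
Lemma kernel1_taylor : exists d : nat -> C -> C, (forall j, polar (d j)) /\
  forall z, disc z -> bergman1 (fun x => kernel1 z x^*) /\
    forall j, taylor j (fun x => kernel1 z x^*) = d j z.
Proof.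
have [c hc] := interpolation R[i] n; pose nd i : C := node R[i] i.
have dnd i : disc (nd i)^*.
  apply: disc_conj; rewrite discE normcV normc_nat invf_lt1 ?ltr1n //.
pose g l z := \sum_(i < n) (c i l * qconj.[nd i]) * kernel1 z (nd i)^*.
have pg l : polar (g l).
  apply: (@polar_sum n (fun i => c i l * qconj.[nd i]) (fun i z => kernel1 z (nd i)^*)).
  by move=> i _; exact: polar_kernel1.
pose b l x := 'X^l.[x] * qconj.[x]^-1.
have hb l : bhol (b l) by apply: bholM; [exact: bhol_horner|exact: qconj_inv_bhol].
exists (fun j z => \sum_(l < n) taylor j (b l) * g l z); split.
  by move=> j; apply: (@polar_sum n (fun l => taylor j (b l)) g) => l _.
move=> z dz; have [G sG hG] := kernel1_poly_conj dz.
have E x : disc x -> \sum_(l < n) g l z * b l x = kernel1 z x^*.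
  move=> dx; have n0 := qconj_neq0 dx.
  apply: (mulfI n0); rewrite hG // (horner_coef_wide _ sG) mulr_sumr.
  apply: eq_bigr => l _; rewrite (hc G sG l (ltn_ord l)) /b hornerXn.
  rewrite mulrCA [x ^+ l * _]mulrC mulVKf //; congr (_ * _).
  apply: eq_bigr => i _; rewrite -mulrA hG //.
  by have := disc_conj (dnd i); rewrite conjcK.
have hgb l : bergman1 (fun x => g l z * b l x) by apply: bergman1Z; exact: bhol_bergman1.
split; first exact: eq_bergman1 E (bergman1_sum _ (fun l : 'I_n => hgb l)).
move=> j; rewrite -(eq_taylor j E) taylor_sum => [|l]; last exact: hgb.
by apply: eq_bigr => l _; rewrite taylorZ; [rewrite mulrC|exact: bhol_bergman1].
Qed.

Definition kernel0_taylor (j : nat) (z : C) : C := j.+1%:R * z ^+ j +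
  \sum_(k < s) pc k * (1 - (a k)^* * z)^-1 * \sum_(l < j.+1) z ^+ l * a k ^+ (j - l).

Lemma kernel0_taylorE j z : disc z ->
  bergman1 (fun x => kernel0 z x^*) /\
  taylor j (fun x => kernel0 z x^*) = kernel0_taylor j z.
Proof.
move=> dz.
pose F x := (1 - z * x)^-1 * (1 - z * x)^-1 +
  \sum_(k < s) pc k * (1 - (a k)^* * z)^-1 * ((1 - z * x)^-1 * (1 - a k * x)^-1).
have E x : F x = kernel0 z x^*.
  rewrite /kernel0 conjcK [x * z]mulrC; congr (_ + _); apply: eq_bigr => k _.
  by rewrite -!mulrA; congr (_ * _); ring.
have b0 := bergman1_geometric_mul dz (bergman1_geometric dz).
have bk k := bergman1_geometric_mul dz (bergman1_geometric (ha k)).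
have bz k := bergman1Z (pc k * (1 - (a k)^* * z)^-1) (bk k).
split.
  by apply: (eq_bergman1 (f := F)) => [x _|]; [exact: E|apply: bergman1D b0 (bergman1_sum _ bz)].
rewrite -(eq_taylor j (fun x _ => E x)) taylorD //; last exact: bergman1_sum.
rewrite taylor_geometric_sqr // taylor_sum //; congr (_ + _).
by apply: eq_bigr => k _; rewrite taylorZ // taylor_geometric2.
Qed.

Lemma kernel0_taylor_bhol j : bhol (kernel0_taylor j).
Proof.
apply: bholD.
  by apply: bholM; [exact: bhol_cst|apply: bhol_eq (bhol_horner 'X^j) => z; rewrite hornerXn].
apply: bhol_sum => k; apply: bholM.
  by apply: bholM; [exact: bhol_cst|apply: bhol_geometric; exact: disc_conj].
apply: bhol_sum => l; apply: bholM; last exact: bhol_cst.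
by apply: bhol_eq (bhol_horner 'X^l) => z; rewrite hornerXn.
Qed.

Lemma mixed_derivE (d : nat -> C -> C) k j : (forall j, polar (d j)) ->
  (forall z, disc z -> bergman1 (fun x => kernel1 z x^*) /\
    forall j, taylor j (fun x => kernel1 z x^*) = d j z) ->
  mixed_deriv K k j 0 0 =
  k`!%:R * (j`!%:R * (taylor k (d j) + taylor k (kernel0_taylor j))).
Proof.
move=> pd hd; have bd := (pd j).1; have b0 := bhol_bergman1 (kernel0_taylor_bhol j).
rewrite -(taylorD k bd b0) -(taylorZ _ _ (bergman1D bd b0)).
apply: derive1n_taylor; first exact: bergman1Z (bergman1D bd b0).
move=> z dz; rewrite conjC0; have [b1 hz] := hd z dz.
have [b2 h0] := kernel0_taylorE j dz.
rewrite -hz -h0 -(taylorD j b1 b2); apply: derive1n_taylor; first exact: bergman1D.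
by move=> x _; rewrite /kernel1 subrK.
Qed.

(** [qrecip * kernel0_taylor j] is a polynomial, whose truncation is explicit. *)
Lemma kernel0_taylor_expand j z : disc z ->
  \sum_(k < n) taylor k (kernel0_taylor j) * Tterm a k z =
  j.+1%:R * Tterm a j z +
  \sum_(m < s) pc m * \sum_(l < j.+1) a m ^+ (j - l) * (Qterm a m l).[z].
Proof.
move=> dz; pose G : {poly C} := j.+1%:R *: ('X^j * qrecip a) +
  \sum_(m < s) pc m *: \sum_(l < j.+1) a m ^+ (j - l) *: ('X^l * qrecip_omit a m).
have hG x : disc x -> (qrecip a).[x] * kernel0_taylor j x = G.[x].
  move=> dx; rewrite /G hornerD hornerZ hornerM hornerXn mulrDr; congr (_ + _); first by ring.
  rewrite horner_sum mulr_sumr; apply: eq_bigr => m _.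
  rewrite hornerZ horner_sum (qrecip_split a m) hornerM horner_linear_recip.
  have n0 := geometric_neq0 (disc_conj (ha m)) dx.
  set u := 1 - _ in n0 *; set q := (qrecip_omit a m).[x].
  rewrite (_ : _ * _ = (u * u^-1) * (pc m * (q * \sum_(l < j.+1) x ^+ l * a m ^+ (j - l)))); last by ring.
  rewrite divff // mul1r; congr (_ * _); rewrite mulr_sumr; apply: eq_bigr => l _.
  by rewrite hornerZ hornerM hornerXn -/q; ring.
have := taylor_truncation_poly n (bhol_bergman1 (kernel0_taylor_bhol j)) hG.
move=> /(congr1 (fun Q => Q.[z])); rewrite horner_sum => h.
transitivity (take_poly n G).[z].
  by rewrite -h; apply: eq_bigr => k _; rewrite hornerZ horner_Tterm.
rewrite /G take_polyD take_polyZ take_poly_sum hornerD hornerZ horner_Tterm horner_sum.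
congr (_ + _); apply: eq_bigr => m _; rewrite take_polyZ take_poly_sum hornerZ horner_sum.
by congr (_ * _); apply: eq_bigr => l _; rewrite take_polyZ hornerZ.
Qed.

(** Truncate [z^l qrecip_omit = qrecip * (z^l / (1 - (a m)^* z))]. *)
Lemma Qterm_expand m l x : disc x ->
  (Qterm a m l).[x] = \sum_(k < n) (if (l <= k)%N then (a m)^* ^+ (k - l) else 0) * Tterm a k x.
Proof.
move=> dx; have dm := disc_conj (ha m).
pose f y := 'X^l.[y] * (1 - (a m)^* * y)^-1.
have bf : bergman1 f by apply: bergman1_horner; exact: bergman1_geometric.
have hG y : disc y -> (qrecip a).[y] * f y = ('X^l * qrecip_omit a m).[y].
  move=> dy; rewrite (qrecip_split a m) !hornerM horner_linear_recip /f.
  by have n0 := geometric_neq0 dm dy; field.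
rewrite /Qterm -(taylor_truncation_poly n bf hG) horner_sum.
apply: eq_bigr => k _; rewrite hornerZ horner_Tterm; congr (_ * _).
rewrite /f taylor_horner_mul; last exact: bergman1_geometric.
case: leqP => [lk|kl].
  have lk' : (l < k.+1)%N by [].
  rewrite (bigD1 (Ordinal lk')) //= coefXn eqxx mul1r taylor_geometric // big1 ?addr0 // => i il.
  rewrite coefXn (_ : (i == l :> nat) = false) ?mul0r //.
  by apply/negbTE; apply: contra il => /eqP il; apply/eqP; apply: val_inj.
rewrite big1 // => i _; rewrite coefXn (_ : (i == l :> nat) = false) ?mul0r //.
by apply/negbTE; rewrite neq_ltn (leq_ltn_trans _ kl) // -ltnS ltn_ord.
Qed.

(** The part of the double sum due to [kernel0]. Summing over [k] first gives
    [Qterm] in [z], and summing over [j] gives [Qterm] in [x]. *)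
Lemma kernel0_part z x : disc z -> disc x ->
  \sum_(k < n) \sum_(j < n) taylor k (kernel0_taylor j) * Tterm a k z * (Tterm a j x)^* =
  \sum_(k < n) k.+1%:R * Tterm a k z * (Tterm a k x)^* +
  \sum_(m < s) pc m * Lterm a m z x.
Proof.
move=> dz dx; rewrite exchange_big /=.
under eq_bigr => j _ do rewrite -mulr_suml kernel0_taylor_expand // mulrDl.
rewrite big_split /=; congr (_ + _).
under eq_bigr => j _ do rewrite mulr_suml.
rewrite exchange_big /=; apply: eq_bigr => m _.
under eq_bigr => j _ do rewrite -mulrA.
rewrite -mulr_sumr; congr (_ * _); rewrite LtermE.
under [RHS]eq_bigr => l _ do rewrite (Qterm_expand m l dx) (rmorph_sum conjc) mulr_sumr /=.
rewrite [RHS]exchange_big /=; apply: eq_bigr => j _; rewrite mulr_suml.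
rewrite (big_ord_widen n (fun l => a m ^+ (j - l) * (Qterm a m l).[z] * (Tterm a j x)^*)); last exact: ltn_ord.
rewrite big_mkcond /=; apply: eq_bigr => l _; rewrite ltnS.
case: leqP => _; last by rewrite mul0r (rmorph0 conjc) mulr0.
have E : ((a m)^* ^+ (j - l))^* = a m ^+ (j - l) by rewrite (rmorphXn conjc) /= conjcK.
by rewrite [X in _ = _ * X]conjc_mul E mulrCA !mulrA.
Qed.

(** Expand in [x^*] first, then each coefficient in [z]; the mixed derivatives of
    [K] are those of [kernel1] plus those of [kernel0]. *)
Lemma kernel1_formula z x : disc z -> disc x ->
  (qstar a x)^* * qstar a z * kernel1 z x = Jfun a p K z x.
Proof.
move=> dz dx; have [d [pd hd]] := kernel1_taylor; have dx' := disc_conj dx.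
have [b1 hz] := hd z dz; have [G sG hG] := kernel1_poly_conj dz.
have E1 : (qstar a x)^* * kernel1 z x = \sum_(j < n) d j z * (Tterm a j x)^*.
  have := hG x^* dx'; rewrite horner_qconj !conjcK => ->.
  rewrite -(take_poly_id sG) -(taylor_truncation_poly n b1 hG) horner_sum.
  apply: eq_bigr => j _; rewrite hornerZ hz; congr (_ * _).
  rewrite (_ : take_poly n _ = map_poly conjc (take_poly n ('X^j * qrecip a))).
    by rewrite horner_conj conjcK horner_Tterm.
  apply/polyP => i; rewrite coef_map /= !coef_take_poly -!commr_polyXn !coefMXn.
  by case: (i < n)%N; case: (i < j)%N; rewrite ?(rmorph0 conjc) ?coef_map.
rewrite mulrAC E1 mulr_suml.
have E2 j : d j z * (Tterm a j x)^* * qstar a z =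
    \sum_(k < n) taylor k (d j) * Tterm a k z * (Tterm a j x)^*.
  by rewrite -mulr_suml -(polar_expand (pd j) dz) horner_qrecip; ring.
under eq_bigr => j _ do rewrite E2.
rewrite exchange_big /= /Jfun -addrA -opprD -(kernel0_part dz dx) -sumrB.
apply: eq_bigr => k _; rewrite -sumrB; apply: eq_bigr => j _.
rewrite (mixed_derivE _ _ pd hd) -!mulrBl; congr (_ * _ * _).
have nz i : (i`!%:R : C) != 0 by rewrite pnatr_eq0 -lt0n fact_gt0.
by field; rewrite !nz.
Qed.

Lemma kernel_formula z x : disc z -> disc x ->
  K z x = kernel0 z x + Jfun a p K z x / ((qstar a x)^* * qstar a z).
Proof.
move=> dz dx; rewrite -kernel1_formula //.
have nq y : disc y -> qstar a y != 0.
  by move=> dy; apply/prodf_neq0 => k _; apply: geometric_neq0 => //; exact: disc_conj.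
rewrite mulrC mulKf; first by rewrite /kernel1 addrC subrK.
by rewrite mulf_neq0 ?nq // conjc_eq0 nq.
Qed.

End Kernel.

Lemma reorder_denominators (F : fieldType) (c z x b b' : F) :
  c / (1 - b * x) * ((1 - b' * z)^-1 / (1 - x * z)) =
  c / ((1 - z * x) * (1 - z * b') * (1 - b * x)).
Proof. by rewrite [x * z]mulrC [b' * z]mulrC !invfM -!mulrA; congr (_ * _); ring. Qed.

Theorem theorem1p1 (R : realType) (s : nat) (a : 'I_s -> R[i])
    (p : 'I_s -> R) (K : R[i] -> R[i] -> R[i]) :
  (1 <= s)%N ->
  (forall k, disc (a k)) ->
  injective a ->
  (forall k, - 2 < p k) ->
  reproducing_kernel (weight a p) K ->
  forall z zeta : R[i], disc z -> disc zeta ->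
  K z zeta =
    1 / (1 - z * zeta^*) ^+ 2
    + \sum_(k < s) pcoef a p k /
        ((1 - z * zeta^*) * (1 - z * (a k)^*) * (1 - a k * zeta^*))
    + Jfun a p K z zeta / ((qstar a zeta)^* * qstar a z).
Proof.
move=> s0 ha inj_a hp hK z x dz dx; rewrite (kernel_formula s0 ha inj_a hp hK dz dx).
congr (_ + _); rewrite /kernel0; congr (_ + _).
  by rewrite [_ * z]mulrC div1r expr2 invfM.
by apply: eq_bigr => k _; exact: reorder_denominators.
Qed.
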